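(* For each of the following directed graphs $G$ (specified by the vertex set and by the set $\mathrm{Out}(x)$ of out-neighbours of each vertex $x$), for all sufficiently small $p>0$ the trapping game on $G$ with trap probability $p$ has, from every vertex, positive probability of a draw: (1) for every $d\ge 3$: vertex set $\{x\in\mathbb{Z}^d:\sum_i x_i \text{ is even}\}$, with $\mathrm{Out}(x)=\{x\pm e_i+e_d:1\le i\le d-1\}$; (2) for $d=3$ and $d=4$: vertex set $\{x\in\mathbb{Z}^d: x_i\equiv x_j \bmod 2\text{ for all } i,j\}$, with $\mathrm{Out}(x)=\{x\pm e_1\pm e_2\pm\dots\pm e_{d-1}+e_d\}$ (all $2^{d-1}$ choices of signs); (3) for $d=3$: vertex set $\mathbb{Z}^d$, with $\mathrm{Out}(x)=\{x+\sum_{i\in S}e_i: S\subset\{1,\dots,d\},\ 1\le|S|\le d-1\}$; (4) for $d=3$ with $r=1$, and for $d=4$ with $r=1$ or $r=2$: vertex set $\{x\in\mathbb{Z}^d:\sum_i x_i\equiv 0\text{ or } r \bmod d\}$, with $\mathrm{Out}(x)=\{x+\sum_{i\in S}e_i: S\subset\{1,\dots,d\},\ |S|=r\}$ if $\sum_i x_i\equiv 0\bmod d$, and $\mathrm{Out}(x)=\{x+\sum_{i\in S}e_i: S\subset\{1,\dots,d\},\ |S|=d-r\}$ if $\sum_i x_i\equiv r\bmod d$.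
   Context: $e_i$ denotes the $i$th standard basis vector of $\mathbb{Z}^d$. **Trapping game on $G$ with parameter $p$.** Each vertex is independently a *trap* with probability $p$ and *open* with probability $1-p$. A token starts at some vertex; two players, who both know the whole configuration, move alternately. If the token is at $x$, a move consists of moving it to an open vertex in $\mathrm{Out}(x)$; if all vertices in $\mathrm{Out}(x)$ are traps, the player to move loses. A strategy for a player is a map assigning a legal move, where one exists, to each vertex; a winning strategy is one that results in a win for that player (in finitely many moves) whatever strategy the other player uses. The game from a vertex is a *draw* if neither player has a winning strategy. (By convention, if the starting vertex is a trap the game from it is regarded as a win for the first player.) *)

(* Defs.v *)
From HB Require Import structures.
From mathcomp Require Import all_boot all_order all_algebra finmap.
From mathcomp Require Import all_classical all_reals all_analysis.

Set Implicit Arguments.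
Unset Strict Implicit.
Unset Printing Implicit Defensive.

Import Order.TTheory GRing.Theory Num.Theory.

Local Open Scope classical_set_scope.
Local Open Scope ring_scope.

Section Game.
Variables (V : Type) (Out : V -> set V) (trap : set V).

Definition legal (x : V) : set V := Out x `\` trap.

Definition stuck (x : V) : Prop := legal x = set0.

(* The value of a strategy at a stuck vertex is unconstrained and never used. *)
Definition strategy (s : V -> V) : Prop :=
  forall x, ~ stuck x -> legal x (s x).

(* Position after n moves, s being used at the even times and t at the odd
   ones; meaningful up to and including the first stuck position. *)
Fixpoint position (s t : V -> V) (x : V) (n : nat) : V :=
  if n is m.+1 then (if odd m then t else s) (position s t x m) else x.

Definition ends_at (s t : V -> V) (x : V) (n : nat) : Prop :=
  stuck (position s t x n) /\ forall m, (m < n)%N -> ~ stuck (position s t x m).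

(* The player to move at the end loses. By convention a game starting at a trap
   is a win for the first player. *)
Definition first_wins (s t : V -> V) (x : V) : Prop :=
  trap x \/ exists2 n, odd n & ends_at s t x n.

Definition second_wins (s t : V -> V) (x : V) : Prop :=
  ~ trap x /\ exists2 n, ~~ odd n & ends_at s t x n.

Definition first_winning_strategy (x : V) (s : V -> V) : Prop :=
  strategy s /\ forall t, strategy t -> first_wins s t x.

Definition second_winning_strategy (x : V) (t : V -> V) : Prop :=
  strategy t /\ forall s, strategy s -> second_wins s t x.

Definition draw (x : V) : Prop :=
  ~ (exists s, first_winning_strategy x s) /\
  ~ (exists t, second_winning_strategy x t).

End Game.

Section RandomTraps.
Local Open Scope ereal_scope.

Definition mutually_independent_events (R : realType) (d : measure_display)
    (Omega : measurableType d) (P : probability Omega R) (V : choiceType)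
    (E : V -> set Omega) : Prop :=
  forall F : {fset V},
    P (\bigcap_(v in [set` F]) E v) = \prod_(v <- F) P (E v).

(* E v is the event that the vertex v is a trap. *)
Definition random_traps (R : realType) (p : R) (d : measure_display)
    (Omega : measurableType d) (P : probability Omega R) (V : choiceType)
    (E : V -> set Omega) : Prop :=
  [/\ forall v, measurable (E v),
      forall v, P (E v) = p%:E &
      mutually_independent_events P E].

Definition draw_event (V : Type) (Out : V -> set V) (Omega : Type)
    (E : V -> set Omega) (x : V) : set Omega :=
  [set w | draw Out [set v | E v w] x].

Definition draws_for_small_p (R : realType) (V : choiceType)
    (Out : V -> set V) : Prop :=
  exists2 p0 : R, (0 < p0)%R &
    forall p : R, (0 < p < p0)%R ->
    forall (d : measure_display) (Omega : measurableType d)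
      (P : probability Omega R) (E : V -> set Omega),
      random_traps p P E ->
      forall x : V,
        measurable (draw_event Out E x) /\ 0 < P (draw_event Out E x).

End RandomTraps.

Section Graphs.
Variable d : nat.

(* 1-based: basis_vec i is the i-th standard basis vector of Z^d for
   1 <= i <= d. *)
Definition basis_vec (i : nat) : 'rV[int]_d := \row_(j < d) (j.+1 == i)%:R.

Definition coord_sum (x : 'rV[int]_d) : int := \sum_(i < d) x ord0 i.

(* {1, ..., d} is encoded as 'I_d, the ordinal i standing for i.+1. *)
Definition subset_vec (S : {set 'I_d}) : 'rV[int]_d :=
  \sum_(i in S) basis_vec i.+1.

Definition V1 : choiceType := {x : 'rV[int]_d | (2 %| coord_sum x)%Z}.

Definition Out1 (x : V1) : set V1 :=
  [set y | exists2 i : nat, (1 <= i <= d - 1)%N &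
    val y = val x + basis_vec i + basis_vec d \/
    val y = val x - basis_vec i + basis_vec d].

Definition V2 : choiceType :=
  {x : 'rV[int]_d |
    [forall i, forall j, (x ord0 i == x ord0 j %[mod 2])%Z]}.

Definition Out2 (x : V2) : set V2 :=
  [set y | exists sgn : nat -> bool,
    val y =
      val x + (\sum_(1 <= i < d) (-1) ^+ sgn i *: basis_vec i) + basis_vec d].

Definition V3 : choiceType := 'rV[int]_d.

Definition Out3 (x : V3) : set V3 :=
  [set y | exists2 S : {set 'I_d}, (1 <= #|S| <= d - 1)%N &
    y = x + subset_vec S].

Variable r : nat.

Definition V4 : choiceType :=
  {x : 'rV[int]_d |
    (coord_sum x == 0 %[mod d])%Z || (coord_sum x == r%:Z %[mod d])%Z}.

(* For 0 < r < d the two congruences are exclusive. *)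
Definition Out4 (x : V4) : set V4 :=
  [set y | exists2 S : {set 'I_d},
    #|S| = (if (coord_sum (val x) == 0 %[mod d])%Z then r else d - r)%N &
    val y = val x + subset_vec S].

End Graphs.

(* Main.v *)
Require Import Defs.
From HB Require Import structures.
From mathcomp Require Import all_boot all_order all_algebra.
From mathcomp Require Import ring lra zify.

(* In each graph the game only moves up the levels of a layered structure, and
   whether a vertex is decided within n moves depends on the traps near it. The
   vertices can be written as pairs (v, j), with v in a lattice of one dimension
   less and j a time, so that the out-neighbours of (v, j) are the (w, k) with w
   adjacent to v and k the earliest possible time. A position is
   lost for the player to move iff it is open and none of its out-neighbours is
   lost for the player to move there; read backwards in time, this is a sequential
   heat-bath update of a configuration I: the site v is put into I iff its coin
   shows "open" and no neighbour is in I. On a finite torus with the configuration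
   frozen outside a box these updates preserve the hard-core measure with
   fugacity (1 - p) / p. Two runs with the same traps and different frozen
   configurations agree at a vertex which is decided within n moves, hence the
   probability that it is undecided is at least the difference of its
   occupation probabilities under the two hard-core measures. This is bounded
   below uniformly in n when the hard-core model has a phase transition, which for
   small p is shown by a Peierls argument.

   For the bipartite lattices (1), (2), (4) the contours are the edge boundaries of
   a set B which is closed under passing from even to odd sites. Exchanging the
   two phases inside B turns its weight into that of the mirror image of B; as
   the steps are not assumed to have any symmetry, the partition functions of B and
   of its mirror image are compared by supermodularity of the weights (which
   bounds them by the one of the whole torus) and by the symmetry of the
   torus that exchanges the two phases. For the triangular lattice (3) the three
   phases differ by translations, and a contour is erased by translating the
   configuration by a Z/3-valued potential which jumps across the contour. *)

Set Implicit Arguments.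
Unset Strict Implicit.
Unset Printing Implicit Defensive.

Import Order.TTheory GRing.Theory Num.Theory.

(** The counting step of a Peierls argument wants connected contours. Their connectedness is not
    taken from topology here: the boundary of a phase region is cut into components on a scale at
    which every elementary parallelogram sees at most one of them, so each component carries a
    closed discrete form of its own. Integrating this form along a line, from a site to a cut where
    everything is frozen, gives a potential that plays the role of the interior of the component.
    This is why [0] and two unit vectors must be among the steps and why the first coordinates of
    steps are 0 or 1. A nonzero potential at a site also forces the component to meet the line on
    both sides of the site, which bounds its distance by its size. Both phases err with probability
    at most 1/4, which leaves at least 1/2 for a draw. *)

Section Independent.
Variables (T : finType) (e : rel T).

Definition free (I : {set T}) v := [forall w in I, ~~ e v w].

Definition indep (I : {set T}) := [forall v in I, free I v].

(** The configurations of the hard-core model on [L] with boundary condition [I0]; the weight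
    [la ^+ #|I|] is written out where it is used. *)
Definition hc_conf (L I0 : {set T}) : {set {set T}} :=
  [set I | indep I && (I :\: L == I0 :\: L)].

(** Every walk of fewer than [k] steps from [v] stays in [L], so a game of fewer than [k] moves sees
    only sites that get updated. *)
Fixpoint deep (L : {set T}) k v : bool :=
  if k is k'.+1 then (v \in L) && [forall w, e v w ==> deep L k' w] else true.

Lemma indepP (I : {set T}) : reflect {in I &, forall v w, ~~ e v w} (indep I).
Proof.
apply: (iffP forall_inP) => [H v w vI wI|H v vI].
  by move/forall_inP: (H v vI); apply.
by apply/forall_inP => w wI; exact: H.
Qed.

End Independent.

Local Open Scope ring_scope.

(** * Connected contours on a torus *)

Section RaySum.
Variables (Gam : finZmodType) (N : nat).
Variables (h1 h2 : {additive Gam -> 'Z_N.+2}) (e1 e2 : Gam).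
Hypotheses (h1e1 : h1 e1 = 1) (h2e1 : h2 e1 = 0) (h2e2 : h2 e2 = 1).
Hypothesis e1N : e1 *+ N.+2 = 0.

Local Notation height a := (nat_of_ord (h1 a)).

Lemma h1_line a k : h1 (a + e1 *+ k) = h1 a + k%:R.
Proof. by rewrite raddfD raddfMn /= h1e1. Qed.

Lemma h2_line a k : h2 (a + e1 *+ k) = h2 a.
Proof. by rewrite raddfD raddfMn /= h2e1 mul0rn addr0. Qed.

Lemma height_line a k :
  height (a + e1 *+ k) = ((height a + k) %% N.+2)%N.
Proof. by rewrite h1_line /= val_Zp_nat // modnDmr. Qed.

Variables (A : zmodType) (J : Type) (s : J -> Gam) (D : J -> Gam -> A) (D1 : Gam -> A).
Hypothesis h1s : forall j, h1 (s j) = 0 \/ h1 (s j) = 1.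
Hypothesis D_closed : forall j a, D1 a + D j (a + e1) = D j a + D1 (a + s j).
Hypothesis D_cut : forall j a, height a = 0%N \/ height a = N.+1 -> D j a = 0.
Hypothesis D1_cut : forall a, height a = 0%N \/ height a = N.+1 -> D1 a = 0.
Hypothesis D1_cut2 : forall a, h2 a = 0 -> D1 a = 0.
Hypothesis e2s : exists j, s j = e2.

Lemma strip_telescope j a m :
  \sum_(k < m) D1 (a + s j + e1 *+ k) - \sum_(k < m) D1 (a + e1 *+ k) =
    D j (a + e1 *+ m) - D j a.
Proof.
elim: m => [|m IH]; first by rewrite !big_ord0 mulr0n addr0 subr0 subrr.
rewrite !big_ord_recr /= opprD addrACA IH.
have H : D1 (a + s j + e1 *+ m) =
    D j (a + e1 *+ m.+1) + D1 (a + e1 *+ m) - D j (a + e1 *+ m).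
  have := D_closed j (a + e1 *+ m); rewrite -[a + _ + e1]addrA -mulrSr.
  move=> E; rewrite [D j _ + D1 _]addrC E [a + s j + _]addrAC.
  by rewrite [RHS]addrAC subrr add0r.
by rewrite H [_ - _ - D1 _]addrAC addrK addrC addrA subrK.
Qed.

(** The sum does not change when the circle is translated by [e2], and on the circle [h2 = 0] every
    term vanishes. This vanishing period makes the form exact on the torus. *)
Lemma circle_sum0 a : \sum_(k < N.+2) D1 (a + e1 *+ k) = 0.
Proof.
have [j sj] := e2s.
have step b : \sum_(k < N.+2) D1 (b + e2 + e1 *+ k) = \sum_(k < N.+2) D1 (b + e1 *+ k).
  by apply/eqP; rewrite -subr_eq0 -sj strip_telescope e1N addr0 subrr.
have steps m : \sum_(k < N.+2) D1 (a + e2 *+ m + e1 *+ k) =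
    \sum_(k < N.+2) D1 (a + e1 *+ k).
  by elim: m => [|m IH]; rewrite ?mulr0n ?addr0 // mulrSr addrA step.
rewrite -(steps (N.+2 - nat_of_ord (h2 a))%N); apply: big1 => k _.
apply: D1_cut2; rewrite h2_line raddfD raddfMn /= h2e2.
apply: val_inj; rewrite /= val_Zp_nat // modnDmr subnKC ?modnn //.
exact: ltnW.
Qed.

(** The potential of the form, normalized to 0 on the cut at height 0 and integrated along [e1] from
    [a] up to that cut. *)
Definition ray_sum a := - \sum_(k < N.+2 - height a) D1 (a + e1 *+ k).

Lemma height_last a : height (a + e1 *+ (N.+2 - height a)) = 0%N.
Proof. by rewrite height_line subnKC ?modnn // ltnW. Qed.

(** Telescoping over the strip between the rays of [a] and [a + s j] leaves [D j] at the two ends,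
    and the upper end lies on the cut. If [s j] raises the height, the rays differ by a term at
    height 0, which vanishes. *)
Lemma ray_sumE j a : ray_sum (a + s j) - ray_sum a = D j a.
Proof.
have ha : (height a < N.+2)%N := ltn_ord (h1 a); have tele := strip_telescope j a (N.+2 - height a).
rewrite (D_cut j (or_introl (height_last a))) sub0r in tele.
have E : height (a + s j) = ((height a + nat_of_ord (h1 (s j))) %% N.+2)%N.
  by rewrite raddfD.
have main : \sum_(k < N.+2 - height (a + s j)) D1 (a + s j + e1 *+ k) =
    \sum_(k < N.+2 - height a) D1 (a + s j + e1 *+ k) ->
    ray_sum (a + s j) - ray_sum a = D j a.
  by rewrite /ray_sum => ->; rewrite opprK addrC -[RHS]opprK -tele opprB.
case: (h1s j) => hs; rewrite hs in E.
  by apply: main; rewrite E addn0 modn_small.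
rewrite (_ : nat_of_ord (1 : 'Z_N.+2) = 1%N) // in E.
(* From height [N.+1] a rising step wraps to height 0, so the new ray is a full circle. *)
have [hN|hN] := eqVneq (height a) N.+1.
  rewrite (D_cut j (or_intror hN)) /ray_sum E hN addn1 modnn subn0 circle_sum0 subSnn.
  by rewrite big_ord_recr big_ord0 /= mulr0n addr0 add0r (D1_cut (or_intror hN)) subrr.
apply: main; rewrite modn_small in E; last by lia.
have -> : (N.+2 - height a = (N.+2 - height (a + s j)%R).+1)%N by rewrite E; lia.
by rewrite big_ord_recr /= (D1_cut (or_introl (height_last _))) addr0.
Qed.

(** The sum over the ray above [a] is minus the sum over the rest of the circle, so both arcs
    contain a nonzero term: the contour that carries [D1] lies on both sides of [a]. *)
Lemma ray_sum_hits a : ray_sum a != 0 ->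
  (exists2 k, D1 (a + e1 *+ k) != 0 &
     height (a + e1 *+ k) = (height a + k)%N) /\
  (exists2 k, D1 (a + e1 *+ k) != 0 & (height (a + e1 *+ k)%R < height a)%N).
Proof.
have ha : (height a < N.+2)%N := ltn_ord (h1 a); rewrite oppr_eq0 => nz.
have ex m (F : 'I_m -> A) : \sum_(k < m) F k != 0 -> exists k, F k != 0.
  move=> S0; apply/existsP; apply: contraNT S0; rewrite negb_exists.
  by move=> /forallP H; rewrite big1 // => k _; apply/eqP; rewrite -[_ == _]negbK.
split.
  have [k Dk] := ex _ _ nz; exists (k : nat) => //.
  by rewrite height_line modn_small //; have := ltn_ord k; lia.
have := circle_sum0 a.
rewrite -(big_mkord xpredT (fun k => D1 (a + e1 *+ k))).
rewrite (@big_cat_nat _ _ _ (N.+2 - height a)%N) ?leq_subr //= big_mkord => /eqP.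
rewrite addr_eq0 => /eqP nzE; rewrite nzE oppr_eq0 in nz.
rewrite -{1}[(N.+2 - _)%N]add0n big_addn big_mkord in nz.
have [k Dk] := ex _ _ nz; exists (k + (N.+2 - height a))%N => //.
have kh : (k < height a)%N by have := ltn_ord k; lia.
rewrite height_line (_ : (_ + _ = k + N.+2)%N); last by lia.
by rewrite modnDr modn_small //; lia.
Qed.

End RaySum.

(** * Counting connected sets by walks *)

Section Contours.
Variables (Gam : finZmodType) (K : finType) (disp : K -> Gam).
Hypothesis disp0 : exists k, disp k = 0.
Hypothesis disp_opp : forall k, exists k', disp k' = - disp k.

Definition near a b := [exists k, b == a + disp k].

Definition near_in (U : {set Gam}) : rel Gam :=
  [rel a b | [&& a \in U, b \in U & near a b]].

Definition component (U : {set Gam}) a := [set b | connect (near_in U) a b].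

Definition near_connected (U : {set Gam}) :=
  [forall a in U, forall b in U, connect (near_in U) a b].

Lemma near_sym : symmetric near.
Proof.
suff H a b : near a b -> near b a by move=> a b; apply/idP/idP; exact: H.
move=> /existsP[k /eqP ->]; have [k' k'E] := disp_opp k.
by apply/existsP; exists k'; rewrite k'E addrK.
Qed.

Lemma near_in_sym U : symmetric (near_in U).
Proof. by move=> a b; rewrite /near_in /= near_sym andbCA. Qed.

Lemma near_in_connect_sym U : connect_sym (near_in U).
Proof. exact: sym_connect_sym (near_in_sym U). Qed.

Lemma component_connect (U : {set Gam}) a b : b \in component U a ->
  connect (near_in (component U a)) a b.
Proof.
rewrite inE => /connectP[p pp ->].
elim/last_ind: p pp => [//|p c IH]; rewrite rcons_path last_rcons => /andP[pp pc].
have lp : connect (near_in U) a (last a p) by apply/connectP; exists p.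
apply: connect_trans (IH pp) (connect1 _).
rewrite /near_in /= !inE lp (connect_trans lp (connect1 pc)) /=.
by case/and3P: pc.
Qed.

Lemma component_connected U a : near_connected (component U a).
Proof.
apply/forall_inP => b bC; apply/forall_inP => c cC.
apply: connect_trans (component_connect cC).
by rewrite near_in_connect_sym; exact: component_connect.
Qed.

Lemma component_sub (U : {set Gam}) a : a \in U -> component U a \subset U.
Proof.
move=> aU; apply/subsetP => b; rewrite inE => /connectP[p pp ->].
elim/last_ind: p pp => [//|p c IH]; rewrite rcons_path last_rcons.
by case/andP => _ /and3P[].
Qed.

Lemma component_near (U : {set Gam}) a b c :
  b \in component U a -> c \in U -> b \in U -> near b c -> c \in component U a.
Proof.
rewrite !inE => ab cU bU bc; apply: connect_trans ab (connect1 _).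
by rewrite /near_in /= bU cU bc.
Qed.

Fixpoint walk_points a (w : seq K) : seq Gam :=
  if w is k :: w' then a :: walk_points (a + disp k) w' else [:: a].

Definition walk_end a (w : seq K) := foldl (fun b k => b + disp k) a w.

Lemma mem_walk_cat a w1 w2 x : (x \in walk_points a (w1 ++ w2)) =
  (x \in walk_points a w1) || (x \in walk_points (walk_end a w1) w2).
Proof.
elim: w1 a => [|k w1 IH] a /=; last by rewrite !inE IH orbA.
by case: w2 => [|k w2]; rewrite /= !inE ?orbb // orbA orbb.
Qed.

Lemma mem_walkP a w x : x \in walk_points a w ->
  exists w1 w2, w = w1 ++ w2 /\ walk_end a w1 = x.
Proof.
elim: w a => [|k w IH] a /=; rewrite inE.
  by move=> /eqP ->; exists [::], [::].
case/orP=> [/eqP ->|/IH[w1 [w2 [-> E]]]]; first by exists [::], (k :: w).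
by exists (k :: w1), w2.
Qed.

(** The walk goes around a growing tree: a point of [C] next to the visited set is inserted by a
    detour of two steps, from a visited neighbour and back. *)
Lemma walk_cover (C : {set Gam}) a m : near_connected C -> a \in C -> (m < #|C|)%N ->
  exists w, [/\ size w = (2 * m)%N, {subset walk_points a w <= C} &
    (m < #|[set x in walk_points a w]|)%N].
Proof.
move=> conn aC; elim: m => [|m IH] mC.
  exists [::]; split=> //; first by move=> x; rewrite inE => /eqP ->.
  by apply/card_gt0P; exists a; rewrite !inE.
have [w [szw sub mw]] := IH (ltnW mC).
set W := [set x in walk_points a w].
have WC : W \subset C by apply/subsetP => x; rewrite inE => /sub.
have [mW|Wm] := ltnP m.+1 #|W|.
  (* The walk already visits enough points; two null steps give it the prescribed length. *)
  have [k0 k0E] := disp0; exists [:: k0, k0 & w].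
  have E x : (x \in walk_points a [:: k0, k0 & w]) = (x \in walk_points a w).
    rewrite /= !k0E !addr0 !inE; case: eqP => [->|//]; case: (w) => [|k s] /=;
      by rewrite inE eqxx.
  split; first by rewrite /= szw; lia.
    by move=> x; rewrite E => /sub.
  by rewrite (_ : [set x in _] = W) //; apply/setP => x; rewrite !in_set E.
have [c cC cW] : exists2 c, c \in C & c \notin W.
  apply/exists_inP; apply: contraTT mC; rewrite negb_exists => /forallP H.
  rewrite -leqNgt (leq_trans _ Wm) // subset_leq_card //; apply/subsetP => x xC.
  by have := H x; rewrite xC /= negbK.
have aW : a \in W by rewrite inE; case: (w) => [|k s] /=; rewrite mem_head.
have /connectP[q qp qc] : connect (near_in C) a c.
  by move/forall_inP: conn => /(_ a aC) /forall_inP /(_ c cC).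
have [g [h [gW hW hC gh]]] : exists g h, [/\ g \in W, h \notin W, h \in C & near g h].
  elim: q (a) aW qp qc => [|b q IHq] z zW /=; first by move=> _ E; rewrite E zW in cW.
  case/andP=> /and3P[_ bC zb] qp qc.
  by have [/IHq|bW] := boolP (b \in W); [apply|exists z, b].
have gw : g \in walk_points a w by rewrite inE in gW.
have [w1 [w2 [wE gE]]] := mem_walkP gw.
have /existsP[k /eqP hE] := gh; have [k' k'E] := disp_opp k.
have E x : (x \in walk_points a (w1 ++ [:: k, k' & w2])) = (x \in walk_points a w) || (x == h).
  rewrite wE !mem_walk_cat gE /= -hE k'E hE addrK !inE -hE.
  rewrite -!orbA; case: (x \in walk_points a w1) => //=.
  have [->|_] := eqVneq x g; last by rewrite /= orbC.
  by case: (w2) => [|? ?] /=; rewrite inE eqxx.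
exists (w1 ++ [:: k, k' & w2]); split.
- by rewrite size_cat /= !addnS -size_cat -wE szw mulnS.
- by move=> x; rewrite E => /orP[/sub|/eqP ->].
have -> : [set x in walk_points a (w1 ++ [:: k, k' & w2])] = h |: W.
  by apply/setP => x; rewrite !in_set E orbC inE.
by rewrite cardsU1 hW.
Qed.

Lemma connected_walk (C : {set Gam}) a : near_connected C -> a \in C ->
  exists t : (2 * #|C|).-tuple K, C = [set x in walk_points a t].
Proof.
move=> conn aC; have C0 : (0 < #|C|)%N by apply/card_gt0P; exists a.
have [|w [szw sub cw]] := @walk_cover C a #|C|.-1 conn aC; first by rewrite prednK.
have [k0 k0E] := disp0.
have sz : size [:: k0, k0 & w] == (2 * #|C|)%N by rewrite /= szw -{2}(prednK C0) mulnS add2n.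
exists (Tuple sz); apply/eqP; rewrite eq_sym eqEcard.
have -> : [set x in walk_points a (Tuple sz)] = [set x in walk_points a w].
  apply/setP => x; rewrite !in_set /= !k0E !addr0 !inE.
  by case: eqP => [->|//]; case: (w) => [|k s] /=; rewrite inE eqxx.
rewrite prednK // in cw; rewrite cw andbT.
by apply/subsetP => x; rewrite inE => /sub.
Qed.

Variables (e1 a0 : Gam).

(** Instead of surrounding [a0], a contour has to meet the line through [a0] in direction [e1]
    within distance twice its size. This suffices for counting, and [hits_contours] derives it from
    a nonzero potential at [a0]. *)
Definition contours : {set {set Gam}} :=
  [set C | near_connected C &
    [exists m : 'I_(2 * #|C|).+1, a0 + e1 *+ m \in C]].

Lemma card_contours n :
  (#|[set C in contours | #|C| == n]| <= (2 * n).+1 * #|K| ^ (2 * n))%N.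
Proof.
set F := fun mt : 'I_(2 * n).+1 * (2 * n).-tuple K =>
  [set x in walk_points (a0 + e1 *+ mt.1) mt.2].
apply: (@leq_trans #|[set F x | x in predT]|).
  apply: subset_leq_card; apply/subsetP => C; rewrite !inE.
  move=> /andP[/andP[conn /existsP[m mC]] /eqP Cn].
  have [t Ct] := connected_walk conn mC.
  subst n; apply/imsetP; exists (m, t) => //.
by apply: (leq_trans (leq_imset_card _ _)); rewrite card_prod card_ord card_tuple.
Qed.

(** Since [(2 * n).+1 <= 3 ^ n], the sets of size [n] contribute at most [z ^+ n] with
    [z = 3 * #|K| ^ 2 * y <= 1 / 2]. The empty set is no contour, so the series starts at [n = 1]
    and is at most [2 * z]; hence the 6. *)
Lemma sum_contours (R : realFieldType) (y : R) : 0 <= y ->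
  6%:R * #|K|%:R ^+ 2 * y <= 1 ->
  \sum_(C in contours) y ^+ #|C| <= 6%:R * #|K|%:R ^+ 2 * y.
Proof.
move=> y0 y1; set z := 3%:R * #|K|%:R ^+ 2 * y.
have z0 : 0 <= z by rewrite !mulr_ge0 ?exprn_ge0.
have z1 : 2%:R * z <= 1 by move: y1; rewrite /z; lra.
rewrite (partition_big (fun C : {set Gam} => inord #|C| : 'I_#|Gam|.+1) xpredT) //=.
have cardC (C : {set Gam}) : (#|C| < #|Gam|.+1)%N by rewrite ltnS max_card.
have term (n : 'I_#|Gam|.+1) :
    \sum_(C in contours | inord #|C| == n) y ^+ #|C| <= (n != ord0)%:R * z ^+ n.
  rewrite (eq_bigr (fun=> y ^+ n)); last first.
    by move=> C /andP[_ /eqP <-]; rewrite inordK.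
  rewrite (eq_bigl (mem [set C in contours | #|C| == n])); last first.
    by move=> C; rewrite !inE -(inj_eq val_inj) /= inordK.
  rewrite sumr_const; have [->|n0] := eqVneq n ord0.
    rewrite mul0r (_ : [set C in contours | #|C| == ord0] = set0) ?cards0 ?mulr0n //.
    apply/setP => C; rewrite !inE.
    apply/negP => /andP[/andP[_ /existsP[m mC]] /eqP C0].
    have : (0 < #|C|)%N by apply/card_gt0P; exists (a0 + e1 *+ m).
    by rewrite C0.
  rewrite mul1r -mulr_natr /z !exprMn mulrC ler_wpM2r ?exprn_ge0 //.
  apply: (@le_trans _ _ ((2 * n).+1 * #|K| ^ (2 * n))%:R).
    by rewrite ler_nat card_contours.
  rewrite natrM natrX mul2n -addnn exprD ler_wpM2r ?mulr_ge0 ?exprn_ge0 // -natrX ler_nat addnn -mul2n.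
  by elim: (nat_of_ord n) => // k; rewrite expnS; lia.
apply: (le_trans (ler_sum _ (fun n _ => term n))).
rewrite big_ord_recl /= mul0r add0r.
rewrite (eq_bigr (fun i : 'I_#|Gam| => z * z ^+ i)); last first.
  by move=> i _; rewrite mul1r exprS.
rewrite -mulr_sumr (_ : 6%:R * _ * y = z * 2%:R); last by rewrite /z; ring.
rewrite ler_wpM2l //.
elim: #|Gam| => [|n IH]; first by rewrite big_ord0.
rewrite big_ord_recl expr0.
rewrite (eq_bigr (fun i : 'I_n => z * z ^+ i)); last by move=> i _; rewrite exprS.
rewrite -mulr_sumr.
have : z * \sum_(i < n) z ^+ i <= z * 2%:R by rewrite ler_wpM2l.
lra.
Qed.

End Contours.

(** * Contours that cross a line on both sides of a point *)

Section HeightContours.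
Variables (Gam : finZmodType) (N : nat) (h1 : {additive Gam -> 'Z_N.+2}) (e1 : Gam).
Hypothesis h1e1 : h1 e1 = 1.
Variables (K : finType) (disp : K -> Gam).
Hypothesis h1_disp : forall k, exists u v : nat,
  [/\ (u <= 2)%N, (v <= 2)%N & h1 (disp k) = u%:R - v%:R].

Local Notation height a := (nat_of_ord (h1 a)).

Lemma nat_Zp_le m : (nat_of_ord (m%:R : 'Z_N.+2) <= m)%N.
Proof. by rewrite val_Zp_nat // leq_mod. Qed.

(** From height at least 2, a descent by at most 2 cannot wrap around to the top of the torus. *)
Lemma near_height a b : (2 <= height a)%N -> near disp a b ->
  (height b <= height a + 2)%N.
Proof.
move=> a2 /existsP[k /eqP ->]; have [u [v [u2 v2 E]]] := h1_disp k.
have -> : h1 (a + disp k) = (height a + u - v)%:R.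
  rewrite raddfD /= E natrB ?natrD; last by lia.
  by rewrite addrA natr_Zp.
by apply: (leq_trans (nat_Zp_le _)); lia.
Qed.

Lemma connected_height (C : {set Gam}) a b : near_connected disp C ->
  {in C, forall c, 2 <= height c}%N -> a \in C -> b \in C ->
  (height b <= height a + 2 * #|C|)%N.
Proof.
move=> conn C2 aC bC.
have /connectP[p pp bE] : connect (near_in disp C) a b.
  by move/forall_inP: conn => /(_ a aC) /forall_inP /(_ b bC).
rewrite bE; case/shortenP: pp => q qp uq _.
have qC : {subset q <= C}.
  move=> x; elim: q a qp {uq aC bE} => //= y q IH z /andP[/and3P[_ yC _] qp].
  by rewrite inE => /orP[/eqP ->//|]; exact: IH qp.
have szq : (size q <= #|C|)%N.
  rewrite -(card_uniqP _); last by case/andP: uq.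
  by apply: subset_leq_card; apply/subsetP.
apply: (@leq_trans (height a + 2 * size q)); last by rewrite leq_add2l leq_mul2l.
elim: q a qp aC {uq qC szq bE} => [|y q IH] z /=; first by rewrite muln0 addn0.
case/andP=> /and3P[_ yC zy] qp zC; apply: (leq_trans (IH _ qp yC)).
by rewrite mulnS addnA leq_add2r; exact: near_height (C2 z zC) zy.
Qed.

(** [C] has a point on the line at most as high as [a] and another one above [a]. Their heights
    differ by at most [2 * #|C|], hence the upper one is within that distance of [a]. The
    alternative [k.+1] is there because a jump from [x] to [x + e1] may touch [C] at either end. *)
Lemma hits_contours (C : {set Gam}) a : near_connected disp C ->
  {in C, forall c, 2 <= height c}%N ->
  (exists2 k, (a + e1 *+ k \in C) || (a + e1 *+ k.+1 \in C) &
     height (a + e1 *+ k) = (height a + k)%N) ->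
  (exists2 k, (a + e1 *+ k \in C) || (a + e1 *+ k.+1 \in C) &
     (height (a + e1 *+ k)%R < height a)%N) ->
  C \in contours disp e1 a.
Proof.
move=> conn C2 [k kC kh] [k' k'C k'h].
have line m : height (a + e1 *+ m) = ((height a + m) %% N.+2)%N by exact: height_line.
have [g gC gh] : exists2 m, a + e1 *+ m \in C & height (a + e1 *+ m) = (height a + m)%N.
  case/orP: kC => [kC'|kC']; first by exists k.
  exists k.+1 => //; have := C2 _ kC'; rewrite line addnS.
  have : (height (a + e1 *+ k)%R < N.+2)%N by exact: ltn_ord.
  rewrite kh leq_eqVlt => /orP[/eqP ->|lt _]; first by rewrite modnn.
  by rewrite modn_small.
have [g' g'C g'h] : exists2 m, a + e1 *+ m \in C & (height (a + e1 *+ m)%R <= height a)%N.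
  case/orP: k'C => [kC'|kC']; first by exists k' => //; exact: ltnW.
  exists k'.+1 => //; rewrite mulrSr addrA raddfD /= h1e1.
  apply: leq_trans k'h; apply: (leq_trans (leq_mod _ _)).
  by rewrite (_ : nat_of_ord (1 : 'Z_N.+2) = 1%N) // addn1.
have := connected_height conn C2 g'C gC; rewrite gh => H.
have gm : (g < (2 * #|C|).+1)%N by lia.
by rewrite inE conn; apply/existsP; exists (Ordinal gm).
Qed.

End HeightContours.

Section Components.
Variables (Gam : finZmodType) (K : finType) (disp : K -> Gam).
Hypothesis disp_opp : forall k, exists k', disp k' = - disp k.

Lemma component_eq (U : {set Gam}) a b : b \in component disp U a ->
  component disp U b = component disp U a.
Proof.
rewrite inE => ab; apply/setP => c; rewrite !inE.
by rewrite (same_connect (near_in_connect_sym disp_opp U) ab).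
Qed.

Lemma component_self (U : {set Gam}) a : a \in component disp U a.
Proof. by rewrite inE connect0. Qed.

Lemma sum_components (A : nmodType) (U : {set Gam}) (a : Gam) (x : A) : a \in U ->
  \sum_(C in [set component disp U b | b in U]) x *+ (a \in C) = x.
Proof.
move=> aU; rewrite (bigD1 (component disp U a)) ?imset_f //= component_self.
rewrite big1 ?addr0 // => C /andP[/imsetP[b bU ->]]; case: (boolP (a \in _)) => // aC.
by rewrite (component_eq aC) eqxx.
Qed.

End Components.

(** * The hard-core model on a bipartite torus *)

(** The common form of the mapping arguments below: an injection under which weights do not
    decrease. *)
Lemma sum_inj_le (R : numDomainType) (I K : finType) (h : I -> K) (P : pred I)
    (Q : pred K) (F : I -> R) (G : K -> R) :
  {in P &, injective h} -> (forall i, P i -> Q (h i) /\ F i <= G (h i)) ->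
  (forall k, Q k -> 0 <= G k) ->
  \sum_(i | P i) F i <= \sum_(k | Q k) G k.
Proof.
move=> inj PQ G0.
apply: (@le_trans _ _ (\sum_(i | P i) G (h i))).
  by apply: ler_sum => i /PQ[].
rewrite -[leLHS](big_imset G) //= [leRHS](bigID (mem (h @: [set i | P i]))) /=.
have -> : \sum_(k in h @: P) G k = \sum_(k | Q k && (k \in h @: [set i | P i])) G k.
  apply: eq_bigl => k; apply/imsetP/andP => [[i Pi ->]|[_ /imsetP[i]]].
    by split; [exact: (PQ _ Pi).1|rewrite imset_f ?inE].
  by rewrite inE => Pi ->; exists i.
by rewrite lerDl; apply: sumr_ge0 => k /andP[/G0].
Qed.

(** * Supermodular weights and the four functions theorem *)

Section Supermodular.
Variables (R : realFieldType) (T : finType) (w : {set T} -> R).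
Hypothesis w0 : forall A, 0 <= w A.
Hypothesis wUI : forall A B, w A * w B <= w (A :|: B) * w (A :&: B).

Definition subset_sum (A : {set T}) := \sum_(X : {set T} | X \subset A) w X.

(* The two-point case of the Ahlswede-Daykin four functions theorem. *)
Lemma four_functions_bool (a0 a1 b0 b1 c0 c1 d0 d1 : R) :
  0 <= a0 -> 0 <= a1 -> 0 <= b0 -> 0 <= b1 ->
  0 <= c0 -> 0 <= c1 -> 0 <= d0 -> 0 <= d1 ->
  a0 * b0 <= c0 * d0 -> a1 * b1 <= c1 * d1 ->
  a0 * b1 <= c1 * d0 -> a1 * b0 <= c1 * d0 ->
  (a1 + a0) * (b1 + b0) <= (c1 + c0) * (d1 + d0).
Proof.
move=> a0p a1p b0p b1p c0p c1p d0p d1p h00 h11 h01 h10.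
suff : a0 * b1 + a1 * b0 <= c1 * d0 + c0 * d1 by lra.
have Up : 0 <= c1 * d0 by rewrite mulr_ge0.
have Vp : 0 <= c0 * d1 by rewrite mulr_ge0.
have [U0|U0] := eqVneq (c1 * d0) 0; first by rewrite U0 in h01 h10 *; lra.
have {}U0 : 0 < c1 * d0 by rewrite lt_neqAle eq_sym U0.
rewrite -(ler_pM2l U0).
have PQ : (a0 * b0) * (a1 * b1) <= (c0 * d0) * (c1 * d1).
  by apply: ler_pM => //; rewrite mulr_ge0.
have H : 0 <= (c1 * d0 - a0 * b1) * (c1 * d0 - a1 * b0).
  by rewrite mulr_ge0 // subr_ge0.
nra.
Qed.

(** Sums [w] over the sets obtained from [A] by deleting points of [l] only. Letting [l] grow point
    by point reduces supermodularity of [subset_sum] to the two-point case. *)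
Fixpoint partial_sum (l : seq T) (A : {set T}) : R :=
  if l is v :: l' then
    if v \in A then partial_sum l' A + partial_sum l' (A :\ v)
    else partial_sum l' A
  else w A.

Lemma partial_sum_ge0 l A : 0 <= partial_sum l A.
Proof.
elim: l A => [|v l IH] A /=; first exact: w0.
by case: ifP => _ //; rewrite addr_ge0.
Qed.

Lemma partial_sum_supermodular l A B :
  partial_sum l A * partial_sum l B <=
    partial_sum l (A :|: B) * partial_sum l (A :&: B).
Proof.
elim: l A B => [|v l IH] A B /=; first exact: wUI.
have p0 := partial_sum_ge0 l.
rewrite inE [v \in A :&: B]inE.
have IHe C D : forall E F, E = C :|: D -> F = C :&: D ->
    partial_sum l C * partial_sum l D <= partial_sum l E * partial_sum l F.
  by move=> E F -> ->; exact: IH.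
case: (boolP (v \in A)) => vA; case: (boolP (v \in B)) => vB //=.
- apply: four_functions_bool => //; apply: IHe; apply/setP => x;
    rewrite !inE; have [->|] := eqVneq x v; rewrite ?vA ?vB //=.
- rewrite !mulrDl; apply: lerD; first exact: IH.
  apply: IHe; apply/setP => x; rewrite !inE;
    have [->|] := eqVneq x v; rewrite ?(negbTE vB) ?andbF //=.
- rewrite mulrDr mulrDl; apply: lerD; first exact: IH.
  apply: IHe; apply/setP => x; rewrite !inE;
    have [->|] := eqVneq x v; rewrite ?(negbTE vA) ?andbF //=.
Qed.

Lemma partial_sumE l A : uniq l ->
  partial_sum l A =
    \sum_(X : {set T} | (X \subset A) && (A :\: X \subset [set x in l])) w X.
Proof.
elim: l A => [|v l IH] A /=.
  move=> _; rewrite (eq_bigl (pred1 A)) ?big_pred1_eq // => X /=.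
  have -> : [set x in [::]] = set0 :> {set T} by apply/setP => x; rewrite !inE.
  by rewrite subset0 setD_eq0 eqEsubset.
case/andP=> vl ul; rewrite !IH //.
have [vA|vA] := boolP (v \in A); last first.
  apply: eq_bigl => X; have [XA|] //= := boolP (X \subset A).
  apply/subsetP/subsetP => H x xAX; have := H x xAX; rewrite !inE.
    by move=> ->; rewrite orbT.
  by case/orP => // /eqP xv; move: xAX; rewrite xv inE (negbTE vA) andbF.
rewrite [RHS](bigID (fun X : {set T} => v \in X)) /=; congr (_ + _).
  apply: eq_bigl => X; have [XA|] //= := boolP (X \subset A).
  apply/subsetP/andP => [H|[/subsetP H vX] x xAX].
    split; last first.
      by apply: contraNT vl => vX; have := H v; rewrite !inE vX vA => /(_ isT).
    by apply/subsetP => x /H; rewrite !inE orbC => ->.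
  have := H x xAX; rewrite !inE => /orP[/eqP xv|//].
  by move: xAX; rewrite xv inE vX.
apply: eq_bigl => X; rewrite subsetD1.
have [XA|] //= := boolP (X \subset A).
have [vX|vX] /= := boolP (v \in X); first by rewrite !andbF.
rewrite andbT; apply/subsetP/subsetP => H x.
  rewrite !inE => /andP[xX xA]; have [//|xv] := eqVneq x v.
  by have := H x; rewrite !inE xX xA xv => /(_ isT).
by rewrite !inE => /and3P[xX xv xA]; have := H x; rewrite !inE xX xA (negbTE xv) => /(_ isT).
Qed.

Lemma subset_sum_supermodular A B :
  subset_sum A * subset_sum B <= subset_sum (A :|: B) * subset_sum (A :&: B).
Proof.
have E C : subset_sum C = partial_sum (enum T) C.
  rewrite partial_sumE ?enum_uniq //; apply: eq_bigl => X.
  suff -> : C :\: X \subset [set x in enum T] by rewrite andbT.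
  by apply/subsetP => x _; rewrite inE mem_enum.
by rewrite !E; exact: partial_sum_supermodular.
Qed.

Lemma subset_sum_mono (A B : {set T}) : A \subset B -> subset_sum A <= subset_sum B.
Proof.
move=> AB; apply: (@sum_inj_le _ _ _ id) => // X XA.
by split=> //; exact: subset_trans XA AB.
Qed.

End Supermodular.

(* Among the maximizers of [q] one of largest cardinality contains its union
   with each of its translates, hence these translates themselves. *)
Lemma supermodular_max_invariant (R : realFieldType) (T : finType) (I : Type)
    (F : I -> {set T} -> {set T}) (q : {set T} -> R) :
  (forall A, 0 < q A) -> (forall A B, q A * q B <= q (A :|: B) * q (A :&: B)) ->
  (forall i A, q (F i A) = q A) ->
  exists2 M, (forall A, q A <= q M) & (forall i, F i M \subset M).
Proof.
move=> q0 qUI qF.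
case: (@arg_maxP _ _ _ set0 xpredT q isT) => M0 _ M0max.
case: (@arg_maxnP _ M0 (fun A => q A == q M0) (fun A => #|A|) (eqxx _)) => M /eqP qM Mmax.
exists M => [A|i]; first by rewrite qM; exact: M0max.
have qU : q (M :|: F i M) == q M0.
  rewrite eq_le; apply/andP; split; first exact: M0max.
  have := qUI M (F i M); rewrite qF qM => H.
  rewrite -(ler_pM2r (q0 M0)); apply: (le_trans H).
  by rewrite ler_pM2l ?q0 //; exact: M0max.
have := Mmax _ qU => cU.
have /eqP E : M == M :|: F i M by rewrite eqEcard subsetUl.
by rewrite {2}E subsetUr.
Qed.

Section Bipartite.
Variables (R : realFieldType) (t : R) (Gam : finZmodType) (J : finType) (s : J -> Gam).
Variable (j0 : J).
Hypothesis t01 : 0 < t <= 1.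

Local Notation T := (Gam * bool)%type.
Local Notation n := #|Gam|.
Implicit Types A B X Y : {set T}.

Let t0 : 0 < t. Proof. by case/andP: t01. Qed.
Let t1 : t <= 1. Proof. by case/andP: t01. Qed.

(* [X] stands for the region of the even phase: it encodes the independent set of
   the even sites in [X] and the odd sites not in [X]. The weight is relative to
   the configuration with all odd sites, [t] being the inverse fugacity. *)
Definition closed (X : {set T}) :=
  [forall a, forall j, ((a, false) \in X) ==> ((a + s j, true) \in X)].

Lemma closedP X :
  reflect (forall a j, (a, false) \in X -> (a + s j, true) \in X) (closed X).
Proof.
apply: (iffP forallP) => [H a j aX|H a].
  by move/forallP: (H a) => /(_ j) /implyP /(_ aX).
by apply/forallP => j; apply/implyP; exact: H.
Qed.

Definition level_prod (x y : R) (A : {set T}) : R :=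
  \prod_(v in A) (if v.2 then x else y).

Definition weight (X : {set T}) : R := (closed X)%:R * level_prod t t^-1 X.

(** The partition function of a region surrounded by the odd phase. *)
Definition odd_sum := subset_sum weight.

Definition odd_part (A : {set T}) := [set a | (a, true) \in A].
Definition even_part (A : {set T}) := [set a | (a, false) \in A].

Lemma level_prodE x y A :
  level_prod x y A = x ^+ #|odd_part A| * y ^+ #|even_part A|.
Proof.
rewrite /level_prod (bigID (fun v : T => v.2)) /=; congr (_ * _).
  rewrite (eq_bigr (fun=> x)); last by move=> v /andP[_ ->].
  rewrite prodr_const; congr (_ ^+ _).
  rewrite -(card_imset (mem (odd_part A)) (f := fun a => (a, true))); last by move=> ? ? [].
  apply: eq_card => v; apply/andP/imsetP => [[vA v2]|[a]].
    by exists v.1; rewrite ?inE; move: v v2 vA => [a []].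
  by rewrite inE => aA ->.
rewrite (eq_bigr (fun=> y)); last by move=> v /andP[_ /negbTE ->].
rewrite prodr_const; congr (_ ^+ _).
rewrite -(card_imset (mem (even_part A)) (f := fun a => (a, false))); last by move=> ? ? [].
apply: eq_card => v; apply/andP/imsetP => [[vA v2]|[a]].
  by exists v.1; rewrite ?inE; move: v v2 vA => [a []].
by rewrite inE => aA ->.
Qed.

Lemma level_prod_gt0 x y A : 0 < x -> 0 < y -> 0 < level_prod x y A.
Proof. by move=> x0 y0; apply: prodr_gt0 => v _; case: ifP. Qed.

Lemma level_prod_split x y A B : level_prod x y A =
  level_prod x y (A :&: B) * level_prod x y (A :\: B).
Proof. by rewrite /level_prod (big_setID B). Qed.

Lemma level_prodUI x y A B :
  level_prod x y A * level_prod x y B =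
    level_prod x y (A :|: B) * level_prod x y (A :&: B).
Proof.
rewrite (level_prod_split x y A B) (level_prod_split x y (A :|: B) B).
have -> : (A :|: B) :&: B = B.
  by apply/setP => v; rewrite !inE; case: (v \in B); rewrite ?orbT ?andbF.
have -> : (A :|: B) :\: B = A :\: B.
  by apply/setP => v; rewrite !inE; case: (v \in B); rewrite ?orbF.
by rewrite [RHS]mulrC [X in _ = _ * X]mulrC mulrA.
Qed.

Lemma weight_ge0 X : 0 <= weight X.
Proof.
by rewrite mulr_ge0 // ltW // level_prod_gt0 // invr_gt0.
Qed.

Lemma weight_closed X : closed X -> weight X = level_prod t t^-1 X.
Proof. by rewrite /weight => ->; rewrite mul1r. Qed.

Lemma closedU X Y : closed X -> closed Y -> closed (X :|: Y).
Proof.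
move=> /closedP cX /closedP cY; apply/closedP => a j; rewrite !inE.
by case/orP => [/cX ->|/cY ->]; rewrite ?orbT.
Qed.

Lemma closedI X Y : closed X -> closed Y -> closed (X :&: Y).
Proof.
move=> /closedP cX /closedP cY; apply/closedP => a j; rewrite !inE.
by case/andP => /cX -> /cY ->.
Qed.

Lemma weight_supermodular X Y :
  weight X * weight Y <= weight (X :|: Y) * weight (X :&: Y).
Proof.
have [cX|ncX] := boolP (closed X); last first.
  by rewrite {1}/weight (negbTE ncX) !mul0r mulr_ge0 ?weight_ge0.
have [cY|ncY] := boolP (closed Y); last first.
  by rewrite {2}/weight (negbTE ncY) !mul0r mulr0 mulr_ge0 ?weight_ge0.
by rewrite !weight_closed ?closedU ?closedI // level_prodUI.
Qed.

Lemma odd_sum_supermodular A B :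
  odd_sum A * odd_sum B <= odd_sum (A :|: B) * odd_sum (A :&: B).
Proof.
by apply: subset_sum_supermodular; [exact: weight_ge0|exact: weight_supermodular].
Qed.

Lemma odd_sum_mono (A B : {set T}) : A \subset B -> odd_sum A <= odd_sum B.
Proof. by apply: subset_sum_mono; exact: weight_ge0. Qed.

Lemma closed0 : closed set0.
Proof. by apply/closedP => a j; rewrite inE. Qed.

Lemma odd_sum_ge1 A : 1 <= odd_sum A.
Proof.
rewrite /odd_sum /subset_sum (bigD1 set0) ?sub0set //= weight_closed ?closed0 //.
by rewrite /level_prod big_set0 lerDl sumr_ge0 // => X _; exact: weight_ge0.
Qed.

Lemma odd_sum_gt0 A : 0 < odd_sum A.
Proof. exact: lt_le_trans ltr01 (odd_sum_ge1 A). Qed.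

Lemma closed_card X : closed X -> (#|even_part X| <= #|odd_part X|)%N.
Proof.
move=> /closedP cX; rewrite -(card_imset (mem (even_part X)) (addIr (s j0))).
apply: subset_leq_card; apply/subsetP => b /imsetP[a]; rewrite !inE => aX ->.
exact: cX.
Qed.

Lemma weight_le1 X : weight X <= 1.
Proof.
have [cX|ncX] := boolP (closed X); last by rewrite /weight (negbTE ncX) mul0r.
rewrite weight_closed // level_prodE -(subnK (closed_card cX)) exprD.
by rewrite -mulrA -exprMn divff ?gt_eqF // expr1n mulr1 exprn_ile1 // ltW.
Qed.

Definition translate c (A : {set T}) := (fun v : T => (v.1 + c, v.2)) @: A.

Lemma mem_translate c A a b : ((a, b) \in translate c A) = ((a - c, b) \in A).
Proof.
apply/imsetP/idP => [[[a' b'] vA [-> ->]]|vA]; first by rewrite addrK.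
by exists (a - c, b) => //=; rewrite subrK.
Qed.

Lemma translateK c : cancel (translate c) (translate (- c)).
Proof. by move=> A; apply/setP => -[a b]; rewrite !mem_translate opprK addrK. Qed.

Lemma card_parts_translate c A :
  #|odd_part (translate c A)| = #|odd_part A| /\
  #|even_part (translate c A)| = #|even_part A|.
Proof.
split.
  rewrite -(card_imset (mem (odd_part A)) (addIr c)); apply: eq_card => a.
  rewrite inE mem_translate; apply/idP/imsetP => [aA|[b]].
    by exists (a - c); rewrite ?inE ?subrK.
  by rewrite inE => bA ->; rewrite addrK.
rewrite -(card_imset (mem (even_part A)) (addIr c)); apply: eq_card => a.
rewrite inE mem_translate; apply/idP/imsetP => [aA|[b]].
  by exists (a - c); rewrite ?inE ?subrK.
by rewrite inE => bA ->; rewrite addrK.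
Qed.

Lemma level_prod_translate c x y A : level_prod x y (translate c A) = level_prod x y A.
Proof. by have [E1 E2] := card_parts_translate c A; rewrite !level_prodE E1 E2. Qed.

Lemma closed_translate c X : closed X -> closed (translate c X).
Proof.
move/closedP => cX; apply/closedP => a j; rewrite !mem_translate => /cX.
by rewrite addrAC; apply.
Qed.

Lemma weight_translate c X : weight X <= weight (translate c X).
Proof.
have [cX|ncX] := boolP (closed X).
  by rewrite !weight_closed ?closed_translate // level_prod_translate.
by rewrite {1}/weight (negbTE ncX) mul0r weight_ge0.
Qed.

Lemma odd_sum_translate_le c A : odd_sum A <= odd_sum (translate c A).
Proof.
apply: (@sum_inj_le _ _ _ (translate c)).
- by move=> X Y _ _; exact: can_inj (translateK c) _ _.
- by move=> X XA; split; [exact: imsetS|exact: weight_translate].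
- by move=> X _; exact: weight_ge0.
Qed.

Lemma odd_sum_translate c A : odd_sum (translate c A) = odd_sum A.
Proof.
apply/le_anti/andP; split; last exact: odd_sum_translate_le.
by rewrite -{2}[A](translateK c) odd_sum_translate_le.
Qed.

Definition mirror (v : T) : T := (- v.1, ~~ v.2).

Lemma mirrorK : involutive mirror.
Proof. by move=> [a b]; rewrite /mirror /= opprK negbK. Qed.

Definition mirror_set (A : {set T}) := mirror @: A.

Lemma mem_mirror_set A v : (v \in mirror_set A) = (mirror v \in A).
Proof.
apply/imsetP/idP => [[u uA ->]|vA]; first by rewrite mirrorK.
by exists (mirror v); rewrite ?mirrorK.
Qed.

Lemma mirror_setK : involutive mirror_set.
Proof. by move=> A; apply/setP => v; rewrite !mem_mirror_set mirrorK. Qed.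

Lemma card_parts_mirror A :
  #|odd_part (mirror_set A)| = #|even_part A| /\
  #|even_part (mirror_set A)| = #|odd_part A|.
Proof.
split.
  rewrite -(card_imset (mem (even_part A)) (@oppr_inj Gam)); apply: eq_card => a.
  rewrite inE mem_mirror_set; apply/idP/imsetP => [aA|[b]].
    by exists (- a); rewrite ?inE ?opprK.
  by rewrite inE => bA ->; rewrite /mirror /= opprK.
rewrite -(card_imset (mem (odd_part A)) (@oppr_inj Gam)); apply: eq_card => a.
rewrite inE mem_mirror_set; apply/idP/imsetP => [aA|[b]].
  by exists (- a); rewrite ?inE ?opprK.
by rewrite inE => bA ->; rewrite /mirror /= opprK.
Qed.

Lemma card_partsC A :
  #|odd_part (~: A)| = (n - #|odd_part A|)%N /\
  #|even_part (~: A)| = (n - #|even_part A|)%N.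
Proof.
have E1 : odd_part (~: A) = ~: odd_part A by apply/setP => a; rewrite !inE.
have E2 : even_part (~: A) = ~: even_part A by apply/setP => a; rewrite !inE.
by rewrite E1 E2; split; rewrite [LHS]cardsCs setCK.
Qed.

Lemma closed_mirrorC X : closed X -> closed (mirror_set (~: X)).
Proof.
move=> /closedP cX; apply/closedP => a j; rewrite !mem_mirror_set !inE /mirror /=.
apply: contra => /(cX _ j).
by rewrite opprD subrK.
Qed.

(** The symmetry between the phases: complementing exchanges their regions and [mirror] exchanges
    the sublattices. The weight is preserved because both sublattices have [n] sites. *)
Lemma weight_mirrorC X : closed X -> weight (mirror_set (~: X)) = weight X.
Proof.
move=> cX; rewrite !weight_closed ?closed_mirrorC // !level_prodE.
have [-> ->] := card_parts_mirror (~: X); have [-> ->] := card_partsC X.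
have le1 : (#|odd_part X| <= n)%N by exact: max_card.
have le2 : (#|even_part X| <= n)%N by exact: max_card.
have tn0 : t != 0 by rewrite gt_eqF.
have E k : (k <= n)%N -> t ^+ (n - k) = t ^+ n * t^-1 ^+ k.
  by move=> kn; rewrite -{2}(subnK kn) exprD -mulrA -exprMn divff // expr1n mulr1.
have E' k : (k <= n)%N -> t^-1 ^+ (n - k) = t^-1 ^+ n * t ^+ k.
  by move=> kn; rewrite -{2}(subnK kn) exprD -mulrA -exprMn mulVf // expr1n mulr1.
rewrite E // E' // mulrACA -exprMn divff // expr1n mul1r mulrC //.
Qed.

Local Notation Z := (odd_sum [set: T]).
Local Notation zO := (odd_sum [set v : T | v.2]).
Local Notation zE := (Z / zO).

Lemma zE_ge1 : 1 <= zE.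
Proof. by rewrite ler_pdivlMr ?odd_sum_gt0 // mul1r odd_sum_mono // subsetT. Qed.

Lemma zEO : zE * zO = Z.
Proof. by rewrite divfK // gt_eqF // odd_sum_gt0. Qed.

Lemma odd_sum_even_level : odd_sum [set v : T | ~~ v.2] = 1.
Proof.
rewrite /odd_sum /subset_sum (bigD1 set0) ?sub0set //= big1 ?addr0.
  by rewrite weight_closed ?closed0 // /level_prod big_set0.
move=> X /andP[/subsetP XE X0]; rewrite /weight; case: closedP => [cX|_]; last by rewrite mul0r.
case/set0Pn: X0 => -[a b] aX; have := XE _ aX; rewrite inE /= => /negbTE b0.
by rewrite b0 in aX; have := XE _ (cX _ j0 aX); rewrite inE.
Qed.

Lemma n_gt0 : (0 < n)%N.
Proof. by apply/card_gt0P; exists 0. Qed.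

(** The ratio [q] of the two sides is supermodular, its denominator being modular, and translation
    invariant; so it is maximal at a union of full sublattices. There are four of these, and [zO]
    and [zE] are chosen such that [q] is 1 at the odd sublattice and at the whole torus; at the
    other two it is at most 1. *)
Lemma odd_sum_bound A :
  odd_sum A ^+ n <= zE ^+ #|even_part A| * zO ^+ #|odd_part A|.
Proof.
have zE0 : 0 < zE by exact: lt_le_trans ltr01 zE_ge1.
have zO0 : 0 < zO by exact: odd_sum_gt0.
pose q B := odd_sum B ^+ n / level_prod zO zE B.
have lp0 B : 0 < level_prod zO zE B by exact: level_prod_gt0.
have [||c B|M Mmax Minv] := @supermodular_max_invariant _ _ _ translate q.
- by move=> B; rewrite divr_gt0 // exprn_gt0 // odd_sum_gt0.
- move=> B C; rewrite /q mulrACA -invfM level_prodUI [leRHS]mulrACA -invfM.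
  rewrite ler_pM2r ?invr_gt0 ?mulr_gt0 // -!exprMn ler_pXn2r ?odd_sum_supermodular //.
  + exact: n_gt0.
  + by rewrite nnegrE mulr_ge0 // ltW // odd_sum_gt0.
  + by rewrite nnegrE mulr_ge0 // ltW // odd_sum_gt0.
- by rewrite /q odd_sum_translate level_prod_translate.
suff qM : q M <= 1.
  have := le_trans (Mmax A) qM; rewrite /q ler_pdivrMr // mul1r level_prodE.
  by rewrite mulrC.
have mem_all a b a' : (a, b) \in M -> (a', b) \in M.
  move=> aM; apply: (subsetP (Minv (a' - a))).
  by rewrite mem_translate subKr.
have nT : #|[set: Gam]| = n by rewrite cardsT.
have full b : (0, b) \in M -> [set a | (a, b) \in M] = [set: Gam].
  by move=> bM; apply/setP => a; rewrite !inE (mem_all _ _ a bM).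
have empty b : (0, b) \notin M -> [set a | (a, b) \in M] = set0.
  by move=> bM; apply/setP => a; rewrite !inE; apply: contraNF bM; exact: mem_all.
have Min b a : ((a, b) \in M) = ((0, b) \in M).
  by apply/idP/idP; exact: mem_all.
rewrite /q ler_pdivrMr // mul1r level_prodE /odd_part /even_part.
case: (boolP ((0, true) \in M)) => tM; case: (boolP ((0, false) \in M)) => fM.
- rewrite (full _ tM) (full _ fM) nT -exprMn mulrC zEO.
  have -> : M = [set: T] by apply/setP => -[a []]; rewrite !inE Min.
  by [].
- rewrite (full _ tM) (empty _ fM) nT cards0 expr0 mulr1.
  suff -> : M = [set v : T | v.2] by [].
  by apply/setP => -[a []]; rewrite !inE Min //= (negbTE fM).
- rewrite (empty _ tM) (full _ fM) nT cards0 expr0 mul1r.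
  have -> : M = [set v : T | ~~ v.2].
    by apply/setP => -[a []]; rewrite !inE Min //= (negbTE tM).
  by rewrite odd_sum_even_level expr1n exprn_ege1 // zE_ge1.
- rewrite (empty _ tM) (empty _ fM) cards0 !expr0 mulr1.
  have -> : M = set0.
    by apply/setP => -[a []]; rewrite !inE Min ?(negbTE fM) ?(negbTE tM).
  rewrite (_ : odd_sum set0 = 1) ?expr1n // /odd_sum /subset_sum.
  rewrite (eq_bigl (pred1 set0)) ?big_pred1_eq ?weight_closed ?closed0 //.
    by rewrite /level_prod big_set0.
  by move=> X; rewrite subset0.
Qed.

Lemma Z_le : Z <= 4%:R ^+ n.
Proof.
apply: (@le_trans _ _ (\sum_(X : {set T}) 1)).
  rewrite /odd_sum /subset_sum big_mkcond /=; apply: ler_sum => X _.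
  by case: ifP => _; rewrite ?weight_le1.
rewrite sumr_const (_ : #|_| = (4 ^ n)%N) ?natrX //.
rewrite (eq_card (B := mem (powerset [set: T]))); last by move=> X; rewrite !inE subsetT.
by rewrite card_powerset cardsT card_prod card_bool mulnC expnM.
Qed.

Definition excess B := (#|odd_part B| - #|even_part B|)%N.

(** Together [mirror_set B] and [~: B] have [n + excess B] even and [n - excess B] odd sites, so
    [odd_sum_bound] gives [Z ^+ (n - excess B) * zE ^+ (2 * excess B)] for the power [n] of the left
    side. The surplus is absorbed by [zE <= Z <= 4 ^ n]. *)
Lemma mirror_sum_bound B : closed B ->
  odd_sum (mirror_set B) * odd_sum (~: B) <= 4%:R ^+ excess B * Z.
Proof.
move=> cB; have gB := closed_card cB.
have pos A C : 0 <= odd_sum A * odd_sum C by rewrite mulr_ge0 // ltW // odd_sum_gt0.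
have zE0 : 0 <= zE by exact: le_trans ler01 zE_ge1.
have zO1 := odd_sum_ge1 [set v : T | v.2].
have Z0 : 0 <= Z by rewrite ltW // odd_sum_gt0.
rewrite -(@ler_pXn2r _ n n_gt0) ?nnegrE //; last by rewrite mulr_ge0 ?exprn_ge0.
rewrite exprMn.
have os0 A : 0 <= odd_sum A ^+ n by rewrite exprn_ge0 // ltW // odd_sum_gt0.
apply: (le_trans (ler_pM (os0 _) (os0 _) (odd_sum_bound _) (odd_sum_bound _))).
have [-> ->] := card_parts_mirror B; have [-> ->] := card_partsC B.
have Bn : (#|odd_part B| <= n)%N by exact: max_card.
rewrite mulrACA -!exprD.
have -> : (#|odd_part B| + (n - #|even_part B|) = (n - excess B) + (excess B + excess B))%N.
  by rewrite /excess; lia.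
have -> : (#|even_part B| + (n - #|odd_part B|) = n - excess B)%N.
  by rewrite /excess; lia.
rewrite exprD mulrAC -exprMn zEO [(4%:R ^+ _ * _) ^+ _]exprMn.
have -> : Z ^+ n = Z ^+ (n - excess B) * Z ^+ excess B.
  by rewrite -exprD subnK // /excess; lia.
rewrite mulrCA ler_wpM2l ?exprn_ge0 // exprD.
have zEZ : zE <= Z by rewrite ler_pdivrMr ?ler_peMr // odd_sum_gt0.
apply: ler_pM; rewrite ?exprn_ge0 //; last by rewrite lerXn2r ?nnegrE.
by rewrite exprAC lerXn2r ?nnegrE ?exprn_ge0 // (le_trans zEZ Z_le).
Qed.

Local Notation Delta := #|J|.

Lemma closed_remove_isolated X a : closed X -> (forall j, (a - s j, false) \notin X) ->
  closed (X :\ (a, true)).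
Proof.
move=> /closedP cX iso; apply/closedP => b j; rewrite !inE => /andP[_ bX].
rewrite cX // andbT; apply: contraTneq bX => -[E].
by have := iso j; rewrite -E addrK.
Qed.

(** Three cases: [X] misses the odd site; it contains the site but no even neighbour, and deleting
    the site does not lower the weight as [t <= 1]; or it contains one of the [#|J|] even
    neighbours, which by the phase symmetry and a translation weighs at most as much as missing the
    site. *)
Lemma missing_odd_bound a :
  Z <= (Delta + 2)%:R * odd_sum (~: [set (a, true)]).
Proof.
set o := (a, true) : T; set S0 := odd_sum (~: [set o]).
have S0E (v : T) : odd_sum (~: [set v]) = \sum_(X : {set T} | v \notin X) weight X.
  by apply: eq_bigl => X; rewrite subsetC sub1set inE.
have even_in b : \sum_(X : {set T} | (b, false) \in X) weight X <= S0.
  have -> : S0 = odd_sum (~: [set mirror (b, false)]).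
    rewrite -[LHS](odd_sum_translate (- b - a)); congr odd_sum; apply/setP => -[c e].
    rewrite mem_translate !inE /mirror /= !xpair_eqE.
    by rewrite subr_eq [a + _]addrC subrK.
  rewrite S0E; apply: (@sum_inj_le _ _ _ (fun X : {set T} => mirror_set (~: X))).
  - by move=> X Y _ _ /(can_inj mirror_setK) /(can_inj (@setCK _)).
  - move=> X bX; split; first by rewrite mem_mirror_set mirrorK inE bX.
    have [cX|ncX] := boolP (closed X); first by rewrite weight_mirrorC.
    by rewrite {1}/weight (negbTE ncX) mul0r weight_ge0.
  - by move=> X _; exact: weight_ge0.
have isolated : \sum_(X : {set T} | (o \in X) && [forall j, (a - s j, false) \notin X]) weight X <= S0.
  rewrite /S0 S0E; apply: (@sum_inj_le _ _ _ (fun X : {set T} => X :\ o)).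
  - move=> X Y; rewrite !unfold_in => /andP[oX _] /andP[oY _] E.
    by rewrite -(setD1K oX) E setD1K.
  - move=> X /andP[oX /forallP iso]; split; first by rewrite !inE eqxx.
    have [cX|ncX] := boolP (closed X); last first.
      by rewrite {1}/weight (negbTE ncX) mul0r weight_ge0.
    rewrite !weight_closed ?closed_remove_isolated //.
    rewrite /level_prod (big_setD1 o) //= ler_piMl //.
    by rewrite ltW // level_prod_gt0 // invr_gt0.
  - by move=> X _; exact: weight_ge0.
have -> : (Delta + 2)%:R * S0 = S0 + (\sum_(j : J) S0 + S0).
  by rewrite sumr_const natrD mulrDl mulr_natl [2%:R]mulr2n mulrDl !mul1r addrCA.
have -> : Z = \sum_(X : {set T}) weight X.
  by apply: eq_bigl => X; rewrite subsetT.
rewrite (bigID (fun X : {set T} => o \notin X)) /= -S0E -/S0 lerD2l.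
rewrite (bigID (fun X : {set T} => [forall j, (a - s j, false) \notin X])) /= addrC.
apply: lerD; last first.
  by rewrite (eq_bigl _ _ (fun X : {set T} => congr1 (andb^~ _) (negbK (o \in X)))).
apply: (@le_trans _ _ (\sum_(j : J) \sum_(X : {set T} | (a - s j, false) \in X) weight X)); last first.
  by apply: ler_sum => j _; exact: even_in.
under [leRHS]eq_bigr do rewrite big_mkcond.
rewrite exchange_big /= [leLHS]big_mkcond /=; apply: ler_sum => X _.
case: ifP => [/andP[_]|_]; last first.
  by apply: sumr_ge0 => j _; case: ifP => // _; exact: weight_ge0.
rewrite negb_forall => /existsP[j]; rewrite negbK => jX.
rewrite (bigD1 j) //= jX lerDl; apply: sumr_ge0 => k _.
by case: ifP => // _; exact: weight_ge0.
Qed.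

Lemma missing_bound v : Z <= (Delta + 2)%:R * odd_sum (~: [set v]).
Proof.
case: v => a []; first exact: missing_odd_bound.
apply: (le_trans (missing_odd_bound (a + s j0))); rewrite ler_wpM2l //.
rewrite /odd_sum /subset_sum [leLHS]big_mkcond [leRHS]big_mkcond; apply: ler_sum => X _.
rewrite !(subsetC X) !sub1set !inE.
have [cX|ncX] := boolP (closed X); last by rewrite /weight (negbTE ncX) mul0r; do 2 case: ifP.
case: ifP => [oX|_]; last by case: ifP => // _; exact: weight_ge0.
case: ifP => // /negbFE aX; move/closedP: cX => /(_ a j0 aX) cX.
by rewrite cX in oX.
Qed.

(** By supermodularity the events of missing single sites are positively correlated, so the
    single-site bounds multiply. *)
Lemma missing_set_bound (W : {set T}) :
  Z <= (Delta + 2)%:R ^+ #|W| * odd_sum (~: W).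
Proof.
have [k] := ubnP #|W|; elim: k W => // k IH W kW.
have [->|/set0Pn[v vW]] := eqVneq W set0.
  by rewrite cards0 expr0 mul1r setC0.
rewrite (cardsD1 v W) vW add1n exprS.
have := IH (W :\ v); rewrite (cardsD1 v W) vW in kW => /(_ kW) {}IH.
have Z0 : 0 < Z by exact: odd_sum_gt0.
rewrite -(ler_pM2l Z0).
apply: (le_trans (ler_pM (ltW Z0) (ltW Z0) (missing_bound v) IH)).
rewrite mulrACA [leRHS]mulrCA ler_wpM2l ?mulr_ge0 ?exprn_ge0 //.
apply: (le_trans (odd_sum_supermodular _ _)).
have -> : ~: [set v] :&: ~: (W :\ v) = ~: W.
  apply/setP => u; rewrite !inE; have [->|] //= := eqVneq u v.
  by rewrite vW.
by rewrite ler_wpM2r ?odd_sum_mono ?subsetT // ltW // odd_sum_gt0.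
Qed.

Definition cut_edges (B : {set T}) : {set Gam * J} :=
  [set e | ((e.1, false) \notin B) && ((e.1 + s e.2, true) \in B)].

(** Of the edges into odd sites of [B], those that start in [B] are all the edges out of its even
    sites, because [B] is closed. *)
Lemma card_cut_edges B : closed B -> #|cut_edges B| = (Delta * excess B)%N.
Proof.
move=> /[dup] cB0 /closedP cB.
have E : (#|cut_edges B| + \sum_(e : Gam * J) ((e.1, false) \in B) =
    \sum_(e : Gam * J) (((e.1 + s e.2)%R, true) \in B))%N.
  rewrite -sum1_card big_mkcond -big_split /=; apply: eq_bigr => -[a j] _ /=.
  rewrite inE /=; have [/(cB _ j) ->|_] //= := boolP ((a, false) \in B).
  by case: (_ \in B).
have cnt (D : {set Gam}) (f : J -> Gam -> Gam) : (forall j, injective (f j)) ->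
    (\sum_(e : Gam * J) (f e.2 e.1 \in D) = Delta * #|D|)%N.
  move=> finj; rewrite -(pair_bigA _ (fun a j => nat_of_bool (f j a \in D))) /=.
  rewrite exchange_big /= (eq_bigr (fun=> #|D|)) ?sum_nat_const // => j _.
  rewrite -[RHS](card_preimset D (finj j)) -sum1_card [RHS]big_mkcond /=.
  by apply: eq_bigr => a _; rewrite inE; case: (f j a \in D).
have E1 := cnt (even_part B) (fun _ a => a) (fun _ => @inj_id _).
have E2 := cnt (odd_part B) (fun j a => a + s j) (fun j => @addIr _ (s j)).
rewrite /excess mulnBr -E1 -E2.
under [in RHS]eq_bigr do rewrite inE.
under [X in _ = (_ - X)%N]eq_bigr do rewrite inE.
by rewrite -E addnK.
Qed.

(** If [X] avoids the even sites adjacent to [B] from outside, no edge leads from [X :\: B] into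
    [B], so both parts of [X] are closed. *)
Lemma split_sum B : closed B ->
  odd_sum (~: [set v | (v \notin B) && ~~ v.2 & [exists j, (v.1 + s j, true) \in B]]) <=
    odd_sum B * odd_sum (~: B).
Proof.
move=> /closedP cB; set W := [set v | _].
rewrite /odd_sum /subset_sum big_distrlr /= pair_big /=.
apply: (@sum_inj_le _ _ _ (fun X : {set T} => (X :&: B, X :\: B))).
- by move=> X Y _ _ [E1 E2]; rewrite -(setID X B) E1 E2 setID.
- move=> X XW /=; rewrite subsetIr setDE subsetIr; split=> //.
  have [cX|ncX] := boolP (closed X); last first.
    by rewrite {1}/weight (negbTE ncX) mul0r mulr_ge0 ?weight_ge0.
  rewrite -setDE !weight_closed //; first by rewrite -level_prod_split.
    apply/closedP => a j; rewrite !inE => /andP[aB aX].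
    rewrite (closedP _ cX) // andbT; apply: contraTN aX => oB.
    have : (a, false) \in W by rewrite !inE aB /=; apply/existsP; exists j.
    by apply: contraTN => /(subsetP XW); rewrite inE.
  by apply: closedI => //; apply/closedP.
- by move=> [X Y] _; rewrite mulr_ge0 ?weight_ge0.
Qed.

(** The 4 comes from [mirror_sum_bound]; the power pays, by [missing_set_bound], for emptying the at
    most [Delta * excess B] even sites along the boundary of [B]. *)
Definition mirror_const : R := 4%:R * (Delta + 2)%:R ^+ Delta.

(* Exchanging the two phases inside [B] costs only a boundary factor. The upper
   bound on [odd_sum (mirror_set B) * odd_sum (~: B)] comes from
   supermodularity, the lower bound on [odd_sum B * odd_sum (~: B)] from the
   symmetry [mirror] between the two phases. *)
Lemma mirror_sum_le B : closed B ->
  odd_sum (mirror_set B) <= mirror_const ^+ excess B * odd_sum B.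
Proof.
move=> cB; have C0 : 0 < odd_sum (~: B) by exact: odd_sum_gt0.
rewrite -(ler_pM2r C0); apply: (le_trans (mirror_sum_bound cB)).
rewrite /mirror_const exprMn -!mulrA ler_wpM2l ?exprn_ge0 //.
set W := [set v : T | (v \notin B) && ~~ v.2 & [exists j, (v.1 + s j, true) \in B]].
apply: (le_trans (missing_set_bound W)).
apply: ler_pM; [exact: exprn_ge0|by rewrite ltW ?odd_sum_gt0| |exact: split_sum].
rewrite -exprM ler_weXn2l //; first by rewrite ler1n addn2.
rewrite -card_cut_edges //.
have -> : W = (fun e : Gam * J => (e.1, false)) @: cut_edges B.
  apply/setP => -[a b]; rewrite !inE; apply/idP/imsetP => [|[[a' j] ]].
    case/andP=> /andP[aB /negbTE b0] /existsP[j jB]; rewrite /= in b0; rewrite b0 in aB *.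
    by exists (a, j); rewrite ?inE //= aB.
  by rewrite inE /= => /andP[aB jB] [-> ->]; rewrite aB /=; apply/existsP; exists j.
exact: leq_imset_card.
Qed.

End Bipartite.

(** * Closed sets as independent sets *)

Section Bipartite.
Variables (R : realFieldType) (t : R) (Gam : finZmodType) (J : finType) (s : J -> Gam).
Hypothesis t0 : 0 < t.
Local Notation T := (Gam * bool)%type.
Implicit Types (I X L : {set T}).

Definition bip_rel : rel T := [rel v w | (v.2 != w.2) &&
  [exists j, if v.2 then v.1 == w.1 + s j else w.1 == v.1 + s j]].

Lemma bip_sym : symmetric bip_rel.
Proof. by move=> [a b] [c e]; rewrite /bip_rel /= eq_sym; case: b; case: e. Qed.

Lemma bip_irr : irreflexive bip_rel.
Proof. by move=> v; rewrite /bip_rel /= eqxx. Qed.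

Definition odd_side : {set T} := [set v | v.2].
Definition even_side : {set T} := [set v | ~~ v.2].

(* The region occupied by the even phase. *)
Definition flip I : {set T} := [set v | (v \in I) (+) v.2].

Lemma flipK : involutive flip.
Proof. by move=> I; apply/setP => v; rewrite !inE -addbA addbb addbF. Qed.

Lemma flip_closed I : closed s (flip I) = indep bip_rel I.
Proof.
apply/closedP/indepP => [H [a b] [c e] aI cI|H a j].
  apply/negP => /andP[/= be /existsP[j E]].
  case: b e aI cI be E => -[] //= aI cI _ /eqP E.
    by have := H c j; rewrite !inE /= cI -E aI => /(_ isT).
  by have := H a j; rewrite !inE /= aI -E cI => /(_ isT).
rewrite !inE /= addbF addbT => aI; apply/negP => jI.
have /negP := H _ _ aI jI; apply; rewrite /bip_rel /=.
by apply/existsP; exists j.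
Qed.

Lemma flip_conf L I : (I \in hc_conf bip_rel L odd_side) = closed s (flip I) && (flip I \subset L).
Proof.
rewrite inE flip_closed; congr (_ && _).
apply/eqP/subsetP => [H v|H].
  rewrite inE => vI; apply: contraLR vI => vL; move/setP/(_ v): H.
  by rewrite !inE vL /= => ->; rewrite addbb.
apply/setP => v; rewrite !inE; have [//|vL] /= := boolP (v \in L).
by apply/eqP; rewrite -negb_add; apply: contra vL => vI; apply: H; rewrite inE.
Qed.

Lemma flip_weight I : indep bip_rel I -> t^-1 ^+ #|I| = t^-1 ^+ #|Gam| * weight t s (flip I).
Proof.
rewrite -flip_closed => cI; rewrite weight_closed // level_prodE.
have E1 : even_part I = even_part (flip I).
  by apply/setP => a; rewrite !inE /= addbF.
have E2 : odd_part I = ~: odd_part (flip I).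
  by apply/setP => a; rewrite !inE /= addbT negbK.
have tt : t^-1 ^+ #|odd_part (flip I)| * t ^+ #|odd_part (flip I)| = 1.
  by rewrite -exprMn mulVf ?gt_eqF // expr1n.
have -> : t^-1 ^+ #|I| = level_prod t^-1 t^-1 I.
  by rewrite /level_prod -prodr_const; apply: eq_bigr => v _; case: ifP.
rewrite [LHS]level_prodE E1 E2 -(cardsC (odd_part (flip I))) exprD.
by rewrite mulrACA tt mul1r.
Qed.

Variables (L : {set T}) (ep : R).
Hypothesis stable : forall v, \sum_(X : {set T} | (X \subset L) && (v \in X)) weight t s X <=
  ep * odd_sum t s L.

Lemma odd_boundary v : 
  \sum_(I in hc_conf bip_rel L odd_side | v \in flip I) t^-1 ^+ #|I| <=
    ep * \sum_(I in hc_conf bip_rel L odd_side) t^-1 ^+ #|I|.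
Proof.
have flipE (P : pred {set T}) :
    \sum_(I in hc_conf bip_rel L odd_side | P (flip I)) t^-1 ^+ #|I| =
    t^-1 ^+ #|Gam| * \sum_(X : {set T} | (X \subset L) && P X) weight t s X.
  rewrite (reindex_onto flip flip) => [|X _]; last by rewrite flipK.
  rewrite mulr_sumr [RHS](bigID (closed s)) /= [X in _ = _ + X]big1 ?addr0; last first.
    by move=> X /andP[_ /negbTE ncX]; rewrite /weight ncX mul0r mulr0.
  rewrite (eq_bigl (fun X : {set T} => ((X \subset L) && P X) && closed s X)); last first.
    by move=> X; rewrite flip_conf flipK eqxx andbT -andbA andbC.
  by apply: eq_bigr => X /andP[_ cX]; rewrite flip_weight ?flipK // -flip_closed flipK.
have := flipE xpredT; under eq_bigl do rewrite andbT.
under [X in _ = _ * X]eq_bigl do rewrite andbT.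
move=> ->; rewrite (flipE (fun X : {set T} => v \in X)) mulrCA ler_wpM2l //.
  by rewrite exprn_ge0 ?invr_ge0 ?(ltW t0).
exact: stable.
Qed.

Lemma mirror_conf I : mirror_set L = L ->
  (mirror_set I \in hc_conf bip_rel L odd_side) = (I \in hc_conf bip_rel L even_side).
Proof.
move=> LL; rewrite !inE; congr (_ && _).
  rewrite -!flip_closed; apply/closedP/closedP => H a j.
    have := H (- a - s j) j; rewrite subrK !inE !mem_mirror_set /mirror /= !opprD !opprK !addbF !addbT.
    by move=> H' aI; apply: contraTN aI => jI; apply: H'.
  have := H (- a - s j) j; rewrite subrK !inE !mem_mirror_set /mirror /= !opprD !addbF !addbT.
  by move=> H' aI; apply: contraTN aI => jI; apply: H'.
have LE v : (v \in L) = (mirror v \in L) by rewrite -{1}LL mem_mirror_set.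
apply/eqP/eqP => /setP H; apply/setP => v; have := H (mirror v);
  rewrite !inE -LE mem_mirror_set ?mirrorK /=; case: (v \in L) => //=.
by rewrite negbK.
Qed.

(** The map [mirror] carries the even boundary condition to the odd one, so only one phase requires
    a contour argument. *)
Lemma even_boundary v : mirror_set L = L ->
  \sum_(I in hc_conf bip_rel L even_side | v \notin flip I) t^-1 ^+ #|I| <=
    ep * \sum_(I in hc_conf bip_rel L even_side) t^-1 ^+ #|I|.
Proof.
move=> LL; have cardM I : #|mirror_set I| = #|I|.
  by rewrite card_imset //; exact: (can_inj (@mirrorK Gam)).
have E (P : pred {set T}) : \sum_(I in hc_conf bip_rel L even_side | P I) t^-1 ^+ #|I| =
    \sum_(I in hc_conf bip_rel L odd_side | P (mirror_set I)) t^-1 ^+ #|I|.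
  rewrite (reindex_inj (can_inj (@mirror_setK Gam))); apply: eq_big => [I|I _]; last by rewrite cardM.
  by rewrite -mirror_conf // mirror_setK.
have := E xpredT; under eq_bigl do rewrite andbT; under [RHS]eq_bigl do rewrite andbT.
move=> ->; rewrite (E (fun I : {set T} => v \notin flip I)).
apply: le_trans (odd_boundary (mirror v)); rewrite le_eqVlt; apply/orP; left; apply/eqP.
apply: eq_bigl => I; congr (_ && _).
by rewrite !inE mem_mirror_set /mirror /=; case: (_ \in I); case: v.2.
Qed.

End Bipartite.

(** * Peierls estimate for bipartite steps *)

Section OneContour.
Variables (R : realFieldType) (t : R) (Gam : finZmodType) (J : finType) (s : J -> Gam).
Variable (j0 : J).
Hypothesis t01 : 0 < t <= 1.
Local Notation T := (Gam * bool)%type.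
Implicit Types A B X Y Lam : {set T}.

Let t0 : 0 < t. Proof. by case/andP: t01. Qed.

Lemma odd_sum0 : odd_sum t s set0 = 1.
Proof.
rewrite /odd_sum /subset_sum (eq_bigl (pred1 set0)).
  by rewrite big_pred1_eq weight_closed ?closed0 // /level_prod big_set0.
by move=> X; rewrite subset0.
Qed.

Lemma level_prod_mirror A : level_prod t t^-1 (mirror_set A) * level_prod t t^-1 A = 1.
Proof.
rewrite !level_prodE; have [-> ->] := card_parts_mirror A.
by rewrite [X in _ * X]mulrC mulrACA -!exprMn divff ?mulVf ?gt_eqF // !expr1n mulr1.
Qed.

Lemma level_prod_closed B : closed s B -> level_prod t t^-1 B = t ^+ excess B.
Proof.
move=> cB; rewrite level_prodE -(subnK (closed_card j0 cB)) exprD -mulrA.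
by rewrite -exprMn divff ?gt_eqF // expr1n mulr1.
Qed.

(* On [B] the configuration is flipped to the other phase and mirrored; this
   removes the contour [cut_edges s B]. *)
Lemma contour_sum_le B Lam : closed s B -> B \subset Lam ->
  \sum_(X : {set T} | (X \subset Lam) && (cut_edges s B \subset cut_edges s X)) weight t s X <=
    (t * mirror_const R J) ^+ excess B * odd_sum t s Lam.
Proof.
move=> /[dup] cB /closedP cBP BL.
have w0 := weight_ge0 s t01; have t0' := ltW t0.
apply: (@le_trans _ _ (t ^+ excess B *
    (odd_sum t s (mirror_set B) * odd_sum t s (Lam :\: B)))).
  rewrite /odd_sum /subset_sum big_distrlr /= pair_big /= mulr_sumr.
  apply: (@sum_inj_le _ _ _ (fun X : {set T} => (mirror_set (B :\: X), X :\: B))).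
  - move=> X Y _ _ [/(can_inj (@mirror_setK Gam)) E1 E2].
    rewrite -(setID X B) -(setID Y B) E2; congr (_ :|: _).
    apply/setP => v; have /setP/(_ v) := E1; rewrite !inE.
    by case: (v \in B); rewrite ?andbT ?andbF //= => /negb_inj.
  - move=> X /andP[XL /subsetP cut] /=; split.
      rewrite setSD // andbT; apply/subsetP => v.
      by rewrite !mem_mirror_set inE => /andP[].
    have [cX|ncX] := boolP (closed s X); last first.
      rewrite {1}/weight (negbTE ncX) mul0r.
      by apply: mulr_ge0; [exact: exprn_ge0|apply: mulr_ge0; exact: w0].
    have cutP a j : (a, false) \notin B -> (a + s j, true) \in B ->
        (a, false) \notin X /\ (a + s j, true) \in X.
      move=> aB jB; have := cut (a, j); rewrite !inE /= aB jB => /(_ isT).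
      by case/andP.
    move/closedP: (cX) => cXP.
    rewrite !weight_closed //.
    + rewrite -level_prod_closed //.
      have E1 := level_prod_split t t^-1 X B; have E2 := level_prod_split t t^-1 B X.
      rewrite setIC in E2; rewrite E1 E2 le_eqVlt; apply/orP; left; apply/eqP.
      by rewrite -[LHS]mulr1 -(level_prod_mirror (B :\: X)); ring.
    + apply/closedP => a j; rewrite !inE => /andP[aB aX]; rewrite cXP // andbT.
      by apply/negP => jB; have [] := cutP a j aB jB; rewrite aX.
    + apply/closedP => a j; rewrite !mem_mirror_set !inE /mirror /= => /andP[aX aB].
      have E : - (a + s j) + s j = - a by rewrite opprD subrK.
      have nX : (- (a + s j), false) \notin X.
        by apply: contra aX => /(cXP _ j); rewrite E.
      rewrite nX /=; apply: contraNT aX => nB.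
      by have := cutP (- (a + s j)) j nB; rewrite E => /(_ aB)[].
  - by move=> [X Y] _; apply: mulr_ge0; [exact: exprn_ge0|apply: mulr_ge0; exact: w0].
rewrite exprMn -mulrA ler_wpM2l ?exprn_ge0 ?(ltW t0) //.
apply: (@le_trans _ _ (mirror_const R J ^+ excess B * odd_sum t s B * odd_sum t s (Lam :\: B))).
  by rewrite ler_wpM2r ?mirror_sum_le // ltW // odd_sum_gt0.
have M0 : 0 <= mirror_const R J by rewrite mulr_ge0 // exprn_ge0.
rewrite -mulrA ler_wpM2l ?exprn_ge0 //.
apply: (le_trans (odd_sum_supermodular s t01 _ _)).
have -> : B :&: (Lam :\: B) = set0 by apply/setP => v; rewrite !inE; case: (v \in B).
rewrite odd_sum0 mulr1 odd_sum_mono //; apply/subsetP => v; rewrite !inE.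
by case: (boolP (v \in B)) => //= /(subsetP BL).
Qed.

End OneContour.

(** * Bipartite contours as closed forms *)

Section Contour.
Variables (R : realFieldType) (t : R) (Gam : finZmodType) (J : finType) (s : J -> Gam).
Hypothesis t01 : 0 < t <= 1.
Variables (N : nat) (h1 h2 : {additive Gam -> 'Z_N.+2}) (e1 e2 : Gam).
Hypotheses (h1e1 : h1 e1 = 1) (h2e1 : h2 e1 = 0) (h2e2 : h2 e2 = 1).
Hypothesis e1N : e1 *+ N.+2 = 0.
Variables (j0 j1 j2 : J).
Hypotheses (sj0 : s j0 = 0) (sj1 : s j1 = e1) (sj2 : s j2 = e2).
Hypothesis h1s : forall j, h1 (s j) = 0 \/ h1 (s j) = 1.
Variables (Q : pred Gam) (lo hi : nat).
Hypotheses (Qe1 : forall a, Q (a + e1) = Q a) (Qh2 : forall a, Q a -> h2 a <> 0).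
Hypotheses (lo3 : (3 <= lo)%N) (hiN : (hi <= N)%N).

Local Notation T := (Gam * bool)%type.
Local Notation height a := (nat_of_ord (h1 a)).
Implicit Types (A B X Y : {set T}) (E : {set Gam * J}).

Definition box := [set a | Q a && (lo <= height a <= hi)%N].
Definition Box : {set T} := [set v | v.1 \in box].

(** The differences of any two points reached by two steps from a common site: on this scale [near]
    relates all corners of a parallelogram. *)
Definition step4 (k : J * J * J * J) := s k.1.1.1 + s k.1.1.2 - s k.1.2 - s k.2.

Definition edge E a j : int := 1 *+ ((a, j) \in E).
(** The change, between the even sites [a] and [a + s j], of an indicator with boundary edges [E]:
    along edge [j] to an odd site, then back along edge [j0] to the even site with the same label,
    as [s j0 = 0]. *)
Definition even_step E j a := edge E a j - edge E (a + s j) j0.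
Definition even_pot E a := ray_sum h1 e1 (even_step E j1) a.
Definition pot E (v : T) :=
  if v.2 then even_pot E v.1 + edge E v.1 j0 else even_pot E v.1.
Definition inside E : {set T} := [set v | pot E v != 0].
Definition base E : {set Gam} := [set a | [exists j, (a, j) \in E]].

Definition edge_contours a0 : {set {set Gam * J}} :=
  [set E | [&& closed s (inside E), inside E \subset Box,
     cut_edges s (inside E) == E & base E \in contours step4 e1 a0]].

Lemma step4_opp k : exists k', step4 k' = - step4 k.
Proof.
exists (k.1.2, k.2, k.1.1.1, k.1.1.2); rewrite /step4 /= !opprD !opprK.
by rewrite addrC addrA addrC -!addrA addrCA [- _ + (_ + _)]addrCA.
Qed.

Lemma step4_0 : exists k, step4 k = 0.
Proof. by exists (j0, j0, j0, j0); rewrite /step4 /= addrK subrr. Qed.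

Lemma h1_step4 k : exists u v : nat,
  [/\ (u <= 2)%N, (v <= 2)%N & h1 (step4 k) = u%:R - v%:R].
Proof.
have H j : exists u : nat, (u <= 1)%N /\ h1 (s j) = u%:R.
  by case: (h1s j) => ->; [exists 0%N|exists 1%N].
have [u1 [l1 E1]] := H k.1.1.1; have [u2 [l2 E2]] := H k.1.1.2.
have [u3 [l3 E3]] := H k.1.2; have [u4 [l4 E4]] := H k.2.
exists (u1 + u2)%N, (u3 + u4)%N; split; [by lia|by lia|].
by rewrite /step4 !raddfB raddfD /= E1 E2 E3 E4 !natrD opprD addrA.
Qed.

Lemma height_add1 a : height (a + e1) = ((height a + 1) %% N.+2)%N.
Proof. by have := height_line h1e1 a 1; rewrite mulr1n. Qed.

Lemma height_step j a : height (a + s j) = height a \/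
  height (a + s j) = ((height a + 1) %% N.+2)%N.
Proof.
case: (h1s j) => E; rewrite raddfD /= E; last by right.
by left; rewrite addn0 modn_small //; exact: ltn_ord.
Qed.

Lemma box_height a : a \in box -> (lo <= height a <= hi)%N.
Proof. by rewrite inE => /andP[]. Qed.

Lemma Q_line a k : Q (a + e1 *+ k) = Q a.
Proof. by elim: k => [|k IH]; rewrite ?mulr0n ?addr0 // mulrSr addrA Qe1. Qed.

Section FixedE.
Variable E : {set Gam * J}.
Hypothesis E_box : forall a j, (a, j) \in E -> a + s j \in box.

Lemma even_step_box j a : even_step E j a != 0 -> a + s j \in box.
Proof.
apply: contraR => nb; rewrite /even_step /edge.
case: (boolP ((a, j) \in E)) => [/E_box aj|_]; first by rewrite aj in nb.
case: (boolP (_ \in E)) => [/E_box aj|_]; last by rewrite subrr.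
by rewrite sj0 addr0 in aj; rewrite aj in nb.
Qed.

Lemma even_step_cut j a : height a = 0%N \/ height a = N.+1 -> even_step E j a = 0.
Proof.
move=> ha; apply/eqP; apply: contraT => /even_step_box /box_height.
by case: ha => ha; case: (height_step j a) => ->; rewrite ha ?addn1 ?modnn ?modn_small //; lia.
Qed.

Lemma even_step_cut2 a : h2 a = 0 -> even_step E j1 a = 0.
Proof.
move=> ha; apply/eqP; apply: contraT => /even_step_box.
by rewrite inE sj1 Qe1 => /andP[/Qh2].
Qed.

Hypothesis E_closed : forall j a,
  even_step E j1 a + even_step E j (a + e1) = even_step E j a + even_step E j1 (a + s j).

Lemma even_potE j a : even_pot E (a + s j) - even_pot E a = even_step E j a.
Proof.
apply: (ray_sumE h1e1 h2e1 h2e2 e1N h1s E_closed) => //.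
- by move=> i b; exact: even_step_cut.
- by move=> b; exact: even_step_cut.
- exact: even_step_cut2.
- by exists j2.
Qed.

Lemma potE a j : pot E (a + s j, true) - pot E (a, false) = edge E a j.
Proof.
rewrite /pot /= addrAC even_potE /even_step subrK //.
Qed.

Lemma even_pot_hits a : even_pot E a != 0 ->
  (exists2 k, even_step E j1 (a + e1 *+ k) != 0 &
     height (a + e1 *+ k) = (height a + k)%N) /\
  (exists2 k, even_step E j1 (a + e1 *+ k) != 0 &
     (height (a + e1 *+ k)%R < height a)%N).
Proof.
move=> nz; apply: (ray_sum_hits h1e1 h2e1 h2e2 e1N E_closed) nz.
- exact: even_step_cut2.
- by exists j2.
Qed.

(** There are jumps both above and below [a] on its line, with ends in the box; the heights of the
    box form an interval. *)
Lemma even_pot_box a : even_pot E a != 0 -> a \in box.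
Proof.
move=> /even_pot_hits[[k kE kh] [k' k'E k'h]].
have kb := even_step_box kE; have k'b := even_step_box k'E.
rewrite sj1 in kb k'b; have := box_height kb; have := box_height k'b.
move: kb; rewrite !inE Qe1 Q_line => /andP[-> _] /=; rewrite !height_add1 kh.
have ha : (height a < N.+2)%N by exact: ltn_ord.
have hb : (height (a + e1 *+ k)%R < N.+2)%N by exact: ltn_ord.
rewrite kh in hb.
rewrite [in X in X -> _]modn_small; last by rewrite addn1; exact: leq_ltn_trans k'h ha.
move: hb; rewrite leq_eqVlt => /orP[/eqP H|H].
  by rewrite !addn1 H modnn; lia.
by rewrite !addn1 modn_small //; lia.
Qed.

End FixedE.

Section Exterior.
Variable X : {set T}.
Hypotheses (cX : closed s X) (XBox : X \subset Box).

Definition adj : rel T := [rel u v |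
  [&& ~~ u.2, v.2 & [exists j, v.1 == u.1 + s j]] ||
  [&& u.2, ~~ v.2 & [exists j, u.1 == v.1 + s j]]].

Definition off := [rel u v | [&& u \notin X, v \notin X & adj u v]].

Definition exterior := [set v | [exists r, (r \notin Box) && connect off r v]].

Definition filled := ~: exterior.

Lemma exterior_off v : v \in exterior -> v \notin X.
Proof.
rewrite inE => /existsP[r /andP[rB /connectP[p pp ->]]].
have rX : r \notin X by apply: contra rB; apply: (subsetP XBox).
elim/last_ind: p pp => [//|p u IH]; rewrite rcons_path last_rcons.
by case/andP=> _ /and3P[].
Qed.

Lemma exterior_edge a j : (a, false) \notin X -> (a + s j, true) \notin X ->
  ((a, false) \in exterior) = ((a + s j, true) \in exterior).
Proof.
move=> aX jX; rewrite !inE; apply/existsP/existsP => -[r /andP[rB rc]];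
  exists r; rewrite rB /=; apply: connect_trans rc (connect1 _);
  rewrite /off /adj /= aX jX /= ?orbF; apply/existsP; by exists j.
Qed.

Lemma not_box_exterior v : v \notin Box -> v \in exterior.
Proof. by move=> vB; rewrite inE; apply/existsP; exists v; rewrite vB connect0. Qed.

Lemma filled_box : filled \subset Box.
Proof.
apply/subsetP => v; rewrite in_setC; apply: contraR; exact: not_box_exterior.
Qed.

Lemma sub_filled : X \subset filled.
Proof.
by apply/subsetP => v vX; rewrite in_setC; apply: contraL vX; exact: exterior_off.
Qed.

Lemma filled_closed : closed s filled.
Proof.
apply/closedP => a j; rewrite !in_setC; apply: contra => jE.
have jX := exterior_off jE.
have aX : (a, false) \notin X by apply: contra jX; exact: (closedP _ _ cX).
by rewrite (exterior_edge aX jX).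
Qed.

Lemma mem_cut_edges (B : {set T}) a j : ((a, j) \in cut_edges s B) =
  ((a, false) \notin B) && ((a + s j, true) \in B).
Proof. by rewrite inE. Qed.

Lemma cut_filled a j : (a, j) \in cut_edges s filled -> (a, j) \in cut_edges s X.
Proof.
rewrite !mem_cut_edges !in_setC negbK => /andP[aE jE]; have aX := exterior_off aE.
by rewrite aX /=; apply: contraR jE => jX; rewrite -(exterior_edge aX jX).
Qed.

Definition roots := base (cut_edges s filled).

Definition piece (C : {set Gam}) := [set e in cut_edges s filled | e.1 \in C].

Definition pieces := [set component step4 roots a | a in roots].

Lemma mem_roots a j : (a, j) \in cut_edges s filled -> a \in roots.
Proof. by move=> aj; rewrite inE; apply/existsP; exists j. Qed.

Lemma piece_box C a j : (a, j) \in piece C -> a + s j \in box.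
Proof.
rewrite inE mem_cut_edges => /andP[/andP[_ jF] _].
by have := subsetP filled_box _ jF; rewrite inE.
Qed.

Definition filled_val v : int := (v \in filled)%:R.

Lemma edge_phi a j : edge (cut_edges s filled) a j = filled_val (a + s j, true) - filled_val (a, false).
Proof.
rewrite /edge mem_cut_edges /filled_val.
have := closedP _ _ filled_closed a j.
case: ((a, false) \in filled) => [/(_ isT) ->|_] /=; first by rewrite subrr.
by rewrite subr0; case: (_ \in filled).
Qed.

Lemma even_step_phi a j :
  even_step (cut_edges s filled) j a = filled_val (a + s j, false) - filled_val (a, false).
Proof. by rewrite /even_step !edge_phi sj0 addr0; ring. Qed.

Lemma edge_piece C a j : edge (piece C) a j = edge (cut_edges s filled) a j *+ (a \in C).
Proof. by rewrite /edge inE /=; case: (_ \in _); case: (_ \in C). Qed.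

Lemma near_corner a i i' k k' : near step4 (a + s i + s i') (a + s k + s k').
Proof.
apply/existsP; exists (k, k', i, i'); rewrite /step4 /=; apply/eqP.
have -> : s k + s k' - s i - s i' = (s k + s k') - (s i + s i').
  by rewrite opprD addrA.
rewrite -(addrA a (s k)) -(addrA a (s i)) -[RHS]addrA; congr (_ + _).
by rewrite [RHS]addrC subrK.
Qed.

Section OnePiece.
Variable C : {set Gam}.
Hypothesis CP : C \in pieces.

Lemma piece_sub : C \subset roots.
Proof. by case/imsetP: CP => a aU ->; exact: component_sub. Qed.

Lemma piece_absorb a b j : b \in C -> near step4 b a ->
  edge (piece C) a j = edge (cut_edges s filled) a j.
Proof.
move=> bC ba; rewrite edge_piece; have [aC|aC] := boolP (a \in C) => //.
rewrite mulr0n /edge; case: (boolP (_ \in cut_edges _ _)) => // aj.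
case/negP: aC; have bU := subsetP piece_sub b bC.
move: CP bC => /imsetP[c cU ->] bC.
exact: component_near bC (mem_roots aj) bU ba.
Qed.

(** All points [a + s i + s i'] are near each other. If one of them lies in [C], every boundary edge
    based at a corner of the parallelogram belongs to the piece and the form is the gradient of
    [filled_val]; otherwise the form vanishes at the corners. *)
Lemma piece_closed j a :
  even_step (piece C) j1 a + even_step (piece C) j (a + e1) =
  even_step (piece C) j a + even_step (piece C) j1 (a + s j).
Proof.
pose corner x := exists i i', x = a + s i + s i'.
have Ca : corner a by exists j0, j0; rewrite sj0 !addr0.
have Ce : corner (a + e1) by exists j1, j0; rewrite sj0 addr0 sj1.
have Cs : corner (a + s j) by exists j0, j; rewrite sj0 addr0.
have Ces : corner (a + e1 + s j) by exists j1, j; rewrite sj1.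
have [/existsP[i /existsP[i' iC]]|nC] :=
    boolP [exists i, exists i', a + s i + s i' \in C].
  have full x l : corner x -> corner (x + s l) ->
      even_step (piece C) l x = filled_val (x + s l, false) - filled_val (x, false).
    move=> [k [k' xE]] [m [m' xlE]]; rewrite -even_step_phi /even_step.
    rewrite (piece_absorb l iC) ?(piece_absorb j0 iC) //.
      by rewrite xlE near_corner.
    by rewrite xE near_corner.
  rewrite !full ?sj1 // [a + s j + e1]addrAC //; ring.
have none x l : corner x -> edge (piece C) x l = 0.
  move=> [k [k' xE]]; rewrite edge_piece; case: (boolP (x \in C)) => // xC.
  by case/negP: nC; apply/existsP; exists k; apply/existsP; exists k'; rewrite -xE.
by rewrite /even_step sj1 [a + s j + e1]addrAC !none // !subr0 !addr0.
Qed.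

Lemma piece_potE a j :
  pot (piece C) (a + s j, true) - pot (piece C) (a, false) = edge (piece C) a j.
Proof. exact: potE (@piece_box C) piece_closed a j. Qed.

Lemma pot_exterior v : v \in exterior -> pot (piece C) v = 0.
Proof.
rewrite inE => /existsP[r /andP[rB /connectP[p pp ->]]].
have r0 : pot (piece C) r = 0.
  have nb : r.1 \notin box by move: rB; rewrite inE.
  have ev : even_pot (piece C) r.1 = 0.
    by apply/eqP; apply: contraR nb; exact: even_pot_box (@piece_box C) piece_closed _.
  rewrite /pot ev /edge; case: (boolP (_ \in piece C)) => [/piece_box|_].
    by rewrite sj0 addr0 (negbTE nb).
  by rewrite addr0; case: ifP.
have rE : r \in exterior by exact: not_box_exterior.
elim: p r pp r0 rE {rB} => [//|u p IH] r /= /andP[ru pp] r0 rE.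
have uE : u \in exterior.
  move: rE; rewrite !inE => /existsP[q /andP[qB qr]]; apply/existsP; exists q.
  by rewrite qB (connect_trans qr) //; apply: (@connect1 _ off); exact: ru.
apply: (IH u pp) => //.
have nocut a j : (a + s j, true) \in exterior -> edge (piece C) a j = 0.
  by move=> jE; rewrite edge_piece /edge mem_cut_edges !in_setC jE andbF mul0rn.
case/and3P: ru => _ _; case: r r0 rE => [a b]; case: u uE {IH pp} => [a' b'] /= uE r0 rE.
case/orP => /and3P[/= b1 b2 /existsP[j /= /eqP aE]].
  move: uE r0; rewrite (negbTE b1) b2 aE => uE r0.
  by have := piece_potE a j; rewrite nocut // r0 subr0.
move: rE r0 {uE}; rewrite (negbTE b2) b1 aE => rE r0.
by have := piece_potE a' j; rewrite nocut // r0 sub0r => /eqP; rewrite oppr_eq0 => /eqP.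
Qed.

Lemma inside_filled : inside (piece C) \subset filled.
Proof.
apply/subsetP => v; rewrite inE in_setC; apply: contra => vE.
by rewrite pot_exterior.
Qed.

Lemma inside_closed : closed s (inside (piece C)).
Proof.
apply/closedP => a j; rewrite [_ \in inside _]inE => aI.
have aF : (a, false) \in filled.
  by apply: (subsetP inside_filled); rewrite inE.
rewrite inE; have := piece_potE a j.
rewrite edge_piece /edge mem_cut_edges aF /= mul0rn => /eqP.
by rewrite subr_eq0 => /eqP ->.
Qed.

(** An edge of the piece starts at an exterior site, where the potential is 0, and raises it by 1;
    any other edge joins sites of equal potential. *)
Lemma cut_inside : cut_edges s (inside (piece C)) = piece C.
Proof.
apply/setP => -[a j]; rewrite mem_cut_edges ![_ \in inside _]inE negbK.
have := piece_potE a j; rewrite /edge; case: (boolP ((a, j) \in piece C)) => aj.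
  have aE : (a, false) \in exterior.
    by move: aj; rewrite inE mem_cut_edges in_setC negbK => /andP[/andP[]].
  by rewrite (pot_exterior aE) subr0 eqxx => ->.
by move/eqP; rewrite subr_eq0 => /eqP ->; rewrite andbN.
Qed.

Lemma base_piece : base (piece C) = C.
Proof.
apply/setP => a; rewrite inE; apply/existsP/idP => [[j]|aC].
  by rewrite inE => /andP[].
have := subsetP piece_sub a aC; rewrite inE => /existsP[j aj].
by exists j; rewrite inE aj.
Qed.

Lemma piece_height a : a \in C -> (2 <= height a)%N.
Proof.
rewrite -base_piece inE => /existsP[j /piece_box /box_height].
have ha : (height a < N.+2)%N by exact: ltn_ord.
case: (height_step j a) => ->; first by lia.
move: ha; rewrite leq_eqVlt => /orP[/eqP H|H]; last by rewrite modn_small; lia.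
by rewrite addn1 H modnn; lia.
Qed.

Lemma piece_contour v : pot (piece C) v != 0 -> C \in contours step4 e1 v.1.
Proof.
move=> v0; have conn : near_connected step4 C.
  by case/imsetP: CP => a aU ->; apply: component_connected; exact: step4_opp.
have hit b : even_step (piece C) j1 b != 0 -> (b \in C) || (b + e1 \in C).
  rewrite /even_step !edge_piece sj1; case: (b \in C) => //=.
  by case: (_ \in C); rewrite // !mulr0n subrr.
(* The potential of an odd site may come from its edge [j0] alone; then its label is in [C]
   itself. *)
have [ev0|ev] := eqVneq (even_pot (piece C) v.1) 0.
  have vC : v.1 \in C.
    move: v0; rewrite /pot ev0; case: ifP; rewrite ?eqxx // add0r edge_piece => _.
    by case: (v.1 \in C); rewrite ?mulr0n ?eqxx.
  by rewrite inE conn; apply/existsP; exists ord0; rewrite mulr0n addr0.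
have [[k kE kh] [k' k'E k'h]] := even_pot_hits (@piece_box C) piece_closed ev.
apply: (hits_contours h1e1 h1_step4 conn) => //.
- exact: piece_height.
- by exists k => //; rewrite mulrSr addrA hit.
- by exists k' => //; rewrite mulrSr addrA hit.
Qed.

End OnePiece.

Lemma sum_pieces_edge a j :
  \sum_(C in pieces) edge (piece C) a j = edge (cut_edges s filled) a j.
Proof.
under eq_bigr do rewrite edge_piece.
have [aU|aU] := boolP (a \in roots).
  by rewrite sum_components //; exact: step4_opp.
have -> : edge (cut_edges s filled) a j = 0.
  by rewrite /edge; case: (boolP (_ \in _)) => // /mem_roots; rewrite (negbTE aU).
by rewrite big1 // => C _; rewrite mul0rn.
Qed.

Lemma even_pot_phi a : even_pot (cut_edges s filled) a = filled_val (a, false).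
Proof.
rewrite /even_pot /ray_sum.
have -> : \sum_(k < N.+2 - height a) even_step (cut_edges s filled) j1 (a + e1 *+ k) =
    filled_val (a + e1 *+ (N.+2 - height a), false) - filled_val (a, false).
  elim: (N.+2 - height a)%N => [|m IH].
    by rewrite big_ord0 mulr0n addr0 subrr.
  by rewrite big_ord_recr /= IH even_step_phi sj1 mulrSr [a + (_ + _)]addrA; ring.
rewrite opprB [filled_val (a + _, _)](_ : _ = 0) ?subr0 // /filled_val.
case: (boolP (_ \in filled)) => // /(subsetP filled_box); rewrite inE => /box_height.
by rewrite (height_last h1e1); lia.
Qed.

Lemma sum_pieces_pot v : \sum_(C in pieces) pot (piece C) v = filled_val v.
Proof.
have ev a : \sum_(C in pieces) even_pot (piece C) a = filled_val (a, false).
  rewrite -even_pot_phi /even_pot /ray_sum sumrN exchange_big /=; congr (- _).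
  apply: eq_bigr => k _; rewrite /even_step sumrB.
  by rewrite !sum_pieces_edge.
case: v => a []; rewrite /pot /=; last exact: ev.
by rewrite big_split /= ev sum_pieces_edge edge_phi sj0 addr0; ring.
Qed.

(** The potentials of the pieces add up to [filled_val], which is 1 at [v]; so one of them is
    nonzero there. *)
Lemma edge_contour_exists v : v \in X ->
  exists2 E, E \in edge_contours v.1 & E \subset cut_edges s X.
Proof.
move=> vX; have phiv : filled_val v != 0 by rewrite /filled_val (subsetP sub_filled _ vX).
have [C CP Cv] : exists2 C, C \in pieces & pot (piece C) v != 0.
  apply/exists_inP; apply: contraNT phiv; rewrite negb_exists => /forallP H.
  rewrite -sum_pieces_pot big1 // => C CP; apply/eqP.
  by have := H C; rewrite CP /= negbK.
exists (piece C); last first.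
  by apply/subsetP => -[a j]; rewrite inE => /andP[/cut_filled].
rewrite inE inside_closed // cut_inside // eqxx base_piece // piece_contour // andbT /=.
by rewrite andbT (subset_trans (inside_filled CP)) // filled_box.
Qed.

End Exterior.

Lemma card_contour_edges E : (#|base E| <= #|E|)%N.
Proof.
have -> : base E = (fun e : Gam * J => e.1) @: E.
  apply/setP => a; rewrite inE; apply/existsP/imsetP => [[j aj]|[[b j] bE ->]].
    by exists (a, j).
  by exists j.
exact: leq_imset_card.
Qed.

(** A contour consists of its base [C] and one of the [2 ^ (#|J| * #|C|)] sets of edges based in
    [C]; this puts the factor [2 ^ #|J|] on the rate. *)
Lemma sum_edge_contours (y : R) a : 0 <= y <= 1 ->
  6%:R * #|{: J * J * J * J}|%:R ^+ 2 * (2%:R ^+ #|J| * y) <= 1 ->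
  \sum_(E in edge_contours a) y ^+ #|E| <=
    6%:R * #|{: J * J * J * J}|%:R ^+ 2 * (2%:R ^+ #|J| * y).
Proof.
move=> /andP[y0 y1] small.
have z0 : 0 <= 2%:R ^+ #|J| * y by rewrite mulr_ge0 ?exprn_ge0.
apply: le_trans (sum_contours step4_0 step4_opp e1 a z0 small).
have -> : \sum_(C in contours step4 e1 a) (2%:R ^+ #|J| * y) ^+ #|C| =
    \sum_(C in contours step4 e1 a) \sum_(E : {set Gam * J} | E \subset setX C [set: J]) y ^+ #|C|.
  apply: eq_bigr => C _; rewrite exprMn -exprM.
  rewrite (eq_bigl (mem (powerset (setX C [set: J])))); last first.
    by move=> E; rewrite /= powersetE.
  rewrite sumr_const card_powerset cardsX cardsT -[RHS]mulr_natl natrX mulnC //.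
rewrite pair_big_dep /=.
apply: (@sum_inj_le _ _ _ (fun E : {set Gam * J} => (base E, E))).
- by move=> E F _ _ [].
- move=> E; rewrite inE => /and4P[_ _ _ EC] /=; rewrite EC /=; split.
    apply/subsetP => -[b j] bE; rewrite in_setX in_setT andbT inE.
    by apply/existsP; exists j.
  by rewrite ler_wiXn2l ?y0 // card_contour_edges.
- by move=> [C E] _; rewrite exprn_ge0.
Qed.

(** Each unit of [excess] costs [t * mirror_const R J] and accounts for [#|J|] boundary edges, so
    [y] bounds the cost of one edge. *)
Lemma odd_phase_stable (y : R) v : 0 <= y <= 1 -> t * mirror_const R J <= y ^+ #|J| ->
  6%:R * #|{: J * J * J * J}|%:R ^+ 2 * (2%:R ^+ #|J| * y) <= 1 ->
  \sum_(X : {set T} | (X \subset Box) && (v \in X)) weight t s X <=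
    6%:R * #|{: J * J * J * J}|%:R ^+ 2 * (2%:R ^+ #|J| * y) * odd_sum t s Box.
Proof.
move=> y01 ty small; have /andP[y0 y1] := y01.
have w0 := weight_ge0 s t01; have Z0 : 0 < odd_sum t s Box by exact: odd_sum_gt0.
have t0 : 0 < t by case/andP: t01.
have M0 : 0 <= mirror_const R J by rewrite mulr_ge0 // exprn_ge0.
apply: (@le_trans _ _ (\sum_(E in edge_contours v.1) \sum_(X : {set T} |
    (X \subset Box) && (cut_edges s (inside E) \subset cut_edges s X)) weight t s X)).
  under [leRHS]eq_bigr do rewrite big_mkcond.
  rewrite exchange_big /= big_mkcond /=; apply: ler_sum => X _.
  have sum0 (P : pred {set Gam * J}) (Q' : {set Gam * J} -> bool) :
      0 <= \sum_(E | P E) (if Q' E then weight t s X else 0).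
    by apply: sumr_ge0 => E _; case: ifP.
  case: ifP => [/andP[XB vX]|_]; last exact: sum0.
  have [cX|ncX] := boolP (closed s X); last first.
    by rewrite {1}/weight (negbTE ncX) mul0r sum0.
  have [E EC EX] := edge_contour_exists cX XB vX.
  rewrite (bigD1 E) //= XB /=; move: (EC); rewrite inE => /and4P[_ _ /eqP -> _].
  by rewrite EX lerDl; apply: sumr_ge0 => F _; case: ifP.
apply: (@le_trans _ _ (\sum_(E in edge_contours v.1) y ^+ #|E| * odd_sum t s Box)).
  apply: ler_sum => E; rewrite inE => /and4P[cI IB /eqP cut _].
  apply: (le_trans (contour_sum_le j0 t01 cI IB)); rewrite ler_wpM2r ?(ltW Z0) //.
  rewrite -{2}cut card_cut_edges // exprM lerXn2r // nnegrE ?exprn_ge0 //.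
  by rewrite mulr_ge0 // ltW.
by rewrite -mulr_suml ler_wpM2r ?(ltW Z0) // sum_edge_contours.
Qed.

End Contour.

(** * Peierls estimate for the triangular lattice *)

Section Triangular.
Variables (Gam : finZmodType) (N : nat).
Variables (h1 h2 : {additive Gam -> 'Z_N.+2}) (cl : {additive Gam -> 'Z_3}).
Variables (e1 e2 : Gam).
Hypotheses (h1e1 : h1 e1 = 1) (h2e1 : h2 e1 = 0) (h1e2 : h1 e2 = 0) (h2e2 : h2 e2 = 1).
Hypotheses (cle1 : cl e1 = 1) (cle2 : cl e2 = 1).
Hypothesis e1N : e1 *+ N.+2 = 0.
Variables (lo hi : nat).
Hypotheses (lo3 : (3 <= lo)%N) (hiN : (hi.+1 <= N)%N).
Implicit Types (I C : {set Gam}) (i : 'Z_3).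

Local Notation height a := (nat_of_ord (h1 a)).
Local Notation height2 a := (nat_of_ord (h2 a)).

(* The origin followed by the six directions of the triangular lattice, in
   cyclic order. *)
Definition nb (k : 'I_7) : Gam :=
  nth 0 [:: 0; e1; e1 + e2; e2; - e1; - (e1 + e2); - e2] k.

Definition tri_rel : rel Gam := [rel u v | [exists k : 'I_7, (k != ord0) && (v == u + nb k)]].

(** One of each pair of opposite directions, chosen with [h1] equal to 0 or 1 as [ray_sum]
    requires. *)
Definition step (j : 'I_3) : Gam := nth 0 [:: e1; e1 + e2; e2] j.

(** Pieces are formed at graph distance 2: the corners of a parallelogram are then near each other,
    and every vertex within distance 2 of a piece but outside it is correct. *)
Definition disp (k : 'I_7 * 'I_7) := nb k.1 + nb k.2.

Definition j1 : 'I_3 := @Ordinal 3 0 isT.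
Definition j2 : 'I_3 := @Ordinal 3 2 isT.

Lemma step_j1 : step j1 = e1. Proof. by []. Qed.

Lemma nb0 : nb ord0 = 0. Proof. by []. Qed.

Lemma nb_opp k : exists k', nb k' = - nb k.
Proof.
case: k => -[|[|[|[|[|[|[|//]]]]]]] lt; rewrite /nb /=.
- by exists (@Ordinal 7 0 isT); rewrite /= oppr0.
- by exists (@Ordinal 7 4 isT).
- by exists (@Ordinal 7 5 isT).
- by exists (@Ordinal 7 6 isT).
- by exists (@Ordinal 7 1 isT); rewrite /= opprK.
- by exists (@Ordinal 7 2 isT); rewrite /= opprK.
- by exists (@Ordinal 7 3 isT); rewrite /= opprK.
Qed.

Lemma step_nb j : exists k, nb k = step j.
Proof.
case: j => -[|[|[|//]]] lt; rewrite /step /=.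
- by exists (@Ordinal 7 1 isT).
- by exists (@Ordinal 7 2 isT).
- by exists (@Ordinal 7 3 isT).
Qed.

Lemma disp_opp k : exists k', disp k' = - disp k.
Proof.
have [a aE] := nb_opp k.1; have [b bE] := nb_opp k.2.
by exists (a, b); rewrite /disp /= aE bE opprD.
Qed.

Lemma disp_0 : exists k, disp k = 0.
Proof. by exists (ord0, ord0); rewrite /disp /= nb0 addr0. Qed.

Lemma h1_nb k : exists u v : nat, [/\ (u <= 1)%N, (v <= 1)%N & h1 (nb k) = u%:R - v%:R].
Proof.
case: k => -[|[|[|[|[|[|[|//]]]]]]] lt;
  rewrite /nb [nth _ _ _]/= ?(raddfN h1) ?(raddfD h1) ?raddf0 ?h1e1 ?h1e2.
- by exists 0%N, 0%N; rewrite subr0.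
- by exists 1%N, 0%N; rewrite subr0.
- by exists 1%N, 0%N; rewrite subr0 addr0.
- by exists 0%N, 0%N; rewrite subr0.
- by exists 0%N, 1%N; rewrite sub0r.
- by exists 0%N, 1%N; rewrite sub0r addr0.
- by exists 0%N, 0%N; rewrite subr0 oppr0.
Qed.

Lemma h1_disp k : exists u v : nat, [/\ (u <= 2)%N, (v <= 2)%N & h1 (disp k) = u%:R - v%:R].
Proof.
have [u [v [u1 v1 E]]] := h1_nb k.1; have [u' [v' [u'1 v'1 E']]] := h1_nb k.2.
exists (u + u')%N, (v + v')%N; split; [by lia|by lia|].
by rewrite /disp raddfD /= E E' !natrD opprD addrACA.
Qed.

Lemma h1_step j : h1 (step j) = 0 \/ h1 (step j) = 1.
Proof.
case: j => -[|[|[|//]]] lt; rewrite /step [nth _ _ _]/= ?raddfD ?h1e1 ?h1e2; first by right.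
  by right; rewrite addr0.
by left.
Qed.

Lemma near_nb2 a k k' : near disp a (a + nb k + nb k').
Proof. by apply/existsP; exists (k, k'); rewrite /disp /= addrA. Qed.

Lemma near_nb a k : near disp a (a + nb k).
Proof. by have := near_nb2 a k ord0; rewrite nb0 addr0. Qed.

Lemma near_refl a : near disp a a.
Proof. by have := near_nb a ord0; rewrite nb0 addr0. Qed.

Lemma nb_ind (P : Gam -> Gam -> Prop) : (forall u, P u u) ->
  (forall u v, P u v -> P v u) -> (forall u j, P u (u + step j)) ->
  forall u k, P u (u + nb k).
Proof.
move=> Prefl Psym Pstep u k.
have Popp v j : P v (v - step j).
  by apply: Psym; rewrite -{2}[v](subrK (step j)).
case: k => -[|[|[|[|[|[|[|//]]]]]]] lt; rewrite /nb /= ?addr0 //.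
- exact: (Pstep u (@Ordinal 3 0 isT)).
- exact: (Pstep u (@Ordinal 3 1 isT)).
- exact: (Pstep u (@Ordinal 3 2 isT)).
- exact: (Popp u (@Ordinal 3 0 isT)).
- exact: (Popp u (@Ordinal 3 1 isT)).
- exact: (Popp u (@Ordinal 3 2 isT)).
Qed.

Definition correct I i v := [forall k : 'I_7, (v + nb k \in I) == (cl (v + nb k) == i)].

Definition incorrect I := [set v | [forall i, ~~ correct I i v]].

Lemma correctP I i v :
  reflect (forall k, (v + nb k \in I) = (cl (v + nb k) == i)) (correct I i v).
Proof. by apply: (iffP forallP) => H k; apply/eqP; exact: H. Qed.

Lemma cl_nb v k : cl (v + nb k) = cl v + (nth 0%N [:: 0; 1; 2; 1; 2; 1; 2] k)%:R.
Proof.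
rewrite (raddfD cl); congr (_ + _).
case: k => -[|[|[|[|[|[|[|//]]]]]]] lt; rewrite /nb [nth _ _ _]/= ?(raddfN cl);
  rewrite ?(raddfD cl) ?raddf0 ?cle1 ?cle2; exact: val_inj.
Qed.

Lemma cl_nb_neq0 k : k != ord0 -> cl (nb k) != 0.
Proof.
rewrite -[nb k]add0r cl_nb raddf0 add0r.
by case: k => -[|[|[|[|[|[|[|//]]]]]]].
Qed.

(** Both phases prescribe the same membership at the two vertices, whose classes differ; with three
    classes this determines the phase. *)
Lemma correct_nb I i j v k : k != ord0 -> correct I i v -> correct I j (v + nb k) -> i = j.
Proof.
move=> k0 /correctP ci /correctP cj.
have [k' k'E] := nb_opp k.
have E1 := ci ord0; have E2 := cj k'; have E3 := ci k; have E4 := cj ord0.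
rewrite k'E addrK in E2; rewrite !nb0 !addr0 in E1 E4.
rewrite E1 in E2; rewrite E3 in E4; rewrite raddfD /= in E4.
have := cl_nb_neq0 k0; move: E2 E4.
move: (cl v) (cl (nb k)) i j {ci cj E1 E3} => x y i j; move: x y i j.
by do 4! [case=> -[|[|[|//]]] ?] => //= _ _ _; apply: val_inj.
Qed.

Lemma correct_uniq I i j v : correct I i v -> correct I j v -> i = j.
Proof.
move=> /correctP ci /correctP cj.
have E k : (cl (v + nb k) == i) = (cl (v + nb k) == j) by rewrite -ci cj.
have := E ord0; have := E (@Ordinal 7 1 isT); have := E (@Ordinal 7 4 isT).
rewrite !cl_nb.
by move: (cl v) i j {ci cj E}; do 3! [case=> -[|[|[|//]]] ?] => //= _ _ _; apply: val_inj.
Qed.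

(* The weights add up to 9, and a correct vertex counts 3, whatever its class:
   independent sets lose density exactly at incorrect vertices. *)
Definition local_count I v : nat :=
  (\sum_(k : 'I_7) (if k == ord0 then 3 else 1) * ((v + nb k)%R \in I))%N.

Lemma sum_local_count I : (\sum_v local_count I v = 9 * #|I|)%N.
Proof.
rewrite /local_count exchange_big /=.
have cnt (k : 'I_7) : (\sum_v (if k == ord0 then 3 else 1) * ((v + nb k)%R \in I) =
    (if k == ord0 then 3 else 1) * #|I|)%N.
  rewrite -big_distrr /=; congr (_ * _)%N.
  rewrite -(card_preimset I (addIr (nb k))) -sum1_card [RHS]big_mkcond /=.
  by apply: eq_bigr => v _; rewrite inE; case: (_ \in I).
rewrite (eq_bigr _ (fun k _ => cnt k)) -big_distrl /=; congr (_ * _)%N.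
by rewrite !big_ord_recl big_ord0.
Qed.

Lemma local_countE I v : local_count I v =
  (3 * (v \in I) + ((v + e1)%R \in I) + ((v + (e1 + e2))%R \in I) +
   ((v + e2)%R \in I) + ((v - e1)%R \in I) + ((v - (e1 + e2))%R \in I) +
   ((v - e2)%R \in I))%N.
Proof.
by rewrite /local_count !big_ord_recl big_ord0 /nb /= addr0 !mul1n addn0 !addnA.
Qed.

Lemma local_count_correct I i v : correct I i v -> local_count I v = 3%N.
Proof.
move=> /correctP ci; rewrite /local_count.
rewrite (eq_bigr (fun k : 'I_7 => ((if k == ord0 then 3 else 1) *
    (cl v + (nth 0%N [:: 0; 1; 2; 1; 2; 1; 2] k)%:R == i)%R)%N));
  last by move=> k _; rewrite ci cl_nb.
rewrite !big_ord_recl big_ord0.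
by move: (cl v) i {ci}; do 2! [case=> -[|[|[|//]]] ?].
Qed.

(** The 12 edges of the wheel around [v] leave only three patterns of count 3, the centre alone and
    the two alternating triples of the hexagon, and these are the correct ones. *)
Lemma local_count_indep I v : indep tri_rel I ->
  (local_count I v <= 3)%N /\ (v \in incorrect I -> (local_count I v <= 2)%N).
Proof.
move=> /indepP ind.
have ex u w k : w = u + nb k -> k != ord0 -> ~~ ((u \in I) && (w \in I)).
  move=> wE k0; apply/negP => /andP[uI wI]; have /negP := ind u w uI wI; apply.
  by apply/existsP; exists k; rewrite k0 wE /=.
pose k1 := @Ordinal 7 1 isT; pose k2 := @Ordinal 7 2 isT; pose k3 := @Ordinal 7 3 isT.
pose k4 := @Ordinal 7 4 isT; pose k5 := @Ordinal 7 5 isT; pose k6 := @Ordinal 7 6 isT.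
have c1 := ex v (v + e1) k1 erefl isT; have c2 := ex v (v + (e1 + e2)) k2 erefl isT.
have c3 := ex v (v + e2) k3 erefl isT; have c4 := ex v (v - e1) k4 erefl isT.
have c5 := ex v (v - (e1 + e2)) k5 erefl isT; have c6 := ex v (v - e2) k6 erefl isT.
have r1 : ~~ ((v + e1 \in I) && (v + (e1 + e2) \in I)).
  by apply: (ex _ _ k3) => //; rewrite /nb /= addrA.
have r2 : ~~ ((v + e2 \in I) && (v + (e1 + e2) \in I)).
  by apply: (ex _ _ k1) => //; rewrite /nb /= [e1 + e2]addrC addrA.
have r3 : ~~ ((v - e1 \in I) && (v + e2 \in I)).
  by apply: (ex _ _ k2) => //; rewrite /nb /= addrA subrK.
have r4 : ~~ ((v - (e1 + e2) \in I) && (v - e1 \in I)).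
  by apply: (ex _ _ k3) => //; rewrite /nb /= opprD addrA subrK.
have r5 : ~~ ((v - (e1 + e2) \in I) && (v - e2 \in I)).
  by apply: (ex _ _ k1) => //; rewrite /nb /= opprD addrA addrAC subrK.
have r6 : ~~ ((v - e2 \in I) && (v + e1 \in I)).
  by apply: (ex _ _ k2) => //; rewrite /nb /= [e1 + e2]addrC addrA subrK.
rewrite local_countE.
have pat i : (forall k, (v + nb k \in I) = (cl (v + nb k) == i)) -> v \in incorrect I -> False.
  by move=> H; rewrite inE => /forallP/(_ i)/negP; apply; apply/correctP.
have pats i b0 b1 b2 b3 b4 b5 b6 :
    (v \in I) = b0 -> (v + e1 \in I) = b1 -> (v + (e1 + e2) \in I) = b2 ->
    (v + e2 \in I) = b3 -> (v - e1 \in I) = b4 -> (v - (e1 + e2) \in I) = b5 ->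
    (v - e2 \in I) = b6 ->
    [&& (cl v == cl v + i) == b0, (cl v + 1 == cl v + i) == b1,
        (cl v + (1 + 1) == cl v + i) == b2, (cl v + 1 == cl v + i) == b3,
        (cl v - 1 == cl v + i) == b4, (cl v - (1 + 1) == cl v + i) == b5 &
        (cl v - 1 == cl v + i) == b6] -> v \in incorrect I -> False.
  move=> E0 E1 E2 E3 E4 E5 E6 /and5P[/eqP H0 /eqP H1 /eqP H2 /eqP H3 /and3P[/eqP H4 /eqP H5 /eqP H6]].
  apply: (pat (cl v + i)) => -[[|[|[|[|[|[|[|//]]]]]]] lt];
    rewrite /nb [nth _ _ _]/= ?addr0 ?(raddfD cl) ?(raddfN cl) ?(raddfD cl) ?cle1 ?cle2.
  - by rewrite E0 H0.
  - by rewrite E1 H1.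
  - by rewrite E2 H2.
  - by rewrite E3 H3.
  - by rewrite E4 H4.
  - by rewrite E5 H5.
  - by rewrite E6 H6.
have cons x : (cl v == cl v + x) = (x == 0) by rewrite -{1}[cl v]addr0 (inj_eq (addrI _)) eq_sym.
move: c1 c2 c3 c4 c5 c6 r1 r2 r3 r4 r5 r6 {pat ex ind k1 k2 k3 k4 k5 k6}.
have P0 := pats 0; have P1 := pats 1; have P2 := pats (1 + 1).
move: P0 P1 P2 {pats}; rewrite !(inj_eq (addrI (cl v))) !cons.
case: (v \in I); case: (v + e1 \in I); case: (v + (e1 + e2) \in I); case: (v + e2 \in I);
 case: (v - e1 \in I); case: (v - (e1 + e2) \in I); case: (v - e2 \in I) => // P0 P1 P2 *;
 split=> // inc; exfalso.
- by apply: (P0 _ _ _ _ _ _ _ erefl erefl erefl erefl erefl erefl erefl).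
- by apply: (P1 _ _ _ _ _ _ _ erefl erefl erefl erefl erefl erefl erefl).
- by apply: (P2 _ _ _ _ _ _ _ erefl erefl erefl erefl erefl erefl erefl).
Qed.

Definition ground i : {set Gam} := [set v | cl v == i].
Definition tbox : {set Gam} :=
  [set v | ((lo <= height v) && (height v <= hi) && ((lo <= height2 v) && (height2 v <= hi)))%N].
(** The box enlarged by one layer: a vertex outside it sees only frozen sites and is therefore
    correct. *)
Definition tbox1 : {set Gam} :=
  [set v | ((lo <= (height v).+1) && (height v <= hi.+1) &&
           ((lo <= (height2 v).+1) && (height2 v <= hi.+1)))%N].

Definition phase I v : option 'Z_3 := [pick i | correct I i v].

(* Phase relative to [i]; junk value [0] at incorrect vertices. *)
Definition phi i I v : 'Z_3 := if phase I v is Some j then j - i else 0.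

Definition touch C u v := (u \in C) || (v \in C).

Definition jump i I C (j : 'I_3) a : 'Z_3 :=
  (phi i I (a + step j) - phi i I a) *+ touch C a (a + step j).

(* The potential created by the contour [C] alone. *)
Definition psi i I C a : 'Z_3 := ray_sum h1 e1 (jump i I C j1) a.

Definition tri_pieces I : {set {set Gam}} :=
  [set component disp (incorrect I) a | a in incorrect I].

Lemma phase_correct I i v : correct I i v -> phase I v = Some i.
Proof.
move=> ci; rewrite /phase; case: pickP => [j cj|/(_ i)]; last by rewrite ci.
by rewrite (correct_uniq cj ci).
Qed.

Lemma not_incorrect I v : v \notin incorrect I -> exists i, correct I i v.
Proof.
rewrite inE negb_forall => /existsP[i]; rewrite negbK => ci; by exists i.
Qed.

Lemma correct_phi i I v : v \notin incorrect I -> correct I (i + phi i I v) v.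
Proof.
by move=> /not_incorrect[j cj]; rewrite /phi (phase_correct cj) addrC subrK.
Qed.

Lemma phi_correct i I v j : correct I j v -> phi i I v = j - i.
Proof. by move=> cj; rewrite /phi (phase_correct cj). Qed.

Lemma phi_step i I v k : v \notin incorrect I -> v + nb k \notin incorrect I ->
  phi i I (v + nb k) = phi i I v.
Proof.
have [->|k0] := eqVneq k ord0; first by rewrite nb0 addr0.
move=> /not_incorrect[j cj] /not_incorrect[j' cj'].
by rewrite (phi_correct i cj) (phi_correct i cj') (correct_nb k0 cj cj').
Qed.

Lemma exact_height (h : {additive Gam -> 'Z_N.+2}) w k (a b : nat) :
  (a <= 1)%N -> (b <= 1)%N -> h (nb k) = a%:R - b%:R ->
  (1 <= nat_of_ord (h w) <= N)%N ->
  nat_of_ord (h (w + nb k)) = (nat_of_ord (h w) + a - b)%N.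
Proof.
move=> a1 b1 E /andP[w1 wN].
have -> : h (w + nb k) = (nat_of_ord (h w) + a - b)%:R.
  by rewrite (raddfD h) E natrB ?natrD; [rewrite addrA natr_Zp|lia].
by rewrite val_Zp_nat // modn_small //; lia.
Qed.

Lemma h2_nb k : exists u v : nat, [/\ (u <= 1)%N, (v <= 1)%N & h2 (nb k) = u%:R - v%:R].
Proof.
case: k => -[|[|[|[|[|[|[|//]]]]]]] lt;
  rewrite /nb [nth _ _ _]/= ?(raddfN h2) ?(raddfD h2) ?raddf0 ?h2e1 ?h2e2.
- by exists 0%N, 0%N; rewrite subr0.
- by exists 0%N, 0%N; rewrite subr0.
- by exists 1%N, 0%N; rewrite subr0 add0r.
- by exists 1%N, 0%N; rewrite subr0.
- by exists 0%N, 0%N; rewrite subr0 oppr0.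
- by exists 0%N, 1%N; rewrite sub0r add0r.
- by exists 0%N, 1%N; rewrite sub0r.
Qed.

Lemma tbox_nb w k : w \in tbox -> w + nb k \in tbox1.
Proof.
rewrite !inE => /andP[/andP[l1 u1] /andP[l2 u2]].
have [a [b [a1 b1 E]]] := h1_nb k; have [a' [b' [a'1 b'1 E']]] := h2_nb k.
rewrite (exact_height a1 b1 E) ?(exact_height a'1 b'1 E'); lia.
Qed.

Lemma tbox1_outward w : w \in tbox1 -> w \notin tbox -> exists k, w + nb k \notin tbox1.
Proof.
rewrite !inE => /andP[/andP[l1 u1] /andP[l2 u2]].
rewrite negb_and !negb_and -!ltnNge => H.
have n1 : h1 (nb (@Ordinal 7 4 isT)) = 0%:R - 1%:R by rewrite (raddfN h1) h1e1 sub0r.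
have n2 : h1 (nb (@Ordinal 7 1 isT)) = 1%:R - 0%:R by rewrite subr0.
have n3 : h2 (nb (@Ordinal 7 6 isT)) = 0%:R - 1%:R by rewrite (raddfN h2) h2e2 sub0r.
have n4 : h2 (nb (@Ordinal 7 3 isT)) = 1%:R - 0%:R by rewrite subr0.
case/orP: H => /orP[] H; [exists (@Ordinal 7 4 isT)|exists (@Ordinal 7 1 isT)|
  exists (@Ordinal 7 6 isT)|exists (@Ordinal 7 3 isT)]; rewrite !inE.
- rewrite (exact_height (isT : (0 <= 1)%N) (isT : (1 <= 1)%N) n1); lia.
- rewrite (exact_height (isT : (1 <= 1)%N) (isT : (0 <= 1)%N) n2); lia.
- rewrite (exact_height (isT : (0 <= 1)%N) (isT : (1 <= 1)%N) n3); lia.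
- rewrite (exact_height (isT : (1 <= 1)%N) (isT : (0 <= 1)%N) n4); lia.
Qed.

Section Configuration.
Variables (i : 'Z_3) (I : {set Gam}).
Hypothesis I_conf : I \in hc_conf tri_rel tbox (ground i).

Lemma conf_indep : indep tri_rel I.
Proof. by move: I_conf; rewrite inE => /andP[]. Qed.

Lemma conf_ground v : v \notin tbox -> (v \in I) = (cl v == i).
Proof.
move=> vB; move: I_conf; rewrite inE => /andP[_ /eqP /setP /(_ v)].
by rewrite !in_setD vB inE.
Qed.

Lemma frozen_correct v : v \notin tbox1 -> correct I i v.
Proof.
move=> vB; apply/correctP => k; rewrite conf_ground //; apply: contra vB => kB.
have [k' k'E] := nb_opp k; have := tbox_nb k' kB.
by rewrite k'E addrK.
Qed.

Lemma incorrect_tbox1 : incorrect I \subset tbox1.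
Proof.
apply/subsetP => v; apply: contraLR => vB; rewrite inE negb_forall.
by apply/existsP; exists i; rewrite negbK frozen_correct.
Qed.

Section OnePiece.
Variable C : {set Gam}.
Hypothesis CP : C \in tri_pieces I.

Lemma tri_piece_sub : C \subset incorrect I.
Proof. by case/imsetP: CP => a aU ->; exact: component_sub. Qed.

Lemma tri_piece_absorb u v : u \in C -> near disp u v -> v \notin C -> v \notin incorrect I.
Proof.
move=> uC uv; apply: contra => vU; have uU := subsetP tri_piece_sub u uC.
move: CP uC => /imsetP[c cU ->] uC; exact: component_near uC vU uU uv.
Qed.

Lemma tri_piece_connected : near_connected disp C.
Proof.
by case/imsetP: CP => a aU ->; apply: component_connected; exact: disp_opp.
Qed.

Lemma jump_full u j a :
  u \in C -> near disp u a -> near disp u (a + step j) ->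
  jump i I C j a = phi i I (a + step j) - phi i I a.
Proof.
move=> uC ua uj; rewrite /jump /touch.
have [aC|aC] := boolP (a \in C) => //=.
have [jC|jC] := boolP (_ \in C) => //=.
have [k kE] := step_nb j; rewrite -kE in uj jC *.
rewrite phi_step ?subrr //; exact: tri_piece_absorb uC _ _.
Qed.

(** If a corner of the parallelogram is in [C], the four jumps are full differences of [phi];
    otherwise they all vanish. *)
Lemma jump_closed j a : jump i I C j1 a + jump i I C j (a + e1) =
  jump i I C j a + jump i I C j1 (a + step j).
Proof.
have E1 : a + e1 + step j = a + step j + e1 by rewrite addrAC.
pose k1 := @Ordinal 7 1 isT; pose k4 := @Ordinal 7 4 isT.
have [k kE] := step_nb j; have [k' k'E] := nb_opp k.
have near4 (u v : Gam) (p q : 'I_7) : v = u + nb p + nb q -> near disp u v.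
  by move=> ->; exact: near_nb2.
have close u : u \in C -> u \in [:: a; a + e1; a + step j; a + step j + e1] ->
    [/\ near disp u a, near disp u (a + e1), near disp u (a + step j) &
        near disp u (a + step j + e1)].
  move=> _; rewrite !inE => /or4P[] /eqP ->; split.
  - exact: near_refl.
  - exact: (near_nb a k1).
  - by rewrite -kE; exact: near_nb.
  - by rewrite -kE; exact: (near_nb2 a k k1).
  - by apply: (near4 _ _ k4 ord0); rewrite nb0 addr0 /nb /= addrK.
  - exact: near_refl.
  - by apply: (near4 _ _ k4 k); rewrite kE {1}/nb /= addrK.
  - by rewrite -E1 -kE; exact: near_nb.
  - by apply: (near4 _ _ k' ord0); rewrite nb0 addr0 k'E kE addrK.
  - by apply: (near4 _ _ k' k1); rewrite k'E kE addrK.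
  - exact: near_refl.
  - exact: (near_nb (a + step j) k1).
  - by apply: (near4 _ _ k4 k'); rewrite k'E kE {1}/nb /= !addrK.
  - by apply: (near4 _ _ k' ord0); rewrite nb0 addr0 k'E kE addrAC addrK.
  - by apply: (near4 _ _ k4 ord0); rewrite nb0 addr0 /nb /= addrK.
  - exact: near_refl.
have [/hasP[u ul uC]|nC] := boolP (has (mem C) [:: a; a + e1; a + step j; a + step j + e1]).
  have [na ne nj nje] := close u uC ul.
  rewrite !(jump_full uC) ?step_j1 ?E1 //.
  by rewrite addrC subrKA [RHS]addrC subrKA.
move: nC; rewrite /= orbF !negb_or => /and4P[/negbTE n1 /negbTE n2 /negbTE n3 /negbTE n4].
by rewrite /jump /touch step_j1 E1 n1 n2 n3 n4 /= !mulr0n.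
Qed.

Lemma piece_tbox1 v : v \in C -> v \in tbox1.
Proof. by move=> /(subsetP tri_piece_sub); exact: (subsetP incorrect_tbox1). Qed.

Lemma jump_touch j a : jump i I C j a != 0 -> (a \in C) || (a + step j \in C).
Proof. by rewrite /jump /touch; case: (_ || _); rewrite // mulr0n eqxx. Qed.

Lemma jump_cut j a : height a = 0%N \/ height a = N.+1 -> jump i I C j a = 0.
Proof.
move=> ha; apply/eqP; apply: contraT => /jump_touch.
have hj : height (a + step j) = height a \/ height (a + step j) = ((height a + 1) %% N.+2)%N.
  case: (h1_step j) => E; rewrite raddfD /= E; last by right.
  by left; rewrite addn0 modn_small //; exact: ltn_ord.
case/orP => /piece_tbox1; rewrite inE => /andP[/andP[l1 u1] _].
  by case: ha => ha; rewrite ha in l1 u1; lia.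
case: ha => ha; case: hj => hj; rewrite hj ha ?addn1 ?modnn in l1 u1; try lia.
by rewrite modn_small // in l1; lia.
Qed.

Lemma jump_cut2 a : h2 a = 0 -> jump i I C j1 a = 0.
Proof.
move=> ha; apply/eqP; apply: contraT => /jump_touch; rewrite step_j1.
have hb : h2 (a + e1) = 0 by rewrite (raddfD h2) ha h2e1 addr0.
case/orP => /piece_tbox1; rewrite inE => /andP[_ /andP[l2 u2]].
  by rewrite ha in l2; move: l2; rewrite /=; lia.
by rewrite hb in l2; move: l2; rewrite /=; lia.
Qed.

Lemma psiE j a : psi i I C (a + step j) - psi i I C a = jump i I C j a.
Proof.
apply: (ray_sumE h1e1 h2e1 h2e2 e1N h1_step jump_closed).
- by move=> l b; exact: jump_cut.
- by move=> b; exact: jump_cut.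
- exact: jump_cut2.
- by exists j2.
Qed.

Lemma psi_hits a : psi i I C a != 0 ->
  (exists2 k, (a + e1 *+ k \in C) || (a + e1 *+ k.+1 \in C) &
     height (a + e1 *+ k) = (height a + k)%N) /\
  (exists2 k, (a + e1 *+ k \in C) || (a + e1 *+ k.+1 \in C) &
     (height (a + e1 *+ k)%R < height a)%N).
Proof.
move=> nz.
have [||[k kE kh] [k' k'E k'h]] := ray_sum_hits h1e1 h2e1 h2e2 e1N jump_closed _ _ nz.
- exact: jump_cut2.
- by exists j2.
split; [exists k => //|exists k' => //]; rewrite mulrSr addrA.
  exact: jump_touch kE.
exact: jump_touch k'E.
Qed.

Lemma piece_height2 v : v \in C -> (2 <= height v)%N.
Proof. by move/piece_tbox1; rewrite inE => /andP[/andP[l1 u1] _]; lia. Qed.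

Lemma psi_contour a : psi i I C a != 0 -> C \in contours disp e1 a.
Proof.
move=> /psi_hits[H1 H2].
exact: (hits_contours h1e1 h1_disp tri_piece_connected piece_height2 H1 H2).
Qed.

Lemma psi_tbox1 a : psi i I C a != 0 -> a \in tbox1.
Proof.
move=> /psi_hits[[k kC kh] [k' k'C k'h]].
have line m : height (a + e1 *+ m) = ((height a + m) %% N.+2)%N by exact: height_line.
have ha : (height a < N.+2)%N by exact: ltn_ord.
have hk : (height (a + e1 *+ k)%R < N.+2)%N by exact: ltn_ord.
have S m : height (a + e1 *+ m.+1) = ((height (a + e1 *+ m)%R + 1) %% N.+2)%N.
  by rewrite !line modnDml addn1 addnS.
have [l2 u2] : (lo <= (height2 a).+1)%N /\ (height2 a <= hi.+1)%N.
  by case/orP: kC => /piece_tbox1; rewrite inE !(h2_line h2e1) => /andP[_ /andP[]].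
rewrite inE l2 u2 /= andbT; apply/andP; split.
  case/orP: k'C => /piece_tbox1; rewrite inE => /andP[/andP[l1 _] _].
    exact: leq_trans l1 (leq_trans k'h (leqnSn _)).
  move: l1; rewrite S modn_small ?addn1; last exact: leq_ltn_trans k'h ha.
  by move=> l1; apply: (leq_trans l1); rewrite ltnS.
case/orP: kC => /piece_tbox1; rewrite inE => /andP[/andP[l1 u1] _].
  by move: u1; rewrite kh; apply: leq_trans; exact: leq_addr.
move: l1 u1 hk; rewrite S kh addn1 [(_ < N.+2)%N]leq_eqVlt => l1 u1 /orP[/eqP H|H].
  by move: l1; rewrite H modnn; lia.
move: u1; rewrite modn_small //; apply: leq_trans.
by rewrite -addnS leq_addr.
Qed.

Lemma psi_nb u k : u \notin C -> u + nb k \notin C ->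
  psi i I C (u + nb k) = psi i I C u.
Proof.
move: u k; apply: (nb_ind (P := fun u v => u \notin C -> v \notin C ->
  psi i I C v = psi i I C u)) => [//|u v H vC uC|u j uC jC]; first by rewrite H.
apply/eqP; rewrite -subr_eq0 psiE /jump /touch (negbTE uC) (negbTE jC) mulr0n //.
Qed.

Lemma psi_tbox v : v \notin C -> psi i I C v != 0 -> v \in tbox.
Proof.
move=> vC v0; apply: contraT => vB.
have [k kB] := tbox1_outward (psi_tbox1 v0) vB.
have kC : v + nb k \notin C by apply: contra kB; exact: piece_tbox1.
by move: v0; rewrite -(psi_nb vC kC) => /psi_tbox1; rewrite (negbTE kB).
Qed.

(** The phase that remains once the contribution of [C] is taken away. It is constant along [C],
    which allows a single phase to fill the erased contour. *)
Definition gap v := phi i I v - psi i I C v.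

Lemma gap_nb u k : (u \in C) || (u + nb k \in C) ||
    ((u \notin incorrect I) && (u + nb k \notin incorrect I)) ->
  gap (u + nb k) = gap u.
Proof.
move: u k; apply: (nb_ind (P := fun u v => (u \in C) || (v \in C) ||
    ((u \notin incorrect I) && (v \notin incorrect I)) -> gap v = gap u)) => [//|u v H c|u j c].
  by rewrite H // [(u \in C) || _]orbC andbC.
have -> : gap (u + step j) = phi i I (u + step j) - jump i I C j u - psi i I C u.
  by rewrite /gap -addrA -opprD -psiE subrK.
rewrite /gap; congr (_ - _); rewrite /jump /touch.
case: ((u \in C) || _) c => [_|/=]; first by rewrite mulrb; exact: subKr.
have [k kE] := step_nb j; rewrite -kE => /andP[u1 u2].
by rewrite (phi_step i u1 u2) subrr mulr0n subr0.
Qed.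

Lemma gap_near u v : u \in C -> near disp u v -> gap v = gap u.
Proof.
move=> uC /[dup] uv /existsP[[k k'] /eqP vE]; rewrite vE /disp /= addrA in uv *.
set z := u + nb k in uv *.
have zu : gap z = gap u by apply: gap_nb; rewrite uC.
rewrite -zu; apply: gap_nb.
have [zC|zC] := boolP (z \in C) => //=; have [vC|vC] //= := boolP (z + nb k' \in C).
by rewrite (tri_piece_absorb uC (near_nb u k) zC) (tri_piece_absorb uC uv vC).
Qed.

Lemma gap_const u v : u \in C -> v \in C -> gap u = gap v.
Proof.
move=> uC vC; have /connectP[p pp ->] : connect (near_in disp C) u v.
  by move/forall_inP: tri_piece_connected => /(_ u uC) /forall_inP /(_ v vC).
elim: p u uC pp => //= w p IH u uC /andP[/and3P[_ wC uw] pp].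
by rewrite -(IH w wC pp) (gap_near uC uw).
Qed.

Variable c0 : Gam.
Hypothesis c0C : c0 \in C.

(* Absolute class of the phase that fills the erased contour. *)
Definition fill := i + gap c0.

Lemma near_correct u v : u \in C -> near disp u v -> v \notin C ->
  correct I (fill + psi i I C v) v.
Proof.
move=> uC uv vC; have := correct_phi i (tri_piece_absorb uC uv vC).
by rewrite /fill (gap_const c0C uC) -(gap_near uC uv) /gap -addrA subrK.
Qed.

Lemma near_mem u v : u \in C -> near disp u v -> v \notin C ->
  (v \in I) = (cl v == fill + psi i I C v).
Proof. by move=> uC uv vC; have /correctP/(_ ord0) := near_correct uC uv vC; rewrite nb0 addr0. Qed.

(** Indexed such that translating by [shift x] lowers the class by [x]. *)
Definition shift (x : 'Z_3) : Gam := nth 0 [:: 0; - e1; e1] x.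

Lemma shift_nb x : exists k, nb k = shift x.
Proof.
case: x => -[|[|[|//]]] lt.
- by exists (@Ordinal 7 0 isT).
- by exists (@Ordinal 7 4 isT).
- by exists (@Ordinal 7 1 isT).
Qed.

Lemma cl_shift v x : cl (v + shift x) = cl v - x.
Proof.
rewrite (raddfD cl); congr (_ + _); case: x => -[|[|[|//]]] lt;
  rewrite /shift [nth _ _ _]/= ?(raddfN cl) ?raddf0 ?cle1; exact: val_inj.
Qed.

Definition move v := v + shift (psi i I C v).

Definition thick := [set v | [exists k, v + nb k \in C]].

Lemma thickP v k : v \notin thick -> v + nb k \notin C.
Proof. by rewrite inE negb_exists => /forallP/(_ k). Qed.

Lemma thick_notin v : v \notin thick -> v \notin C.
Proof. by move/thickP => /(_ ord0); rewrite nb0 addr0. Qed.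

Lemma thick_near v : v \in thick -> exists2 u, u \in C & near disp u v.
Proof.
rewrite inE => /existsP[k kC]; exists (v + nb k) => //.
by have [k' k'E] := nb_opp k; have := near_nb (v + nb k) k'; rewrite k'E addrK.
Qed.

Lemma move_notin v : v \notin thick -> move v \notin C /\ psi i I C (move v) = psi i I C v.
Proof.
move=> vT; have [k kE] := shift_nb (psi i I C v).
rewrite /move -kE thickP //; split=> //; apply: psi_nb; [exact: thick_notin|exact: thickP].
Qed.

(** A move is at most one lattice step. From outside [thick] it does not enter [C], hence stays in a
    level set of the potential, on which moving is a translation. *)
Lemma move_inj u v : u \notin thick -> v \notin C -> move u = move v -> u = v.
Proof.
move=> uT vC muv; have [mC mE] := move_notin uT.
have [k kE] := shift_nb (psi i I C v).
have : psi i I C (move v) = psi i I C v.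
  by rewrite {1}/move -kE; apply: psi_nb => //; rewrite kE -/(move v) -muv.
rewrite -muv mE => E; move: muv; rewrite /move E; exact: addIr.
Qed.

Definition moved w := [exists v, (v \notin thick) && (move v == w)].

(* Away from [C] the configuration is moved by the potential of [C], after which
   all phases touching [C] are the phase [fill]; the latter is put on the sites
   that are not reached. *)
Definition erased : {set Gam} := [set w | [exists v, [&& v \notin thick, move v == w & v \in I]]
  || (~~ moved w && (cl w == fill))].

Lemma erased_move v : v \notin thick -> (move v \in erased) = (v \in I).
Proof.
move=> vT; rewrite inE; have -> : moved (move v) by apply/existsP; exists v; rewrite vT eqxx.
rewrite orbF; apply/existsP/idP => [[u /and3P[uT /eqP E uI]]|vI].
  by rewrite -(move_inj uT (thick_notin vT) E).
by exists v; rewrite vT eqxx vI.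
Qed.

Lemma erased_hole w : ~~ moved w -> (w \in erased) = (cl w == fill).
Proof.
move=> wm; rewrite inE wm /=; case: existsP => // -[v /and3P[vT vw _]].
by case/negP: wm; apply/existsP; exists v; rewrite vT.
Qed.

Lemma erased_move_nb v k : v \notin thick -> (move v + nb k \in erased) = (v + nb k \in I).
Proof.
move=> vT; have vC := thick_notin vT; have kC := thickP k vT.
have E : move (v + nb k) = move v + nb k by rewrite /move psi_nb // addrAC.
have [kT|kT] := boolP (v + nb k \in thick); last by rewrite -E erased_move.
have [u uC un] := thick_near kT.
rewrite (near_mem uC un kC) -E erased_hole; last first.
  apply/negP => /existsP[w /andP[wT /eqP wE]].
  by move: (wT); rewrite (move_inj wT kC wE) kT.
by rewrite /move cl_shift subr_eq.
Qed.

(** A reached neighbour of a hole was moved from a vertex near [C], where moving turns the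
    configuration into the phase [fill]. *)
Lemma erased_correct w : ~~ moved w -> correct erased fill w.
Proof.
move=> wm; apply/correctP => k.
have [/existsP[v /andP[vT /eqP vE]]|nm] := boolP (moved (w + nb k)); last exact: erased_hole.
have [k' k'E] := nb_opp k; have vC := thick_notin vT.
have wE : move (v + nb k') = w.
  by rewrite /move psi_nb ?thickP // addrAC -/(move v) vE k'E addrK.
have : v + nb k' \in thick.
  by apply: contraR wm => nT; apply/existsP; exists (v + nb k'); rewrite nT wE eqxx.
rewrite inE => /existsP[k2 cC].
have [q qE] := nb_opp k2; have [q' q'E] := nb_opp k'.
have := near_nb2 (v + nb k' + nb k2) q q'; rewrite qE q'E !addrK => un.
by rewrite -vE erased_move // (near_mem cC un vC) /move cl_shift subr_eq.
Qed.

Lemma erased_indep : indep tri_rel erased.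
Proof.
apply/indepP => u w uE wE; apply/negP => /existsP[k /andP[k0 /eqP wk]].
have cl0 x : cl (x + nb k) != cl x.
  by rewrite (raddfD cl) -subr_eq0 addrAC subrr add0r cl_nb_neq0.
have [/existsP[v /andP[vT /eqP vE]]|nm] := boolP (moved u).
  move: uE wE; rewrite wk -vE erased_move // erased_move_nb // => vI vkI.
  have /indepP/(_ _ _ vI vkI)/negP := conf_indep; apply.
  by apply/existsP; exists k; rewrite k0 /=.
have /correctP H := erased_correct nm.
have := H k; rewrite -wk wE wk => /esym/eqP E2.
have := H ord0; rewrite nb0 addr0 uE => /esym/eqP E1.
by have := cl0 u; rewrite E1 E2 eqxx.
Qed.

Lemma erased_ground w : w \notin tbox -> (w \in erased) = (cl w == i).
Proof.
move=> wB; have [/existsP[v /andP[vT /eqP vE]]|nm] := boolP (moved w).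
  rewrite -vE erased_move //.
  have [mC mE] := move_notin vT.
  have psi0 : psi i I C v = 0.
    apply/eqP; apply: contraT => v0; case/negP: wB; rewrite -vE.
    by apply: psi_tbox => //; rewrite mE.
  have E : move v = v by rewrite /move psi0 /shift addr0.
  by rewrite E conf_ground // -E vE.
rewrite erased_hole //.
(* A vertex of [C] outside [tbox] has a neighbour outside [tbox1], where the phase is [i] and the
   potential 0; this gives [fill = i]. *)
have [wC|wC] := boolP (w \in C).
  have [k kB] := tbox1_outward (piece_tbox1 wC) wB.
  have psi0 : psi i I C (w + nb k) = 0.
    by apply/eqP; apply: contraR kB => /psi_tbox1.
  rewrite /fill (gap_const c0C wC) -(gap_near wC (near_nb w k)) /gap psi0 subr0.
  by rewrite (phi_correct i (frozen_correct kB)) subrr addr0.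
have psi0 : psi i I C w = 0 by apply/eqP; apply: contraR wB; exact: psi_tbox.
have wT : w \in thick.
  apply: contraR nm => nT; apply/existsP; exists w.
  by rewrite nT /move psi0 /shift addr0 eqxx.
have [u uC un] := thick_near wT.
by rewrite -(conf_ground wB) (near_mem uC un wC) psi0 addr0.
Qed.

Lemma erased_conf : erased \in hc_conf tri_rel tbox (ground i).
Proof.
rewrite inE erased_indep; apply/eqP/setP => w; rewrite !in_setD.
by case wB: (w \in tbox) => //=; rewrite erased_ground ?wB // inE.
Qed.

(** Dropping [thick] loses at most [3 * #|thick| - #|C|], moved vertices keep their local count, and
    the holes, as many as [thick] has vertices, count 3 each. *)
Lemma erased_count : (9 * #|I| + #|C| <= 9 * #|erased|)%N.
Proof.
rewrite -!sum_local_count (bigID (mem thick)) /= [in X in (_ <= X)%N](bigID moved) /=.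
have cT : C \subset thick.
  by apply/subsetP => c cC; rewrite inE; apply/existsP; exists ord0; rewrite nb0 addr0.
have H1 : (\sum_(v in thick) local_count I v + #|C| <= 3 * #|thick|)%N.
  rewrite -!sum1_card big_distrr /= (big_setID C) /= [X in (_ <= X)%N](big_setID C) /=.
  rewrite (setIidPr cT) addnAC -big_split /=; apply: leq_add; apply: leq_sum => v.
    move=> vC; have [_ H] := local_count_indep v conf_indep.
    by have := H (subsetP tri_piece_sub v vC); lia.
  by move=> _; have [H _] := local_count_indep v conf_indep.
have H2 : (\sum_(v | v \notin thick) local_count I v = \sum_(w | moved w) local_count erased w)%N.
  rewrite [RHS](reindex_onto move (fun w => odflt w [pick v | (v \notin thick) && (move v == w)])) /=.
    apply: eq_big => [v|v vT].
      apply/idP/andP => [vT|[]].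
        split; first by apply/existsP; exists v; rewrite vT eqxx.
        case: pickP => [u /andP[uT /eqP uE]|/(_ v)] /=; last by rewrite vT eqxx.
        by rewrite (move_inj uT (thick_notin vT) uE).
      move=> /existsP[u /andP[uT uE]]; case: pickP => [x /andP[xT _] /eqP <- //|/(_ u)].
      by rewrite uT uE.
    by rewrite /local_count; apply: eq_bigr => k _; rewrite erased_move_nb.
  move=> w /existsP[u /andP[uT uE]]; case: pickP => [x /andP[_ /eqP]//|/(_ u)].
  by rewrite uT uE.
have H3 : (\sum_(w | ~~ moved w) local_count erased w = 3 * #|[set w | ~~ moved w]|)%N.
  rewrite -sum1_card big_distrr /=; apply: eq_big => [w|w nm]; first by rewrite inE.
  by rewrite (local_count_correct (erased_correct nm)).
have H4 : #|[set w | ~~ moved w]| = #|thick|.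
  apply/eqP; rewrite -(eqn_add2l #|[set w | moved w]|).
  have -> : [set w | moved w] = move @: ~: thick.
    apply/setP => w; rewrite inE; apply/existsP/imsetP => [[v /andP[vT /eqP <-]]|[v vT ->]].
      by exists v => //; rewrite inE.
    by exists v; rewrite eqxx andbT; rewrite inE in vT.
  have -> : [set w | ~~ moved w] = ~: (move @: ~: thick).
    apply/setP => w; rewrite !inE; congr (~~ _).
    apply/existsP/imsetP => [[v /andP[vT /eqP <-]]|[v vT ->]].
      by exists v => //; rewrite inE.
    by exists v; rewrite eqxx andbT; rewrite inE in vT.
  rewrite cardsC card_in_imset; last first.
    by move=> u v; rewrite ![_ \in ~: _]inE => uT vT; apply: move_inj => //; exact: thick_notin.
  by rewrite -(cardsC thick) addnC.
by rewrite H2 H3 H4 addnAC [leqRHS]addnC leq_add2r.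
Qed.

End OnePiece.

Lemma phi_frozen v : v \notin tbox1 -> phi i I v = 0.
Proof. by move=> /frozen_correct ci; rewrite (phi_correct i ci) subrr. Qed.

Lemma sum_jump j a : \sum_(C in tri_pieces I) jump i I C j a =
  phi i I (a + step j) - phi i I a.
Proof.
rewrite /jump; set x := phi i I (a + step j) - _.
have [k kE] := step_nb j.
have aj : near disp a (a + step j) by rewrite -kE; exact: near_nb.
have [aU|aU] := boolP (a \in incorrect I).
  rewrite -[RHS](sum_components disp_opp x aU); apply: eq_bigr => C CP; congr (_ *+ nat_of_bool _).
  rewrite /touch; have [//|aC] := boolP (a \in C).
  apply/negbTE; apply: contraL aU => jC; apply: (tri_piece_absorb CP jC _ aC).
  by rewrite (near_sym disp_opp).
have aC C : C \in tri_pieces I -> a \in C = false.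
  by move=> /tri_piece_sub/subsetP CU; apply: contraNF aU; exact: CU.
have [jU|jU] := boolP (a + step j \in incorrect I).
  rewrite -[RHS](sum_components disp_opp x jU); apply: eq_bigr => C CP; congr (_ *+ nat_of_bool _).
  by rewrite /touch aC.
rewrite -kE in jU; rewrite /x -kE phi_step ?subrr // big1 // => C _.
by rewrite mul0rn.
Qed.

Lemma sum_psi a : \sum_(C in tri_pieces I) psi i I C a = phi i I a.
Proof.
rewrite /psi /ray_sum sumrN exchange_big /=.
have E m : \sum_(k < m) \sum_(C in tri_pieces I) jump i I C j1 (a + e1 *+ k) =
    phi i I (a + e1 *+ m) - phi i I a.
  elim: m => [|m IH]; first by rewrite big_ord0 mulr0n addr0 subrr.
  by rewrite big_ord_recr IH sum_jump step_j1 mulrSr [a + (_ + _)]addrA [LHS]addrC subrKA.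
rewrite E opprB [X in _ - X]phi_frozen ?subr0 //; rewrite inE (height_last h1e1).
by rewrite negb_and negb_and -ltnNge; apply/orP; left; apply/orP; left; exact: leq_ltn_trans lo3.
Qed.

Lemma tri_contour_exists x : ~~ correct I i x ->
  exists2 C, C \in tri_pieces I & C \in contours disp e1 x.
Proof.
move=> nc; have [xU|xU] := boolP (x \in incorrect I).
  exists (component disp (incorrect I) x); first exact: imset_f.
  rewrite inE component_connected; last exact: disp_opp.
  by apply/existsP; exists ord0; rewrite mulr0n addr0 component_self.
have phi0 : phi i I x != 0.
  by apply: contra nc => /eqP E; have := correct_phi i xU; rewrite E addr0.
have [C CP Cx] : exists2 C, C \in tri_pieces I & psi i I C x != 0.
  apply/exists_inP; apply: contraNT phi0; rewrite negb_exists => /forallP H.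
  rewrite -sum_psi big1 // => C CP; apply/eqP.
  by have := H C; rewrite CP /= negbK.
by exists C => //; exact: (psi_contour CP Cx).
Qed.

End Configuration.

Definition halo (C : {set Gam}) := [set v | [exists u in C, near disp u v]].

Lemma card_halo C : (#|halo C| <= 49 * #|C|)%N.
Proof.
have -> : halo C = [set c.1 + disp c.2 | c in setX C [set: 'I_7 * 'I_7]].
  apply/setP => v; rewrite inE; apply/existsP/imsetP.
    move=> [u /andP[uC /existsP[k /eqP ->]]]; exists (u, k) => //.
    by rewrite in_setX uC inE.
  move=> [[u k]]; rewrite in_setX => /andP[uC _] ->; exists u; rewrite uC.
  by apply/existsP; exists k.
apply: (leq_trans (leq_imset_card _ _)).
by rewrite cardsX cardsT card_prod card_ord mulnC.
Qed.

Lemma mem_halo C u v : u \in C -> near disp u v -> v \in halo C.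
Proof. by move=> uC uv; rewrite inE; apply/existsP; exists u; rewrite uC. Qed.

Definition anchor (C : {set Gam}) := odflt 0 [pick c in C].

Lemma tri_piece_anchor I C : C \in tri_pieces I -> anchor C \in C.
Proof.
move=> /imsetP[a aU ->]; rewrite /anchor; case: pickP => // /(_ a).
by rewrite component_self.
Qed.

Section Halo.
Variables (i : 'Z_3) (C I I' : {set Gam}).
Hypothesis II' : I :&: halo C = I' :&: halo C.

Lemma halo_mem v : v \in halo C -> (v \in I) = (v \in I').
Proof. by move=> vC; move/setP: II' => /(_ v); rewrite !in_setI vC !andbT. Qed.

Lemma halo_phi u k : u \in C -> phi i I (u + nb k) = phi i I' (u + nb k).
Proof.
move=> uC; rewrite /phi /phase; congr (if _ is Some _ then _ else _).
apply: eq_pick => j; apply: eq_forallb => k'.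
by rewrite halo_mem //; apply: mem_halo uC _; exact: near_nb2.
Qed.

Lemma halo_jump j a : jump i I C j a = jump i I' C j a.
Proof.
have [k kE] := step_nb j; have [k' k'E] := nb_opp k.
rewrite /jump /touch; have [aC|aC] := boolP (a \in C).
  by rewrite -kE halo_phi // -[a]addr0 -nb0 halo_phi // nb0 addr0.
have [jC|//] := boolP (a + step j \in C).
have aE : a = a + step j + nb k' by rewrite k'E kE addrK.
by rewrite -[a + step j]addr0 -nb0 halo_phi // nb0 addr0 {2 4}aE halo_phi.
Qed.

Lemma halo_psi a : psi i I C a = psi i I' C a.
Proof. by rewrite /psi /ray_sum; congr (- _); apply: eq_bigr => k _; exact: halo_jump. Qed.

End Halo.

(** The potential of [C] depends only on [I] in the halo, so the translation can be undone outside
    [thick], while [thick] is part of the halo. Erasing is thus at most [2 ^ (49 * #|C|)] to one. *)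
Lemma erased_determines i C I I' :
  I \in hc_conf tri_rel tbox (ground i) -> C \in tri_pieces I ->
  I' \in hc_conf tri_rel tbox (ground i) -> C \in tri_pieces I' ->
  I :&: halo C = I' :&: halo C ->
  erased i I C (anchor C) = erased i I' C (anchor C) -> I = I'.
Proof.
move=> cI CI cI' CI' II' EE; apply/setP => v.
have [vT|vT] := boolP (v \in thick C).
  have [u uC uv] := thick_near vT; apply: (halo_mem II'); exact: mem_halo uC uv.
rewrite -(erased_move cI CI (anchor C) vT) EE -(erased_move cI' CI' (anchor C) vT).
by rewrite /move (halo_psi i II').
Qed.

Section Weights.
Variables (R : realFieldType) (la y : R) (i : 'Z_3).
Hypotheses (la0 : 0 < la) (y0 : 0 <= y) (y1 : y <= 1) (lay : la^-1 <= y ^+ 9).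

Local Notation conf := (hc_conf tri_rel tbox (ground i)).
Local Notation Z := (\sum_(I in conf) la ^+ #|I|).

(** Erasing gains at least [#|C| / 9] occupied sites, each worth a factor [la^-1 <= y ^+ 9]; so [y]
    is the price per vertex of [C]. *)
Lemma erased_weight I C : I \in conf -> C \in tri_pieces I ->
  la ^+ #|I| <= y ^+ #|C| * la ^+ #|erased i I C (anchor C)|.
Proof.
move=> cI CI; set E := erased _ _ _ _.
have := erased_count cI CI (tri_piece_anchor CI); rewrite -/E => H.
have [m Em] : exists m, #|E| = (#|I| + m)%N by exists (#|E| - #|I|)%N; lia.
have Cm : (#|C| <= 9 * m)%N by lia.
rewrite Em exprD mulrCA -[leLHS]mulr1 ler_wpM2l ?exprn_ge0 ?(ltW la0) //.
have lam : 0 < la ^+ m by rewrite exprn_gt0.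
rewrite -ler_pdivrMr // mul1r -exprVn.
apply: (@le_trans _ _ (y ^+ (9 * m))); last by rewrite ler_wiXn2l ?y0.
by rewrite exprM lerXn2r // nnegrE ?exprn_ge0 // invr_ge0 ltW.
Qed.

Lemma tri_piece_weight C :
  \sum_(I in conf | C \in tri_pieces I) la ^+ #|I| <= (2%:R ^+ 49 * y) ^+ #|C| * Z.
Proof.
apply: (@le_trans _ _ (\sum_(EW : {set Gam} * {set Gam} | (EW.1 \in conf) && (EW.2 \subset halo C))
    y ^+ #|C| * la ^+ #|EW.1|)).
  apply: (@sum_inj_le _ _ _ (fun I => (erased i I C (anchor C), I :&: halo C))).
  - move=> I I' /andP[cI CI] /andP[cI' CI'] [EE II']; exact: erased_determines cI CI cI' CI' II' EE.
  - move=> I /andP[cI CI] /=; split; last exact: erased_weight.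
    rewrite subsetIr andbT; exact: (erased_conf cI CI (tri_piece_anchor CI)).
  - by move=> EW _; rewrite mulr_ge0 ?exprn_ge0 // ltW.
rewrite -(pair_big (mem conf) (fun W : {set Gam} => W \subset halo C)
  (fun E _ => y ^+ #|C| * la ^+ #|E|)) /=.
rewrite mulr_sumr; apply: ler_sum => E _.
rewrite (eq_bigl (mem (powerset (halo C)))); last by move=> W; rewrite /= powersetE.
rewrite sumr_const card_powerset -[leLHS]mulr_natl natrX mulrA ler_wpM2r ?exprn_ge0 ?(ltW la0) //.
rewrite exprMn ler_wpM2r ?exprn_ge0 // -exprM ler_weXn2l ?card_halo //.
by rewrite ler1n.
Qed.

Lemma tri_phase_stable x : 6%:R * 49%:R ^+ 2 * (2%:R ^+ 49 * y) <= 1 ->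
  \sum_(I in conf | ~~ correct I i x) la ^+ #|I| <=
    6%:R * 49%:R ^+ 2 * (2%:R ^+ 49 * y) * Z.
Proof.
have cardK : #|{: 'I_7 * 'I_7}| = 49%N by rewrite card_prod card_ord.
rewrite -cardK; set w := 2%:R ^+ _ * y => small.
have w0 : 0 <= w by rewrite mulr_ge0 ?exprn_ge0.
have Z0 : 0 <= Z by apply: sumr_ge0 => I _; rewrite exprn_ge0 // ltW.
apply: (@le_trans _ _ (\sum_(C in contours disp e1 x)
    \sum_(I in conf | C \in tri_pieces I) la ^+ #|I|)).
  under [leRHS]eq_bigr do rewrite big_mkcondr.
  rewrite exchange_big /= big_mkcondr /=; apply: ler_sum => I cI.
  have term0 C : 0 <= (if C \in tri_pieces I then la ^+ #|I| else 0).
    by case: ifP => // _; rewrite exprn_ge0 // ltW.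
  case: ifP => [nc|_]; last exact: sumr_ge0.
  have [C CI Cx] := tri_contour_exists cI nc.
  by rewrite (bigD1 C) //= CI lerDl; apply: sumr_ge0.
apply: (@le_trans _ _ (\sum_(C in contours disp e1 x) w ^+ #|C| * Z)).
  by apply: ler_sum => C _; have := tri_piece_weight C; rewrite /w cardK.
rewrite -mulr_suml ler_wpM2r //.
exact: (sum_contours disp_0 disp_opp).
Qed.

End Weights.
End Triangular.

(** * Windows of the lattice inside a torus *)

Section Window.
Variable M : nat.
Local Notation N := M.*2.
Implicit Types x : 'Z_N.+2.

Definition centered x : int := (nat_of_ord x)%:Z - M.+1%:Z.

Lemma centered_inj : injective centered.
Proof. by move=> x y /addIr[] /val_inj. Qed.

Lemma Zp_val_add1 x : (x < N.+1)%N -> nat_of_ord (x + 1) = x.+1.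
Proof. by move=> xN; rewrite /= addn1 modn_small. Qed.

Lemma Zp_val_sub1 x : (0 < x)%N -> nat_of_ord (x - 1) = x.-1.
Proof.
move=> x0; have xN : (x < N.+2)%N := ltn_ord x.
rewrite -[X in nat_of_ord (X - _)](natr_Zp x) -{1}(prednK x0) mulrSr addrK.
by rewrite val_Zp_nat // modn_small // (leq_ltn_trans (leq_pred _)).
Qed.

Lemma Zp_val_shift x (z : int) : (0 < x < N.+1)%N -> `|z| <= 1 ->
  (nat_of_ord (x + z%:~R))%:Z = (nat_of_ord x)%:Z + z.
Proof.
move=> /andP[x0 xN] z1.
have : z = 0 \/ z = 1 \/ z = -1 by lia.
case=> [->|[->|->]]; first by rewrite mulr0z !addr0.
  by rewrite Zp_val_add1 // -addn1 PoszD.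
by rewrite mulrNz Zp_val_sub1 //; lia.
Qed.

Lemma centered_shift x (z : int) : (0 < x < N.+1)%N -> `|z| <= 1 ->
  centered (x + z%:~R) = centered x + z.
Proof. by move=> xN z1; rewrite /centered Zp_val_shift // addrAC. Qed.

(** The window from 3 to [N - 1], shrunk by [k] on both sides. It is symmetric under negation in
    ['Z_N.+2] and keeps contours away from the cut at heights 0 and [N.+1]. *)
Definition margin k x := (3 + k <= x <= N - 1 - k)%N.

Lemma margin_shift k x (z : int) : `|z| <= 1 -> margin k.+1 x -> margin k (x + z%:~R).
Proof.
rewrite /margin => z1 H.
have xN : (0 < x < N.+1)%N by move: H; move: (nat_of_ord x) => w; lia.
have := Zp_val_shift xN z1; move: (nat_of_ord (x + _)) (nat_of_ord x) H {xN} => u w; lia.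
Qed.

Lemma marginN x : margin 0 (- x) = margin 0 x.
Proof.
suff H y : margin 0 y -> margin 0 (- y) by apply/idP/idP => /H; rewrite ?opprK.
rewrite /margin => yM.
have -> : nat_of_ord (- y) = (N.+2 - y)%N.
  by rewrite /= modn_small // ltn_subrL; move: yM; case: (nat_of_ord y).
by move: yM; move: (nat_of_ord y) => w; lia.
Qed.

Lemma margin_center k : (k + 3 <= M.+1)%N -> margin k (M.+1%:R).
Proof.
move=> kM; rewrite /margin val_Zp_nat // modn_small; lia.
Qed.

Lemma centered_center : centered (M.+1%:R) = 0.
Proof. by rewrite /centered val_Zp_nat // modn_small ?subrr //; lia. Qed.

End Window.

Definition coord (A : zmodType) m (i : 'I_m) (a : 'rV[A]_m) := a ord0 i.

Fact coord_is_additive (A : zmodType) m i : {morph @coord A m i : x y / x - y}.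
Proof. by move=> x y; rewrite /coord !mxE. Qed.

HB.instance Definition _ (A : zmodType) m i :=
  GRing.isZmodMorphism.Build _ _ (@coord A m i) (@coord_is_additive A m i).

(** * The bipartite model on a torus *)

Section BipartiteTorus.
Variables (M m : nat) (J : finType) (s : J -> 'rV[int]_m.+2).
Local Notation N := M.*2.
Local Notation Gam := 'rV['Z_N.+2]_m.+2.
Variables (j0 j1 j2 : J).
Hypotheses (sj0 : s j0 = 0) (sj1 : s j1 = delta_mx 0 0) (sj2 : s j2 = delta_mx 0 1).
Hypothesis s_le1 : forall j i, `|s j 0 i| <= 1.
Hypothesis s_ge0 : forall j, 0 <= s j 0 0.

Definition tstep j : Gam := map_mx intr (s j).

Definition tcoord i (a : Gam) := coord i a.

Definition cross (a : Gam) := [forall i, (i != 0) ==> margin 0 (a 0 i)].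

Definition bbox : {set Gam * bool} := Box (tcoord 0) cross 3 (N - 1).

Lemma mem_bbox v : (v \in bbox) = [forall i, margin 0 (v.1 0 i)].
Proof.
rewrite !inE /cross /margin addn0 subn0; apply/andP/forallP => [[/forallP H v0] i|H].
  by have := H i; have [->|//] := eqVneq i 0.
by split; [apply/forallP => i; apply/implyP|exact: H].
Qed.

Lemma mirror_bbox : mirror_set bbox = bbox.
Proof.
apply/setP => v; rewrite mem_mirror_set !mem_bbox; apply: eq_forallb => i.
by rewrite mxE marginN.
Qed.

Definition lift_pos (a : Gam) : 'rV[int]_m.+2 := map_mx (@centered M) a.

Lemma lift_pos_inj : injective lift_pos.
Proof.
move=> a b /rowP H; apply/rowP => i; have := H i.
by rewrite !mxE => /centered_inj.
Qed.

Lemma lift_shift (a : Gam) (z : 'rV[int]_m.+2) : (forall i, margin 0 (a 0 i)) -> (forall i, `|z 0 i| <= 1) ->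
  lift_pos (a + map_mx intr z) = lift_pos a + z.
Proof.
move=> aB z1; apply/rowP => i; rewrite !mxE centered_shift //.
by have := aB i; rewrite /margin; move: (nat_of_ord (a 0 i)) => u; lia.
Qed.

Lemma deep_bbox k (v : Gam * bool) : (forall i, margin k (v.1 0 i)) -> deep (bip_rel tstep) bbox k v.
Proof.
elim: k v => // k IH [a b] H /=; apply/andP; split.
  rewrite mem_bbox; apply/forallP => i; have := H i.
  rewrite /margin /=; move: (nat_of_ord _) => u; lia.
apply/forallP => -[c e]; apply/implyP => /andP[/= _ /existsP[j jE]]; apply: IH => i /=.
case: b H jE => /= H /eqP E; last by rewrite E !mxE; exact: margin_shift.
have -> : c = a + map_mx intr (- s j).
  by rewrite map_mxN E addrK.
by rewrite mxE [map_mx _ _ _ _]mxE; apply: margin_shift => //; rewrite mxE normrN.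
Qed.

Definition torus_center : Gam := const_mx M.+1%:R.

Lemma lift_torus_center : lift_pos torus_center = 0.
Proof. by apply/rowP => i; rewrite !mxE centered_center. Qed.

Lemma deep_torus_center k b : (k + 3 <= M.+1)%N -> deep (bip_rel tstep) bbox k (torus_center, b).
Proof. by move=> kM; apply: deep_bbox => i; rewrite mxE margin_center. Qed.

Lemma torus_stable (R : realFieldType) (t y : R) v : 0 < t <= 1 -> 0 <= y <= 1 ->
  t * mirror_const R J <= y ^+ #|J| ->
  6%:R * #|{: J * J * J * J}|%:R ^+ 2 * (2%:R ^+ #|J| * y) <= 1 ->
  \sum_(X : {set Gam * bool} | (X \subset bbox) && (v \in X)) weight t tstep X <=
    6%:R * #|{: J * J * J * J}|%:R ^+ 2 * (2%:R ^+ #|J| * y) * odd_sum t tstep bbox.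
Proof.
move=> t01; pose e1 : Gam := delta_mx 0 0; pose e2 : Gam := delta_mx 0 1.
apply: (@odd_phase_stable R t Gam J tstep t01 N (coord 0) (coord 1) e1 e2 _ _ _ _ j0 j1 j2).
- by change (e1 0 0 = 1); rewrite !mxE.
- by change (e1 0 1 = 0); rewrite !mxE.
- by change (e2 0 1 = 1); rewrite !mxE.
- apply/rowP => i; rewrite /e1 mulmxnE !mxE.
  by case: (_ && _) => /=; rewrite ?mul0rn // pchar_Zp.
- by rewrite /tstep sj0 map_mx0.
- by rewrite /tstep sj1 map_delta_mx.
- by rewrite /tstep sj2 map_delta_mx.
- move=> j; change (tstep j 0 0 = 0 \/ tstep j 0 0 = 1); rewrite mxE.
  have : s j 0 0 = 0 \/ s j 0 0 = 1 by have := s_ge0 j; have := s_le1 j 0; lia.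
  by case=> ->; [left|right].
- move=> a; apply: eq_forallb => i; rewrite !mxE.
  by case: (eqVneq i 0) => //= _; rewrite ?andbF addr0.
- move=> a /forallP/(_ 1) /= /andP[]; rewrite /coord => H _ E.
  by move: H; rewrite E.
- by [].
- by rewrite leq_subr.
Qed.

End BipartiteTorus.

From mathcomp Require Import finmap.
From mathcomp Require Import all_classical all_reals all_analysis.

(** * The game *)

Section Decided.
Local Open Scope classical_set_scope.
Variables (V : Type) (Out : V -> set V) (trap : set V).

(* [decided true n x]: the first player, or [decided false n x]: the second
   player, can force a win from [x] within fewer than [n] moves. *)
Fixpoint decided (b : bool) (n : nat) (x : V) : Prop :=
  if n is m.+1 then
    if b then trap x \/ exists2 y, Out x y & decided false m y
    else ~ trap x /\ forall y, Out x y -> decided true m y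
  else False.

Definition undecided n x := ~ decided true n x /\ ~ decided false n x.

Lemma decidedS b n x : decided b n x -> decided b n.+1 x.
Proof.
elim: n b x => [|n IH] [] x //=.
  by case=> [tx|[y xy yn]]; [left|right; exists y => //; exact: (IH false)].
by case=> tx H; split=> // y /H; exact: (IH true).
Qed.

Lemma decided_leq b m n x : (m <= n)%N -> decided b m x -> decided b n x.
Proof.
move=> /subnK <-; elim: (n - m)%N => // k IH /IH; rewrite addSn.
exact: decidedS.
Qed.

Lemma undecided_leq m n x : (m <= n)%N -> undecided n x -> undecided m x.
Proof.
by move=> mn [nt nf]; split=> d; [apply: nt|apply: nf]; exact: decided_leq d.
Qed.

Lemma decided_false_open n x : decided false n x -> ~ trap x.
Proof. by case: n => // n []. Qed.

Hypothesis Out_fin : forall x, finite_set (Out x).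

(** Compactness: otherwise every point of [S] fails at some [n], and the largest of these finitely
    many [n] has no witness. *)
Lemma finite_unbounded (S : set V) (Q : nat -> V -> Prop) : finite_set S ->
  (forall m n y, (m <= n)%N -> Q n y -> Q m y) ->
  (forall n, exists2 y, S y & Q n y) ->
  exists2 y, S y & forall n, Q n y.
Proof.
move=> finS Qmono Qex; apply: contrapT => noy.
have bound y : S y -> exists n, ~ Q n y.
  by move=> Sy; apply: contrapT => /forallNP H; apply: noy; exists y => // n;
    exact: contrapT (H n).
have /choice[f fP] : forall y, exists n, S y -> ~ Q n y.
  move=> y; have [/bound[n ?]|nSy] := pselect (S y); first by exists n.
  by exists 0%N.
have [s sE] : exists s : seq nat, f @` S = [set` s].
  by apply/finite_seqP; exact: finite_image.
have [y Sy] := Qex (\max_(i <- s) i)%N.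
move/Qmono => H; apply: (fP y Sy); apply: H.
have : f y \in s.
  have : (f @` S) (f y) by exists y.
  by rewrite sE.
by move=> fys; exact: (@leq_bigmax_seq _ s xpredT id).
Qed.

Lemma first_escape x : ~ trap x -> (forall n, ~ decided false n x) ->
  exists2 y, Out x y & forall n, ~ decided true n y.
Proof.
move=> tx H; apply: finite_unbounded => //.
  by move=> m n y mn nd d; apply: nd; exact: decided_leq d.
move=> n; apply: contrapT => noy; apply: (H n.+1) => /=; split=> // y xy.
by apply: contrapT => nd; apply: noy; exists y.
Qed.

Lemma legal_exists x : ~ stuck Out trap x -> exists y, legal Out trap x y.
Proof. by move/eqP/set0P. Qed.

(** Strategies are positional, so one choice of moves, preferring [Q], has to serve at all vertices
    at once. *)
Lemma exists_strategy (Q : V -> V -> Prop) :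
  exists s, strategy Out trap s /\
    forall x, (exists2 y, legal Out trap x y & Q x y) -> Q x (s x).
Proof.
suff /choice[s sP] : forall x, exists y,
    (~ stuck Out trap x -> legal Out trap x y) /\
    ((exists2 y, legal Out trap x y & Q x y) -> Q x y).
  by exists s; split=> x; have [] := sP x.
move=> x; have [[y xy Qy]|noy] := pselect (exists2 y, legal Out trap x y & Q x y).
  by exists y; split=> // _.
have [[y xy]|nol] := pselect (exists y, legal Out trap x y).
  by exists y; split=> // /noy.
exists x; split; last by move/noy.
by move/legal_exists/nol.
Qed.

Lemma no_first_winning x : (forall n, ~ decided true n x) ->
  ~ exists s, first_winning_strategy Out trap x s.
Proof.
move=> ndx [s [ss sw]].
have [t [tt tP]] := exists_strategy (fun _ y => forall n, ~ decided true n y).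
(* [decided (~~ odd n)] at time [n] is a win of the original first player, whoever is to move; the
   strategy [t] never lets it occur. *)
have inv n : (forall m, (m < n)%N -> ~ stuck Out trap (position s t x m)) ->
    ~ trap (position s t x n) /\
    forall k, ~ decided (~~ odd n) k (position s t x n).
  elim: n => [_|n IH ns].
    by split=> // tx; apply: (ndx 1%N) => /=; left.
  have [|nt nd] := IH; first by move=> m mn; apply: ns; rewrite ltnS ltnW.
  have nsn := ns n (ltnSn n).
  rewrite /=; case: (boolP (odd n)) nd => on /= nd.
    have [y xy nty] := first_escape nt nd.
    have ly : legal Out trap (position s t x n) y.
      by split=> // ty; apply: (nty 1%N); left.
    have H : forall k, ~ decided true k (t (position s t x n)).
      by apply: tP; exists y.
    by split=> // ty; apply: (H 1%N); left.
  have [Oy ty] := ss _ nsn; split=> // k dk.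
  by apply: (nd k.+1) => /=; right; exists (s (position s t x n)).
case: (sw t tt) => [tx|[n on [stn nsn]]]; first by apply: (ndx 1%N); left.
have [nt nd] := inv n nsn; rewrite on /= in nd.
have [y xy nty] := first_escape nt nd.
have : legal Out trap (position s t x n) y.
  by split=> // ty; apply: (nty 1%N); left.
by rewrite stn.
Qed.

Lemma no_second_winning x : (forall n, ~ decided false n x) ->
  ~ exists t, second_winning_strategy Out trap x t.
Proof.
move=> ndx [t [tt tw]].
have [s [ss sP]] := exists_strategy (fun _ y => forall n, ~ decided true n y).
have [ntx [n on [stn nsn]]] := tw s ss.
have inv m : (forall k, (k < m)%N -> ~ stuck Out trap (position s t x k)) ->
    ~ trap (position s t x m) /\
    forall k, ~ decided (odd m) k (position s t x m).
  elim: m => [_//|m IH ns].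
  have [|nt nd] := IH; first by move=> k km; apply: ns; rewrite ltnS ltnW.
  have nsm := ns m (ltnSn m).
  rewrite /=; case: (boolP (odd m)) nd => om /= nd.
    have [Oy ty] := tt _ nsm; split=> // k dk.
    by apply: (nd k.+1) => /=; right; exists (t (position s t x m)).
  have [y xy nty] := first_escape nt nd.
  have ly : legal Out trap (position s t x m) y.
    by split=> // ty; apply: (nty 1%N); left.
  have H : forall k, ~ decided true k (s (position s t x m)).
    by apply: sP; exists y.
  by split=> // ty; apply: (H 1%N); left.
have [nt nd] := inv n nsn; rewrite (negbTE on) in nd.
have [y xy nty] := first_escape nt nd.
have : legal Out trap (position s t x n) y.
  by split=> // ty; apply: (nty 1%N); left.
by rewrite stn.
Qed.

(** A move that lowers the rank at every rank simultaneously. A positional strategy does not know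
    the number of moves left, so it has to take the fastest win for the play to end. *)
Definition quick_move x y :=
  forall n, decided true n.+1 x -> decided false n y.

Lemma quick_move_exists x n : ~ trap x -> decided true n x ->
  exists2 y, legal Out trap x y & quick_move x y.
Proof.
move=> tx; elim: n {-2}n (leqnn n) => [[]//|N IH] [//|n] nN dn.
have [dn'|ndn] := pselect (decided true n x); first exact: (IH n).
case: dn => // -[y xy yn]; exists y.
  by split=> //; exact: decided_false_open yn.
move=> k dk; apply: decided_leq yn; rewrite leqNgt; apply/negP => kn.
by apply: ndn; apply: decided_leq dk.
Qed.

Lemma strategy_wins (s t : V -> V) (b : bool) x n :
  (forall z, (exists2 y, legal Out trap z y & quick_move z y) ->
     quick_move z (if b then s z else t z)) ->
  strategy Out trap s -> strategy Out trap t ->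
  ~ trap x -> decided b n x ->
  exists2 k, odd k = b & ends_at Out trap s t x k.
Proof.
move=> qs ss st.
suff H : forall n m, ~ trap (position s t x m) ->
    (forall k, (k < m)%N -> ~ stuck Out trap (position s t x k)) ->
    decided (odd m (+) b) n (position s t x m) ->
    exists2 k, odd k = b & ends_at Out trap s t x k.
  by move=> tx dx; apply: (H n 0%N).
elim=> // {}n IH m nt ns dm.
have [sm|nsm] := pselect (stuck Out trap (position s t x m)).
  exists m; last by split.
  move: dm; case: (odd m) => /=; case: (b) => //=.
    by case=> // -[y xy yn]; have : legal Out trap (position s t x m) y;
      [split=> //; exact: decided_false_open yn | rewrite sm].
  by case=> // -[y xy yn]; have : legal Out trap (position s t x m) y;
      [split=> //; exact: decided_false_open yn | rewrite sm].
have lm : legal Out trap (position s t x m) (position s t x m.+1).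
  by rewrite /=; case: (odd m); [exact: st|exact: ss].
apply: (IH m.+1); first by case: lm.
  by move=> k; rewrite ltnS leq_eqVlt => /orP[/eqP ->//|/ns].
case: (boolP (odd m (+) b)) dm => ob dm.
  have -> : odd m.+1 (+) b = false by rewrite /= addNb ob.
  have -> : position s t x m.+1 =
      if b then s (position s t x m) else t (position s t x m).
    by move: ob; rewrite /=; case: (odd m); case: (b).
  by apply: qs => //; exact: quick_move_exists dm.
have -> : odd m.+1 (+) b = true by rewrite /= addNb ob.
by case: dm => _; apply; case: lm.
Qed.

Lemma draw_undecided x : draw Out trap x <-> forall n, undecided n x.
Proof.
split=> [[nf nsd] n|H]; last first.
  by split; [apply: no_first_winning|apply: no_second_winning] => n; case: (H n).
have [s [ss sq]] := exists_strategy quick_move.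
split=> dn.
  apply: nf; exists s; split=> // t st.
  have [tx|tx] := pselect (trap x); [by left|right].
  by have [k ok ?] := strategy_wins (b := true) sq ss st tx dn; exists k.
apply: nsd; exists s; split=> // t st.
have tx := decided_false_open dn; split=> //.
by have [k ok ?] := strategy_wins (b := false) sq st ss tx dn; exists k => //; rewrite ok.
Qed.

End Decided.

(** * Probabilities of finite trap patterns *)

Fixpoint coin_mean (R : pzRingType) (p : R) (n : nat) (h : seq bool -> R) : R :=
  if n is m.+1 then p * coin_mean p m (fun s => h (true :: s)) +
                    (1 - p) * coin_mean p m (fun s => h (false :: s))
  else h [::].

Section Coins.
Local Open Scope classical_set_scope.
Local Open Scope ring_scope.
Variables (R : realType) (p : R) (d : measure_display).
Variables (Omega : measurableType d) (P : probability Omega R).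
Variables (V : choiceType) (E : V -> set Omega).
Hypothesis traps : random_traps p P E.

Definition pattern (ys : seq V) (w : Omega) : seq bool :=
  [seq `[< E y w >] | y <- ys].

Let mE v : measurable (E v). Proof. by case: traps. Qed.

Lemma pattern_cons y ys (b : pred (seq bool)) :
  [set w | b (pattern (y :: ys) w)] =
    E y `&` [set w | b (true :: pattern ys w)] `|`
    ~` E y `&` [set w | b (false :: pattern ys w)].
Proof.
apply/seteqP; split=> w /=; rewrite /pattern /=.
  case: asboolP => Ew bw; first by left; split.
  by right; split.
case=> -[Ew bw]; first by rewrite (asboolT Ew).
by rewrite (asboolF Ew).
Qed.

Lemma measurable_pattern ys (b : pred (seq bool)) :
  measurable [set w | b (pattern ys w)].
Proof.
elim: ys b => [|y ys IH] b.
  have [bn|nbn] := boolP (b [::]).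
    rewrite (_ : [set w | _] = setT); first exact: measurableT.
    by apply/seteqP; split.
  rewrite (_ : [set w | _] = set0); first exact: measurable0.
  by apply/seteqP; split=> w //=; rewrite (negbTE nbn).
rewrite pattern_cons; apply: measurableU; apply: measurableI => //.
- exact: (IH (fun s => b (true :: s))).
- exact: measurableC.
- exact: (IH (fun s => b (false :: s))).
Qed.

Lemma measurable_bigcap_traps (F : {fset V}) :
  measurable (\bigcap_(v in [set` F]) E v).
Proof. by apply: fin_bigcap_measurable => //; exact: finite_fset. Qed.

Lemma prob_bigcap_traps (F : {fset V}) :
  P (\bigcap_(v in [set` F]) E v) = (p ^+ #|` F|)%:E.
Proof.
case: traps => _ PE ind; rewrite ind.
rewrite (eq_bigr (fun=> p%:E)); last by move=> v _; exact: PE.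
elim: (enum_fset F) => [|v s IH]; first by rewrite big_nil.
by rewrite big_cons IH /= exprS EFinM.
Qed.

(** Independence is given for traps only. An open vertex enters by subtracting the event that it is
    a trap, and the set [F] of vertices already known to be traps keeps the induction going. *)
Lemma prob_pattern_bigcap ys (F : {fset V}) (b : pred (seq bool)) :
  uniq ys -> (forall y, y \in ys -> y \notin F) ->
  P ((\bigcap_(v in [set` F]) E v) `&` [set w | b (pattern ys w)]) =
    (p ^+ #|` F| * coin_mean p (size ys) (fun s => (b s)%:R))%:E.
Proof.
elim: ys F b => [|y ys IH] F b.
  move=> _ _ /=; case: (b [::]).
    rewrite (_ : [set _ | true] = setT); last by apply/seteqP; split.
    by rewrite setIT mulr1 prob_bigcap_traps.
  rewrite (_ : [set _ | false] = set0); last by apply/seteqP; split.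
  by rewrite setI0 measure0 mulr0.
move=> /= /andP[yys uys] disj.
have yF : y \notin F by apply: disj; rewrite mem_head.
have dF z : z \in ys -> z \notin F.
  by move=> zys; apply: disj; rewrite inE zys orbT.
have dyF z : z \in ys -> z \notin (y |` F)%fset.
  move=> zys; rewrite !inE negb_or dF // andbT.
  by apply: contraNneq yys => <-.
set C := \bigcap_(v in _) _.
have capy : \bigcap_(v in [set` (y |` F)%fset]) E v = E y `&` C.
  apply/seteqP; split=> w.
    move=> H; split; first by apply: H; rewrite /= !inE eqxx.
    by move=> v vF; apply: H; rewrite /= !inE vF orbT.
  case=> Ey H v; rewrite /= !inE => /orP[/eqP -> //|vF]; exact: H.
pose B b0 := [set w | b (b0 :: pattern ys w)].
have mB b0 : measurable (B b0).
  exact: (@measurable_pattern ys (fun s => b (b0 :: s))).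
have IHy b0 : P (E y `&` C `&` B b0) =
    (p ^+ #|` F|.+1 * coin_mean p (size ys) (fun s => (b (b0 :: s))%:R))%:E.
  by rewrite -capy (IH _ (fun s => b (b0 :: s))) // cardfsU1 yF.
have IHF b0 : P (C `&` B b0) =
    (p ^+ #|` F| * coin_mean p (size ys) (fun s => (b (b0 :: s))%:R))%:E.
  by rewrite (IH _ (fun s => b (b0 :: s))).
have mC : measurable C by exact: measurable_bigcap_traps.
have -> : C `&` [set w | b (pattern (y :: ys) w)] =
    (E y `&` C `&` B true) `|` ((C `&` B false) `\` (E y `&` C `&` B false)).
  rewrite pattern_cons; apply/seteqP; split=> w.
    case=> Cw [[Ew Bw]|[Ew Bw]]; first by left.
    by right; split=> // -[[]].
  case=> [[[Ew Cw] Bw]|[[Cw Bw] nw]]; first by split=> //; left.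
  by split=> //; right; split=> // Ew; exact: nw.
rewrite measureU; first last.
- by apply/seteqP; split=> // w [[[Ew Cw] Bw] [[_ Bw'] nw]]; apply: nw.
- by apply: measurableD; repeat apply: measurableI.
- by repeat apply: measurableI.
rewrite measureD; first last.
- by rewrite (le_lt_trans (probability_le1 P _)) ?ltry //; exact: measurableI.
- by repeat apply: measurableI.
- by repeat apply: measurableI.
have -> : C `&` B false `&` (E y `&` C `&` B false) = E y `&` C `&` B false.
  by rewrite setIC; apply/setIidPl => w [[_ Cw] Bw].
rewrite /= !IHy IHF -EFinB -EFinD; congr (_%:E).
by rewrite !exprS; ring.
Qed.

Lemma prob_pattern ys (b : pred (seq bool)) : uniq ys ->
  P [set w | b (pattern ys w)] = (coin_mean p (size ys) (fun s => (b s)%:R))%:E.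
Proof.
move=> uys; have := @prob_pattern_bigcap ys fset0 b uys.
rewrite cardfs0 expr0 mul1r => <- //.
by rewrite (_ : \bigcap_(_ in _) _ = setT) ?setTI // set_fset0 bigcap_set0.
Qed.

Variable (Out : V -> set V).
Hypothesis Out_fin : forall x, finite_set (Out x).

Lemma measurable_decided b n x :
  measurable [set w | decided Out [set v | E v w] b n x].
Proof.
elim: n b x => [|n IH] [] x /=.
- exact: measurable0.
- exact: measurable0.
- rewrite (_ : [set w | _] = E x `|` \bigcup_(y in Out x)
      [set w | decided Out [set v | E v w] false n y]).
    by apply: measurableU => //; exact: fin_bigcup_measurable.
  by apply/seteqP; split.
- rewrite (_ : [set w | _] = ~` E x `&` \bigcap_(y in Out x)
      [set w | decided Out [set v | E v w] true n y]).
    by apply: measurableI; [exact: measurableC|exact: fin_bigcap_measurable].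
  by apply/seteqP; split.
Qed.

Definition undecided_event n x := [set w | undecided Out [set v | E v w] n x].

Lemma measurable_undecided n x : measurable (undecided_event n x).
Proof.
have -> : undecided_event n x =
    ~` [set w | decided Out [set v | E v w] true n x] `&`
    ~` [set w | decided Out [set v | E v w] false n x] by [].
by apply: measurableI; apply: measurableC; exact: measurable_decided.
Qed.

(** By [draw_undecided] the draw is the decreasing intersection of the undecided events, and
    continuity from above passes the bound to the limit. *)
Lemma draw_positive (c : R) x : 0 < c ->
  (forall n, (c%:E <= P (undecided_event n x))%E) ->
  measurable (draw_event Out E x) /\ (0 < P (draw_event Out E x))%E.
Proof.
move=> c0 cP.
have -> : draw_event Out E x = \bigcap_n undecided_event n x.
  apply/seteqP; split=> w.
    by move=> dw n _; exact: (draw_undecided _ Out_fin _).1 dw n.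
  by move=> H; apply/(draw_undecided _ Out_fin) => n; exact: H.
split; first by apply: bigcap_measurable => // n _; exact: measurable_undecided.
apply: (@lt_le_trans _ _ c%:E); first by rewrite lte_fin.
have cv : P (undecided_event n x) @[n --> \oo] --> P (\bigcap_n undecided_event n x).
  apply: nonincreasing_cvg_mu => //.
  - by apply: (le_lt_trans (probability_le1 _ _)); [exact: measurable_undecided|rewrite ltry].
  - by move=> n; exact: measurable_undecided.
  - by apply: bigcap_measurable => // n _; exact: measurable_undecided.
  - move=> m n mn; apply/subsetPset => w; exact: undecided_leq.
rewrite -(cvg_lim _ cv) //; apply: lime_ge; first by apply/cvg_ex; eexists; exact: cv.
exact: nearW.
Qed.

End Coins.

(** * Heat-bath dynamics driven by the traps *)

Section HardCore.
Variables (T : finType) (e : rel T).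

Definition heat_bath (open : bool) v (I : {set T}) :=
  if open && free e I v then v |: I else I :\ v.

(* [true] stands for a trap. *)
Fixpoint run (l : seq T) (s : seq bool) (I : {set T}) : {set T} :=
  if l is v :: l' then
    if s is b :: s' then run l' s' (heat_bath (~~ b) v I) else I
  else I.

Hypothesis e_sym : symmetric e.
Hypothesis e_irr : irreflexive e.

Lemma free_setU1 (I : {set T}) v : free e (v |: I) v = free e I v.
Proof.
apply/forall_inP/forall_inP => H w wI; first by apply: H; rewrite inE wI orbT.
by case/finset.setU1P: wI => [->|/H//]; rewrite e_irr.
Qed.

Lemma indep_setU1 (I : {set T}) v : v \notin I -> indep e (v |: I) = indep e I && free e I v.
Proof.
move=> vI; apply/indepP/andP => [H|[/indepP H /forall_inP F] u w].
  split; first by apply/indepP => u w uI wI; apply: H; rewrite !inE ?uI ?wI orbT.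
  by apply/forall_inP => w wI; apply: H; rewrite !inE ?eqxx ?wI ?orbT.
case/finset.setU1P=> [->|uI] /finset.setU1P[->|wI]; rewrite ?e_irr //; first exact: F.
  by rewrite e_sym F.
exact: H.
Qed.

Section Stationary.
Variables (R : realFieldType) (p la : R).
Hypothesis lap : la * p = 1 - p.

(** A configuration without [v] is paired with the one where [v] is added, if this is allowed; the
    heat bath at [v] redistributes mass only inside such a pair. *)
Lemma sum_split_vertex (h : {set T} -> R) (L I0 : {set T}) v : v \in L ->
  \sum_(I in hc_conf e L I0) h I =
  \sum_(K in hc_conf e L I0 | v \notin K) (h K + (free e K v)%:R * h (v |: K)).
Proof.
move=> vL; rewrite (bigID (fun I : {set T} => v \in I)) /= addrC big_split /=.
congr (_ + _).
rewrite [RHS](eq_bigr (fun K => if free e K v then h (v |: K) else 0)); last first.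
  by move=> K _; case: ifP; rewrite ?mul1r ?mul0r.
rewrite -big_mkcondr /=.
rewrite (reindex_onto (fun K : {set T} => v |: K) (fun I => I :\ v)) /=; last first.
  by move=> I /andP[_ vI]; rewrite finset.setD1K.
apply: eq_bigl => K; rewrite !inE eqxx /= andbT.
have -> : ((v |: K) :\ v == K) = (v \notin K).
  apply/eqP/idP => [<-|vK]; first by rewrite !inE eqxx.
  by rewrite finset.setU1K.
have [vK|vK] := boolP (v \in K); rewrite ?andbF //= !andbT indep_setU1 //.
have -> : (v |: K) :\: L = K :\: L.
  by apply/setP => w; rewrite !inE; case: eqP => // ->; rewrite vL.
by rewrite -!andbA; congr (_ && _); rewrite andbC.
Qed.

(** Inside a pair the masses have the ratio [1 : la], which is the ratio [p : 1 - p] of the coin, so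
    a fresh coin reproduces them. *)
Lemma heat_bath_stationary (h : {set T} -> R) (L I0 : {set T}) v : v \in L ->
  \sum_(I in hc_conf e L I0) la ^+ #|I| *
    (p * h (heat_bath false v I) + (1 - p) * h (heat_bath true v I)) =
  \sum_(I in hc_conf e L I0) la ^+ #|I| * h I.
Proof.
move=> vL; rewrite !(sum_split_vertex _ _ vL); apply: eq_bigr => K /andP[_ vK].
rewrite /heat_bath /= free_setU1 finset.setU1K // cardsU1 vK /= add1n exprS.
have -> : K :\ v = K.
  by apply/setP => w; rewrite !inE; case: eqP => // ->; rewrite (negbTE vK).
have -> : v |: (v |: K) = v |: K by rewrite finset.setUA finset.setUid.
have -> : 1 - p = la * p by rewrite lap.
case: (free e K v); rewrite ?mul0r ?mul1r ?addr0; last first.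
  by rewrite -mulrDl lap addrC subrK mul1r.
have p1 : p + la * p = 1 by rewrite lap addrC subrK.
transitivity (la ^+ #|K| * (h K + la * h (v |: K)) * (p + la * p)); first by ring.
by rewrite p1; ring.
Qed.

Lemma run_stationary (h : {set T} -> R) (L I0 : {set T}) l : {subset l <= L} ->
  \sum_(I in hc_conf e L I0) la ^+ #|I| *
    coin_mean p (size l) (fun s => h (run l s I)) =
  \sum_(I in hc_conf e L I0) la ^+ #|I| * h I.
Proof.
elim: l => [//|v l IH] lL.
have vL : v \in L by apply: lL; rewrite mem_head.
rewrite -IH; last by move=> w wl; apply: lL; rewrite inE wl orbT.
exact: (heat_bath_stationary
  (fun I => coin_mean p (size l) (fun s => h (run l s I))) I0 vL).
Qed.

End Stationary.

(** * The game read backwards as a sequence of updates *)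

Section Unfolding.
Variables (V : Type) (Out : V -> set V) (trap : set V).
Variables (cls : T -> nat) (L : {set T}) (pos : T -> nat -> V).
Hypothesis e_cls : forall v w, e v w -> cls v <> cls w.
Hypothesis Out_pos : forall v j, v \in L -> forall y,
  Out (pos v j) y <-> exists2 w, e v w & y = pos w (j + (cls w < cls v)%N)%N.

(* The copy of [v] at the latest time treated so far; updates go back in time. *)
Definition step_time (v : T) (ver : T -> nat) w :=
  if w == v then (ver v).-1 else ver w.

Fixpoint updated (l : seq T) (ver : T -> nat) : seq V :=
  if l is v :: l' then pos v (ver v).-1 :: updated l' (step_time v ver) else [::].

Fixpoint final_time (l : seq T) (ver : T -> nat) : T -> nat :=
  if l is v :: l' then final_time l' (step_time v ver) else ver.

Fixpoint schedule (l : seq T) (ver : T -> nat) : Prop :=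
  if l is v :: l' then
    [/\ (0 < ver v)%N, v \in L,
        forall w, e v w -> w \in L -> ver w = ((ver v).-1 + (cls w < cls v)%N)%N &
        schedule l' (step_time v ver)]
  else True.

(** [v \in I] is to mean that the copy of [v] at time [ver v] is lost for the player to move. This
    is trusted only for games too short to reach the time horizon [N] or to leave [L]. *)
Definition agrees (N : nat) (I : {set T}) (ver : T -> nat) :=
  forall k v, deep e L k v -> (ver v + k <= N)%N ->
    (decided Out trap false k (pos v (ver v)) -> v \in I) /\
    (decided Out trap true k (pos v (ver v)) -> v \notin I).

Lemma heat_bath_agrees N I ver v (b : bool) : (0 < ver v)%N -> v \in L ->
  (forall w, e v w -> w \in L -> ver w = ((ver v).-1 + (cls w < cls v)%N)%N) ->
  (b <-> trap (pos v (ver v).-1)) ->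
  agrees N I ver -> agrees N (heat_bath (~~ b) v I) (step_time v ver).
Proof.
move=> ver0 vL verE bt ag k u; rewrite /step_time.
have [->|uv] := eqVneq u v; last first.
  move=> dk uN; have [Hf Ht] := ag k u dk uN.
  by split=> [/Hf|/Ht] H; rewrite /heat_bath; case: ifP; rewrite !inE ?(negbTE uv) ?H.
case: k => [//|k] /andP[_ /forall_inP dk] vN.
have vE w : e v w -> k != 0%N ->
    ver w = ((ver v).-1 + (cls w < cls v)%N)%N /\ (ver w + k <= N)%N.
  move=> vw; case: k dk vN => // k dk vN _.
  have verw := verE w vw; have /andP[wL _] := dk w vw.
  by rewrite verw //; split=> //; case: (_ < _)%N; lia.
split=> /= H; rewrite /heat_bath.
  have [tx all_w] := H.
  have -> : b = false by apply/negP => /bt.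
  rewrite /=; have -> : free e I v; last by rewrite !inE eqxx.
  apply/forall_inP => w wI; apply/negP => vw.
  have dw : decided Out trap true k (pos w ((ver v).-1 + (cls w < cls v)%N)).
    by apply: all_w; apply/(Out_pos _ vL); exists w.
  have k0 : k != 0%N by apply/eqP => k0; rewrite k0 in dw.
  have [vw' wN] := vE w vw k0; rewrite -vw' in dw.
  by have [_ /(_ dw)] := ag k w (dk w vw) wN; rewrite wI.
case: H => [/bt ->|[y /(Out_pos _ vL)[w vw ->] dw]] /=; first by rewrite !inE eqxx.
have k0 : k != 0%N by apply/eqP => k0; rewrite k0 in dw.
have [vw' wN] := vE w vw k0; rewrite -vw' in dw.
have [/(_ dw) wI _] := ag k w (dk w vw) wN.
have -> : free e I v = false by apply/negP => /forall_inP /(_ w wI); rewrite vw.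
by rewrite andbF !inE eqxx.
Qed.

Lemma run_agrees N l ver I : schedule l ver -> agrees N I ver ->
  agrees N (run l [seq `[< trap y >] | y <- updated l ver] I) (final_time l ver).
Proof.
elim: l ver I => //= v l IH ver I [ver0 vL verE sch] ag.
by apply: IH => //; apply: heat_bath_agrees => //; split=> /asboolP.
Qed.

(** Time runs backwards, so high classes come first: when [v] is updated, exactly its neighbours of
    higher class in [L] have been updated in this sweep. *)
Definition sweep : seq T := sort (fun v w => (cls w <= cls v)%N) (enum L).

Lemma mem_sweep v : (v \in sweep) = (v \in L).
Proof. by rewrite mem_sort mem_enum. Qed.

Lemma uniq_sweep : uniq sweep.
Proof. by rewrite sort_uniq enum_uniq. Qed.

(** Induction on the part [l2] of the current sweep still to be done; its sites are at time [j.+1],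
    the others at time [j]. *)
Lemma sweep_schedule j rest l1 l2 ver : sweep = l1 ++ l2 ->
  (forall w, w \in L -> ver w = (j + (w \in l2))%N) ->
  (forall ver', (forall w, w \in L -> ver' w = j) ->
     schedule rest ver' /\ (forall w, w \in L -> final_time rest ver' w = 0%N)) ->
  schedule (l2 ++ rest) ver /\
  forall w, w \in L -> final_time (l2 ++ rest) ver w = 0%N.
Proof.
move=> sE verE Hrest; elim: l2 l1 ver sE verE => [|v l2 IH] l1 ver sE verE /=.
  by apply: Hrest => w wL; rewrite verE // addn0.
have vL : v \in L by rewrite -mem_sweep sE mem_cat mem_head orbT.
have [vl1 vl2] : v \notin l1 /\ v \notin l2.
  have := uniq_sweep; rewrite sE cat_uniq /= negb_or => /and3P[_ /andP[-> _]].
  by case/andP.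
have verv : ver v = j.+1 by rewrite verE // mem_head addn1.
have [|w wL|sch fin] := IH (rcons l1 v) (step_time v ver).
- by rewrite cat_rcons.
- rewrite /step_time; have [->|wv] := eqVneq w v; last by rewrite verE // inE (negbTE wv).
  by rewrite verv (negbTE vl2) addn0.
split=> //; split=> // [|w vw wL]; first by rewrite verv.
rewrite verE // verv /=; congr (_ + nat_of_bool _)%N.
have wv : w != v by apply: contraTneq vw => ->; rewrite e_irr.
have := e_cls vw; have : w \in sweep by rewrite mem_sweep.
have srt : sorted (fun v w => (cls w <= cls v)%N) sweep.
  by apply: sort_sorted => a b; exact: leq_total.
rewrite sE mem_cat inE (negbTE wv) /= => wl clsN.
have tr : transitive (fun v w => (cls w <= cls v)%N).
  by move=> a b c ab bc; exact: leq_trans bc ab.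
move: srt; rewrite sE (sorted_pairwise tr) pairwise_cat /=.
move=> /and3P[/allrelP H1 _ /andP[/allP H2 _]].
case/orP: wl => [wl1|wl2].
  have := H1 w v wl1 (mem_head _ _).
  have -> : (w \in l2) = false.
    apply/negP => wl2; have := uniq_sweep; rewrite sE cat_uniq => /and3P[_ /hasP[]].
    by exists w; rewrite // inE wl2 orbT.
  by move=> ?; apply/esym/negbTE; rewrite -leqNgt.
by rewrite wl2; have := H2 w wl2; rewrite leq_eqVlt => /orP[/eqP ?|->]; [lia|].
Qed.

Definition sweeps n := flatten (nseq n sweep).

Lemma sweeps_schedule n ver : (forall w, w \in L -> ver w = n) ->
  schedule (sweeps n) ver /\
  forall w, w \in L -> final_time (sweeps n) ver w = 0%N.
Proof.
elim: n ver => [//|n IH] ver verE.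
apply: (@sweep_schedule n _ [::]) => // w wL.
by rewrite verE // mem_sweep wL addn1.
Qed.

Lemma sweeps_sub n : {subset sweeps n <= L}.
Proof. by move=> v /flattenP[s /nseqP[-> _]]; rewrite mem_sweep. Qed.

Lemma run_decided n v0 I : v0 \in L -> deep e L n v0 ->
  let J := run (sweeps n)
    [seq `[< trap y >] | y <- updated (sweeps n) (fun=> n)] I in
  (decided Out trap false n (pos v0 0%N) -> v0 \in J) /\
  (decided Out trap true n (pos v0 0%N) -> v0 \notin J).
Proof.
move=> vL dn; have [sch fin] := @sweeps_schedule n (fun=> n) (fun _ _ => erefl).
(* At the horizon only [k = 0] is admissible, and nothing is decided within 0; hence any initial [I]
   will do. *)
have ag0 : agrees n I (fun=> n).
  move=> k v _; case: k => // k; rewrite addnS ltnNge leq_addr //.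
have := run_agrees sch ag0 => /(_ n v0 dn).
by rewrite fin //; apply.
Qed.

End Unfolding.

(** Each update reads the trap of another vertex, so the coins that drive [run] are independent. *)
Lemma updated_uniq (V : choiceType) (pos : T -> nat -> V) l ver :
  injective (fun vj => pos vj.1 vj.2) ->
  (forall v, count_mem v l <= ver v)%N ->
  uniq (updated pos l ver) /\
  (forall y, y \in updated pos l ver -> exists v j, y = pos v j /\ (j < ver v)%N).
Proof.
move=> inj; elim: l ver => [//|v l IH] ver cnt.
have verv : (0 < ver v)%N by have := cnt v; rewrite /= eqxx; lia.
have [|uq mem] := IH (step_time v ver).
  move=> w; rewrite /step_time; have := cnt w; rewrite /= [v == w]eq_sym.
  by case: eqP => [->|_]; lia.
split=> /=.
  rewrite uq andbT; apply/negP => /mem[w [j [E jw]]].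
  have [vw jE] : v = w /\ (ver v).-1 = j.
    by have := inj (v, (ver v).-1) (w, j) E; case.
  by move: jw; rewrite /step_time -vw eqxx jE ltnn.
move=> y; rewrite inE => /orP[/eqP ->|/mem[w [j [-> jw]]]].
  by exists v, (ver v).-1; split=> //; lia.
exists w, j; split=> //; move: jw; rewrite /step_time.
by case: eqP => // ->; lia.
Qed.

End HardCore.

(** * Two phases leave the game undecided *)

Section UndecidedBound.
Variables (R : realType) (p : R) (d : measure_display).
Variables (Omega : measurableType d) (P : probability Omega R).
Variables (V : choiceType) (Out : V -> set V) (E : V -> set Omega).
Hypothesis Out_fin : forall x, finite_set (Out x).
Hypothesis traps : random_traps p P E.

(** [f I] is the probability that [v0] is occupied after running from [I]. By stationarity its mean
    under either hard-core measure is the occupation probability of [v0]; and [f] varies by at most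
    [P U], because the run forgets its start wherever the game is decided. *)
Lemma undecided_lower_bound (T : finType) (e : rel T) (cls : T -> nat)
    (L I0 I1 : {set T}) (pos : T -> nat -> V) (v0 : T) (n : nat) (ep : R) :
  symmetric e -> irreflexive e -> (forall v w, e v w -> cls v <> cls w) ->
  injective (fun vj => pos vj.1 vj.2) ->
  (forall v j, v \in L -> forall y, Out (pos v j) y <->
     exists2 w, e v w & y = pos w (j + (cls w < cls v)%N)%N) ->
  v0 \in L -> deep e L n v0 -> 0 < p < 1 ->
  indep e I0 -> indep e I1 ->
  let la := (1 - p) / p in
  \sum_(I in hc_conf e L I0 | v0 \notin I) la ^+ #|I| <=
    ep * \sum_(I in hc_conf e L I0) la ^+ #|I| ->
  \sum_(I in hc_conf e L I1 | v0 \in I) la ^+ #|I| <=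
    ep * \sum_(I in hc_conf e L I1) la ^+ #|I| ->
  ((1 - 2 * ep)%:E <= P (undecided_event E Out n (pos v0 0%N)))%E.
Proof.
move=> sym irr ecls inj OutE vL dn /andP[p0 p1] ind0 ind1 la H0 H1.
have la0 : 0 < la by rewrite divr_gt0 // subr_gt0.
have lap : la * p = 1 - p by rewrite /la divfK // gt_eqF.
pose l := sweeps cls L n; pose ys := updated pos l (fun=> n).
have szys : size ys = size l.
  rewrite /ys; elim: (l) (fun=> n) => //= v s IH ver; by rewrite IH.
have uys : uniq ys.
  apply: (updated_uniq inj _).1 => v; rewrite /l /sweeps.
  elim: (n) => //= k IH; rewrite count_cat -addn1 addnC leq_add //.
  by rewrite count_uniq_mem ?uniq_sweep // leq_b1.
pose f I := coin_mean p (size l) (fun s => (v0 \in run e l s I)%:R).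
pose A I : set Omega := [set w : Omega | v0 \in run e l (pattern E ys w) I]%classic.
have PA I : P (A I) = (f I)%:E.
  by rewrite (prob_pattern traps (fun s => v0 \in run e l s I)) // szys.
have mA I : measurable (A I).
  exact: (measurable_pattern traps ys (fun s => v0 \in run e l s I)).
have mU := measurable_undecided traps Out_fin n (pos v0 0%N).
set U := undecided_event _ _ _ _ in mU *.
have PUfin : P U \is a fin_num.
  by rewrite ge0_fin_numE // (le_lt_trans (probability_le1 P mU)) // ltry.
pose q := fine (P U).
have PU : P U = q%:E by rewrite fineK.
have comp I I' : f I <= f I' + q.
  rewrite -lee_fin EFinD -!PA -PU.
  apply: (@le_trans _ _ (P (A I' `|` U)%classic)); last exact: measureU2.
  apply: le_measure; rewrite ?inE //; first exact: measurableU.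
  move=> w Aw; have [Uw|nUw] := pselect (U w); [by right|left].
  have rd J := @run_decided _ e irr V Out [set v | E v w]%classic cls L pos ecls OutE n v0 J vL dn.
  have [dt|ndt] := pselect (decided Out [set v | E v w]%classic true n (pos v0 0%N)).
    by have [_ /(_ dt)] := rd I; rewrite Aw.
  have [df|ndf] := pselect (decided Out [set v | E v w]%classic false n (pos v0 0%N)).
    by have [/(_ df)] := rd I'.
  by exfalso; apply: nUw; split.
have stat I2 : \sum_(I in hc_conf e L I2) la ^+ #|I| * f I =
    \sum_(I in hc_conf e L I2 | v0 \in I) la ^+ #|I|.
  rewrite (run_stationary sym irr lap (fun I => (v0 \in I)%:R) I2 (@sweeps_sub _ cls L n)).
  rewrite big_mkcondr; apply: eq_bigr => I _.
  by case: ifP; rewrite ?mulr1 ?mulr0.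
set Z0 := \sum_(I in hc_conf e L I0) _ in H0.
set Z1 := \sum_(I in hc_conf e L I1) _ in H1.
have Zpos I2 : indep e I2 -> 0 < \sum_(I in hc_conf e L I2) la ^+ #|I|.
  move=> ind; rewrite (bigD1 I2) ?inE ?ind ?eqxx //=.
  by rewrite ltr_pwDl ?exprn_gt0 // sumr_ge0 // => I _; rewrite exprn_ge0 // ltW.
have Z0p : 0 < Z0 by exact: Zpos.
have Z1p : 0 < Z1 by exact: Zpos.
have low I' : 1 - ep <= f I' + q.
  rewrite -(ler_pM2l Z0p).
  have : \sum_(I in hc_conf e L I0) la ^+ #|I| * f I <= Z0 * (f I' + q).
    rewrite /Z0 mulr_suml ler_sum // => I _.
    by rewrite ler_wpM2l ?comp // exprn_ge0 // ltW.
  apply: le_trans; rewrite stat.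
  have ZE : Z0 = \sum_(I in hc_conf e L I0 | v0 \in I) la ^+ #|I| +
      \sum_(I in hc_conf e L I0 | v0 \notin I) la ^+ #|I| by rewrite -bigID.
  by rewrite mulrBr mulr1 lerBlDr {1}ZE lerD2l mulrC.
have : Z1 * (1 - ep) <= Z1 * (ep + q).
  apply: (@le_trans _ _ (\sum_(I in hc_conf e L I1) la ^+ #|I| * (f I + q))).
    rewrite /Z1 mulr_suml ler_sum // => I _.
    by rewrite ler_wpM2l ?low // exprn_ge0 // ltW.
  under eq_bigr do rewrite mulrDr.
  by rewrite big_split /= stat -mulr_suml mulrDr lerD2r mulrC.
rewrite ler_pM2l // => qlow.
by rewrite PU lee_fin; lra.
Qed.

End UndecidedBound.

(** * The graphs *)

Section BipartiteDraws.
Variables (V : choiceType) (Out : V -> set V).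

(** The three special steps serve to integrate contours, the bound 1 keeps short walks in the
    window, and nonnegative first coordinates make the height rise by 0 or 1. *)
Definition flat_steps m (J : finType) (s : J -> 'rV[int]_m.+2) :=
  [/\ exists j, s j = 0, exists j, s j = delta_mx 0 0, exists j, s j = delta_mx 0 1,
    forall j i, `|s j 0 i| <= 1 & forall j, 0 <= s j 0 0].

(* Coordinates in which the game alternates between the steps [s j] and their
   opposites, the level going up by one after each pair of moves. *)
Definition alternating m (J : finType) (s : J -> 'rV[int]_m.+2)
    (pos : 'rV[int]_m.+2 -> bool -> nat -> V) :=
  [/\ injective (fun u => pos u.1.1 u.1.2 u.2),
    forall a k y, Out (pos a false k) y <-> exists j, y = pos (a + s j) true k &
    forall a k y, Out (pos a true k) y <-> exists j, y = pos (a - s j) false k.+1].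

Lemma alternating_finite m (J : finType) (s : J -> 'rV[int]_m.+2) pos :
  alternating s pos -> finite_set (Out (pos 0 false 0%N)).
Proof.
case=> _ H _; have -> : Out (pos 0 false 0%N) = range (fun j => pos (0 + s j) true 0%N).
  apply/predeqP => y; rewrite H; split=> [[j ->]|[j _ <-]]; first by exists j.
  by exists j.
exact: finite_image.
Qed.

Section Bound.
Context (R : realType) (p : R) (d : measure_display) (Omega : measurableType d)
  (P : probability Omega R) (E : V -> set Omega).
Hypothesis traps : random_traps p P E.
Hypothesis Out_fin : forall x, finite_set (Out x).

Lemma alternating_undecided m (J : finType) (s : J -> 'rV[int]_m.+2) pos y n :
  flat_steps s -> alternating s pos -> 0 < p < 1 ->
  0 <= y <= 1 -> p / (1 - p) <= 1 ->
  p / (1 - p) * mirror_const R J <= y ^+ #|J| ->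
  6%:R * #|{: J * J * J * J}|%:R ^+ 2 * (2%:R ^+ #|J| * y) <= 4%:R^-1 ->
  ((2%:R^-1)%:E <= P (undecided_event E Out n (pos 0%R false 0%N)))%E.
Proof.
move=> [[j0 sj0] [j1 sj1] [j2 sj2] s1 s0] [inj OutF OutT] /andP[p0 p1] y01 t1 ty ysmall.
set t := p / (1 - p) in t1 ty.
have t0 : 0 < t by rewrite divr_gt0 // subr_gt0.
(* The least size at which [margin_center] applies with depth [n]. *)
pose M := (n + 2)%N.
pose e := bip_rel (tstep M s).
pose L := bbox M m.
pose ep : R := 4%:R^-1.
have stab v : \sum_(X : {set _} | (X \subset L) && (v \in X)) weight t (tstep M s) X <=
    ep * odd_sum t (tstep M s) L.
  have t01 : 0 < t <= 1 by rewrite t0.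
  apply: (le_trans (@torus_stable M m J s j0 j1 j2 sj0 sj1 sj2 s1 s0 R t y v t01 y01 ty _)).
    by apply: (le_trans ysmall); rewrite invf_le1 // ler1n.
  by rewrite ler_wpM2r // ltW // odd_sum_gt0.
have laE : (1 - p) / p = t^-1 by rewrite invf_div.
have -> : (2%:R^-1 : R) = 1 - 2 * ep by rewrite /ep; lra.
rewrite -(lift_torus_center M m).
apply: (undecided_lower_bound Out_fin traps (T := ('rV['Z_M.*2.+2]_m.+2 * bool)%type) (e := e)
  (cls := fun v => nat_of_bool v.2) (L := L) (I0 := even_side _) (I1 := odd_side _)
  (pos := fun v k => pos (lift_pos v.1) v.2 k) (v0 := (torus_center M m, false))).
- exact: bip_sym.
- exact: bip_irr.
- by move=> [a b] [c b'] /andP[/= bb' _]; case: b bb'; case: b'.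
- move=> [[a b] k] [[a' b'] k'] /= E2; have := inj (lift_pos a, b, k) (lift_pos a', b', k') E2.
  by case=> /lift_pos_inj -> -> ->.
- move=> [a b] k; rewrite mem_bbox => /forallP aB z; case: b aB => /= aB.
    rewrite OutT; split=> [[j ->]|[[c [|]] /andP[/= // _ /existsP[j /eqP jE]] ->]].
      exists (a - tstep M s j, false); last first.
        rewrite /= addn1; congr (pos _ _ _).
        rewrite -(lift_shift (z := - s j)) //; last by move=> i; rewrite mxE normrN.
        by rewrite map_mxN.
      by rewrite /e /bip_rel /=; apply/existsP; exists j; rewrite subrK.
    exists j; rewrite addn1; congr (pos _ _ _).
    rewrite -(lift_shift (z := - s j)) //; last by move=> i; rewrite mxE normrN.
    by rewrite map_mxN jE addrK.
  rewrite OutF; split=> [[j ->]|[[c [|]] /andP[/= // _ /existsP[j /eqP jE]] ->]].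
    exists (a + tstep M s j, true); last by rewrite /= addn0 lift_shift.
    by rewrite /e /bip_rel /=; apply/existsP; exists j.
  by exists j; rewrite addn0 jE lift_shift.
- by rewrite mem_bbox; apply/forallP => i; rewrite mxE margin_center // /M; lia.
- by apply: deep_torus_center => //; rewrite /M addn2 addn3.
- by rewrite p0.
- by apply/indepP => v w; rewrite !inE => v2 w2; rewrite /e /bip_rel /= (negbTE v2) (negbTE w2).
- by apply/indepP => v w; rewrite !inE => v2 w2; rewrite /e /bip_rel /= v2 w2.
- rewrite laE; have := even_boundary t0 stab (torus_center M m, false) (mirror_bbox M m).
  by under eq_bigl do rewrite [_ \in flip _]inE /= addbF.
- rewrite laE; have := odd_boundary t0 stab (torus_center M m, false).
  by under eq_bigl do rewrite [_ \in flip _]inE /= addbF.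
Qed.

End Bound.

Lemma odds_le (R : realFieldType) (p : R) : 0 < p -> p <= 2%:R^-1 -> p / (1 - p) <= 2%:R * p.
Proof. by move=> p0 p2; rewrite ler_pdivrMr; nra. Qed.

Lemma small_rate (R : realFieldType) (k : R) : 0 <= k ->
  exists2 y : R, 0 < y <= 1 & k * y <= 4%:R^-1.
Proof.
move=> k0; exists (4%:R * k + 1)^-1.
  by rewrite invr_gt0 invf_le1; lra.
by rewrite ler_pdivrMr; lra.
Qed.

Lemma alternating_draws (R : realType) (J : finType) :
  (forall x, exists m (s : J -> 'rV[int]_m.+2) pos,
     [/\ flat_steps s, alternating s pos & pos 0 false 0%N = x]) ->
  draws_for_small_p R Out.
Proof.
move=> emb; have Out_fin x : finite_set (Out x).
  by have [m [s [pos [_ alt <-]]]] := emb x; exact: alternating_finite alt.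
have [|y /andP[y0 y1] ysmall] := @small_rate R (6%:R * #|{: J * J * J * J}|%:R ^+ 2 * 2%:R ^+ #|J|).
  by rewrite !mulr_ge0 ?exprn_ge0.
have mc0 : 0 < mirror_const R J by rewrite mulr_gt0 ?exprn_gt0 // ltr0n addn2.
(* For [p <= 1 / 2] the inverse fugacity [p / (1 - p)] is at most [2 * p]; hence the 2 in the second
   entry. *)
exists (Num.min 2%:R^-1 (y ^+ #|J| / (2%:R * mirror_const R J))).
  by rewrite lt_min invr_gt0 ltr0n divr_gt0 ?exprn_gt0 ?mulr_gt0.
move=> p /andP[p0]; rewrite lt_min => /andP[p2 py] d Omega P E traps x.
have t2 := odds_le p0 (ltW p2).
have [m [s [pos [fs alt <-]]]] := emb x.
apply: (draw_positive traps Out_fin (c := 2%:R^-1)); first by rewrite invr_gt0.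
move=> n; apply: (alternating_undecided traps Out_fin (y := y) _ fs alt).
- by rewrite p0; lra.
- by rewrite y1 ltW.
- by lra.
- apply: (@le_trans _ _ (2%:R * p * mirror_const R J)); first by rewrite ler_wpM2r // ltW.
  by move: py; rewrite ltr_pdivlMr ?mulr_gt0 // mulrA [p * _]mulrC => /ltW.
- by rewrite [leLHS]mulrA.
Qed.

End BipartiteDraws.

(** [tau] is the offset of the first move and [omega] that of a pair of moves, the second of which
    uses the opposite steps. The level [lev] recovers [b] and [k] from a position since
    [0 < lev tau < lev omega]. *)
Lemma affine_draws (R : realType) (J : finType) (d : nat) (V : choiceType)
    (val : V -> 'rV[int]_d) (Out : V -> set V) :
  injective val ->
  (forall x, exists m (s : J -> 'rV[int]_m.+2) (Phi : 'rV[int]_m.+2 -> 'rV[int]_d)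
     (lev : 'rV[int]_d -> int) (tau omega : 'rV[int]_d),
     let raw a (b : bool) k := val x + Phi a + tau *+ b + omega *+ k in
     [/\ flat_steps s,
        [/\ {morph Phi : a b / a + b}, {morph lev : a b / a + b}, injective Phi,
           forall a, lev (Phi a) = 0 & 0 < lev tau < lev omega],
        forall a b k, exists v, val v = raw a b k &
        forall a b k v, val v = raw a b k -> forall y, Out v y <->
          exists j, val y = val v + (if b then omega - tau - Phi (s j) else tau + Phi (s j))]) ->
  draws_for_small_p R Out.
Proof.
move=> val_inj emb; apply: (@alternating_draws _ _ R J) => x.
have [m [s [Phi [lev [tau [omega [fs [PhiD levD Phi_inj levPhi /andP[tau0 tauo]] ex mv]]]]]]] := emb x.
have {}ex u : exists v, val v = val x + Phi u.1.1 + tau *+ (u.1.2 : bool) + omega *+ u.2 by exact: ex.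
have [pos posE] := choice ex.
have Phi0 : Phi 0 = 0 by apply: (addrI (Phi 0)); rewrite -PhiD !addr0.
have PhiB a b : Phi (a - b) = Phi a - Phi b by apply/eqP; rewrite eq_sym subr_eq -PhiD subrK.
have lev0 : lev 0 = 0 by apply: (addrI (lev 0)); rewrite -levD !addr0.
have levMn z k : lev (z *+ k) = lev z *+ k.
  by elim: k => [|k IH]; rewrite ?mulr0n // !mulrS levD IH.
exists m, s, (fun a b k => pos (a, b, k)); split=> //; last first.
  by apply: val_inj; rewrite posE /= Phi0 !mulr0n !addr0.
split.
- move=> [[a b] k] [[a' b'] k'] /= E.
  have := congr1 val E; rewrite !posE /= -!addrA => /addrI E2.
  have := congr1 lev E2; rewrite !levD !levPhi !levMn !add0r => E3.
  move: E3; rewrite -!(mulr_natr (lev _)) !natz => E3.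
  have kk : k = k' by move: E3; case: (b); case: (b') => /= E3; nia.
  have bb : b = b' by move: E3; rewrite kk => /addIr; case: (b); case: (b') => //= E3; nia.
  move: E2; rewrite kk bb => /addIr /Phi_inj -> //.
- move=> a k y; rewrite mv; last exact: posE.
  have E j : val (pos (a + s j, true, k)) = val (pos (a, false, k)) + (tau + Phi (s j)).
    rewrite !posE /= PhiD mulr1n mulr0n addr0; move: (omega *+ k) => w.
    by apply/rowP => i; rewrite !mxE; ring.
  split=> -[j jE]; exists j; last by rewrite jE E.
  by apply: val_inj; rewrite jE E.
- move=> a k y; rewrite mv; last exact: posE.
  have E j : val (pos (a - s j, false, k.+1)) = val (pos (a, true, k)) + (omega - tau - Phi (s j)).
    rewrite !posE /= PhiB mulr1n mulr0n addr0 mulrSr; move: (omega *+ k) => w.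
    by apply/rowP => i; rewrite !mxE; ring.
  split=> -[j jE]; exists j; last by rewrite jE E.
  by apply: val_inj; rewrite jE E.
Qed.

(** * Splitting off the last coordinate *)

Section Ext.
Variable m : nat.
Local Notation D := m.+3.
Implicit Types (a b : 'rV[int]_m.+2) (c : int) (z : 'rV[int]_D).

Definition ext a c : 'rV[int]_D :=
  \row_j (if unlift ord_max j is Some i then a 0 i else c).

Lemma ext_max a c : ext a c 0 ord_max = c.
Proof. by rewrite mxE unlift_none. Qed.

Lemma ext_lift a c i : ext a c 0 (lift ord_max i) = a 0 i.
Proof. by rewrite mxE liftK. Qed.

Lemma rowE_ext z z' : z 0 ord_max = z' 0 ord_max ->
  (forall i, z 0 (lift ord_max i) = z' 0 (lift ord_max i)) -> z = z'.
Proof. by move=> zm zl; apply/rowP => j; case: (unliftP ord_max j) => [i|] ->. Qed.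

Lemma extD a c b c' : ext (a + b) (c + c') = ext a c + ext b c'.
Proof.
apply: rowE_ext => [|i]; rewrite [RHS]mxE; first by rewrite !ext_max.
by rewrite !ext_lift mxE.
Qed.

Lemma extZ k a c : ext (k *: a) (k * c) = k *: ext a c.
Proof.
apply: rowE_ext => [|i]; rewrite [RHS]mxE; first by rewrite !ext_max.
by rewrite !ext_lift mxE.
Qed.

Lemma ext_inj a c b c' : ext a c = ext b c' -> a = b.
Proof.
by move=> E; apply/rowP => i; have := congr1 (fun z : 'rV_D => z 0 (lift ord_max i)) E; rewrite !ext_lift.
Qed.

Lemma basis_max : basis_vec D D = ext 0 1.
Proof.
apply: rowE_ext => [|i]; first by rewrite ext_max mxE eqxx.
by rewrite ext_lift !mxE lift_max eqSS ltn_eqF.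
Qed.

Lemma basis_lift (i : 'I_m.+2) : basis_vec D i.+1 = ext (delta_mx 0 i) 0.
Proof.
apply: rowE_ext => [|j]; first by rewrite ext_max mxE eqSS gtn_eqF.
by rewrite ext_lift !mxE lift_max eqSS.
Qed.

Lemma coord_sum_ext a c : coord_sum (ext a c) = \sum_i a 0 i + c.
Proof.
rewrite /coord_sum big_ord_recr ext_max; congr (_ + _); apply: eq_bigr => i _.
rewrite -(ext_lift a c); congr (ext a c _ _); apply: val_inj.
by rewrite /= /bump leqNgt ltn_ord.
Qed.

End Ext.

Lemma coord_sumD d : {morph @coord_sum d : x y / x + y}.
Proof. by move=> x y; rewrite /coord_sum -big_split; apply: eq_bigr => i _; rewrite mxE. Qed.

Lemma coord_sum0 d : @coord_sum d 0 = 0.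
Proof. by rewrite /coord_sum big1 // => i _; rewrite mxE. Qed.

Lemma coord_sumMn d z k : @coord_sum d (z *+ k) = coord_sum z *+ k.
Proof. by elim: k => [|k IH]; rewrite ?mulr0n ?coord_sum0 // !mulrS coord_sumD IH. Qed.

Lemma delta_le1 m (i j : 'I_m) : `|(delta_mx 0 i : 'rV[int]_m) 0 j| <= 1.
Proof. by rewrite mxE; case: (_ && _). Qed.

(** * The even sublattice with axis steps *)

Section Case1.
Variable m : nat.
Local Notation D := m.+3.

Definition step1 (ib : 'I_m.+2 * bool) : 'rV[int]_m.+2 :=
  if ib.2 then delta_mx 0 ib.1 else delta_mx 0 0 - delta_mx 0 ib.1.

Definition sum_row (a : 'rV[int]_m.+2) : int := \sum_i a 0 i.

Lemma sum_rowD : {morph sum_row : a b / a + b}.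
Proof. by move=> x y; rewrite /sum_row -big_split; apply: eq_bigr => i _; rewrite mxE. Qed.

Lemma sum_row_delta i : sum_row (delta_mx 0 i) = 1.
Proof.
rewrite /sum_row (bigD1 i) //= mxE !eqxx big1 ?addr0 // => j ji.
by rewrite mxE (negbTE ji).
Qed.

(** A shear that sends the flat steps of [step1] to [delta_mx 0 0] plus or minus [delta_mx 0 i]; the
    offset [tau] then removes [delta_mx 0 0]. In this way the axis steps acquire a null step and
    nonnegative first coordinates. *)
Definition chart1 (a : 'rV[int]_m.+2) := ext (a + sum_row a *: delta_mx 0 0) 0.

Lemma chart1D : {morph chart1 : a b / a + b}.
Proof. by move=> a b; rewrite /chart1 sum_rowD -extD scalerDl addrACA. Qed.

Lemma sum_row_shear c : sum_row (c + sum_row c *: delta_mx 0 0) = sum_row c * 2%:R.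
Proof.
rewrite sum_rowD mulr_natr mulr2n; congr (_ + _).
rewrite -[RHS]mulr1 -(sum_row_delta 0) /sum_row mulr_sumr; apply: eq_bigr => i _.
by rewrite mxE.
Qed.

Lemma chart1_inj : injective chart1.
Proof.
move=> a b /ext_inj E; have : sum_row a = sum_row b.
  by have := congr1 sum_row E; rewrite !sum_row_shear => /mulIf; apply.
by move=> SE; move: E; rewrite SE => /addIr.
Qed.

Lemma chart1_step ib : chart1 (step1 ib) = ext (delta_mx 0 0 + (if ib.2 then 1 else -1) *: delta_mx 0 ib.1) 0.
Proof.
case: ib => i []; rewrite /chart1 /step1 /=.
  by rewrite sum_row_delta !scale1r addrC.
have -> : sum_row (delta_mx 0 0 - delta_mx 0 i) = 0.
  by apply: (addIr (sum_row (delta_mx 0 i))); rewrite -sum_rowD subrK !sum_row_delta.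
by rewrite scale0r addr0 scaleN1r.
Qed.

Lemma Out1E (v y : V1 D) : Out1 v y <-> exists ib : 'I_m.+2 * bool,
  val y = val v + ((if ib.2 then 1 else -1) *: basis_vec D ib.1.+1 + basis_vec D D).
Proof.
split=> [[[//|i] /= iD H]|[[i b] H]].
  have im : (i < m.+2)%N by rewrite subn1 in iD.
  case: H => H; [exists (Ordinal im, true)|exists (Ordinal im, false)].
    by rewrite /= scale1r addrA.
  by rewrite /= scaleN1r addrA.
exists i.+1; first by rewrite subn1 /= ltn_ord.
by rewrite H addrA; case: (b); [left; rewrite scale1r|right; rewrite scaleN1r].
Qed.

Lemma draws1 (R : realType) : draws_for_small_p R (@Out1 D).
Proof.
apply: (@affine_draws R ('I_m.+2 * bool)%type D (V1 D) val) => [|x]; first exact: val_inj.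
exists m, step1, chart1, (fun z => z 0 ord_max), (ext (- delta_mx 0 0) 1), (ext 0 2) => raw.
have tau_step ib : ext (- delta_mx 0 0) 1 + chart1 (step1 ib) =
    (if ib.2 then 1 else -1) *: basis_vec D ib.1.+1 + basis_vec D D.
  by rewrite chart1_step -extD addKr basis_lift basis_max -extZ -extD mulr0 addr0 add0r addr0.
split.
- split.
  + by exists (0, false); rewrite /step1 /= subrr.
  + by exists (0, true).
  + by exists (1, true).
  + move=> [j []] i; rewrite /step1 /= ?delta_le1 // !mxE; case: (_ && _); case: (_ && _) => //.
  + move=> [j []]; rewrite /step1 /= !mxE /=; case: (_ == _) => //.
- split.
  + exact: chart1D.
  + by move=> a b; rewrite mxE.
  + exact: chart1_inj.
  + by move=> a; rewrite ext_max.
  + by rewrite !ext_max.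
- move=> a b k.
  have P : (2 %| coord_sum (raw a b k))%Z.
    rewrite /raw !coord_sumD !coord_sumMn !coord_sum_ext.
    rewrite -!/(sum_row _) sum_row_shear.
    have -> : sum_row (- delta_mx 0 0) = -1.
      by apply: (addIr (sum_row (delta_mx 0 0)));
        rewrite -sum_rowD addNr sum_row_delta /sum_row big1 // => i _; rewrite mxE.
    have -> : sum_row 0 = 0 by rewrite /sum_row big1 // => i _; rewrite mxE.
    rewrite addNr mul0rn !addr0 add0r; apply: rpredD; last by rewrite rpredMn.
    by apply: rpredD; [exact: (valP x)|rewrite dvdz_mull].
  by exists (exist _ (raw a b k) P).
- move=> a b k v _ y; rewrite Out1E.
  have two : ext 0 2 = basis_vec D D + basis_vec D D by rewrite basis_max -extD addr0.
  case: b; split=> -[[i c] H].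
  + exists (i, ~~ c); rewrite -addrA -opprD tau_step two H /=; congr (_ + _).
    by rewrite opprD addrACA subrr addr0 addrC -scaleNr; case: (c); rewrite /= ?opprK.
  + exists (i, ~~ c); rewrite H -addrA -opprD tau_step two /=; congr (_ + _).
    by rewrite opprD addrACA subrr addr0 addrC -scaleNr; case: (c); rewrite /= ?opprK.
  + by exists (i, c); rewrite tau_step.
  + by exists (i, c); rewrite H tau_step.
Qed.

End Case1.

(** * The lattice of equal parities with diagonal steps *)

Section Case2.
Variable m : nat.
Local Notation D := m.+3.
Implicit Types (f : {ffun 'I_m.+2 -> bool}).

Definition step2 f : 'rV[int]_m.+2 := \row_i (f i)%:R.

Lemma sum_signs (g : 'I_m.+2 -> int) :
  \sum_(i < m.+2) g i *: basis_vec D i.+1 = ext (\row_i g i) 0.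
Proof.
rewrite [\row_i g i]row_sum_delta; under eq_bigr do rewrite basis_lift -extZ mulr0.
have ext_sum (F : 'I_m.+2 -> 'rV_m.+2) : ext (\sum_i F i) 0 = \sum_i ext (F i) 0.
  apply: (big_morph (fun a => ext a 0)) => [a b|]; first by rewrite -extD addr0.
  by apply: rowE_ext => [|k]; rewrite ?ext_max ?ext_lift !mxE.
by rewrite ext_sum; apply: eq_bigr => i _; rewrite mxE.
Qed.

(** Doubling turns 0/1 vectors into sign vectors once the offset with entries -1 is added. *)
Definition chart2 (a : 'rV[int]_m.+2) := ext (a *+ 2) 0.

Lemma Out2E (v y : V2 D) : Out2 v y <-> exists f,
  val y = val v + ext (\row_i (if f i then 1 else -1)) 1.
Proof.
have signE (sgn : nat -> bool) : \sum_(1 <= i < D) (-1) ^+ sgn i *: basis_vec D i + basis_vec D D =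
    ext (\row_(i < m.+2) (-1) ^+ sgn i.+1) 1.
  rewrite big_add1 big_mkord (sum_signs (fun i => (-1) ^+ sgn i.+1)).
  by rewrite basis_max -extD addr0 add0r.
split=> [[sgn H]|[f H]].
  exists [ffun i : 'I_m.+2 => ~~ sgn i.+1]; rewrite H -addrA signE; congr (_ + ext _ _).
  by apply/rowP => i; rewrite !mxE ffunE; case: (sgn _).
exists (fun k => if k is i.+1 then ~~ f (inord i) else true); rewrite H -addrA signE.
congr (_ + ext _ _); apply/rowP => i; rewrite !mxE inord_val.
by case: (f i).
Qed.

Lemma draws2 (R : realType) : draws_for_small_p R (@Out2 D).
Proof.
apply: (@affine_draws R {ffun 'I_m.+2 -> bool} D (V2 D) val) => [|x]; first exact: val_inj.
exists m, step2, chart2, (fun z => z 0 ord_max), (ext (const_mx (-1)) 1), (ext 0 2) => raw.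
have tau_step f : ext (const_mx (-1)) 1 + chart2 (step2 f) = ext (\row_i (if f i then 1 else -1)) 1.
  rewrite /chart2 /step2 -extD addr0; congr (ext _ 1); apply/rowP => i; rewrite mxE mulmxnE !mxE.
  by case: (f i).
have opp_step f : ext 0 2 - ext (\row_i (if f i then 1 else -1)) 1 =
    ext (\row_i (if ~~ f i then 1 else -1)) 1.
  apply: (addIr (ext (\row_i (if f i then 1 else -1)) 1)); rewrite subrK -extD.
  congr (ext _ _); apply/rowP => i; rewrite !mxE.
  by case: (f i).
split.
- split.
  + by exists [ffun=> false]; apply/rowP => i; rewrite !mxE ffunE.
  + by exists [ffun i => i == 0]; apply/rowP => i; rewrite !mxE ffunE.
  + by exists [ffun i => i == 1]; apply/rowP => i; rewrite !mxE ffunE.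
  + by move=> f i; rewrite mxE; case: (f i).
  + by move=> f; rewrite mxE.
- split.
  + by move=> a b; rewrite /chart2 mulrnDl -extD addr0.
  + by move=> a b; rewrite mxE.
  + by move=> a b /ext_inj/rowP E; apply/rowP => i; have := E i; rewrite !mulmxnE => /(@pmulrnI _ 2 isT).
  + by move=> a; rewrite ext_max.
  + by rewrite !ext_max.
- move=> a b k.
  have P : [forall i, forall j, (raw a b k ord0 i == raw a b k ord0 j %[mod 2])%Z].
    have E i : (2 %| raw a b k ord0 i - (val x ord0 i + b%:Z))%Z.
      case: (unliftP ord_max i) => [i'|] ->; rewrite /raw /chart2 mxE mulmxnE mxE mulmxnE mxE.
        rewrite !ext_lift mulmxnE !mxE mul0rn addr0.
        rewrite (_ : _ - _ = (a 0 i' - b%:Z) * 2); first by rewrite dvdz_mull.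
        by case: (b); ring.
      rewrite !ext_max (_ : _ - _ = k%:Z * 2); first by rewrite dvdz_mull.
      by move: (val x _ _) => u; rewrite -(mulr_natr 2) natz; case: (b); ring.
    apply/forallP => i; apply/forallP => j; rewrite eqz_mod_dvd.
    have /forallP/(_ i)/forallP/(_ j) := valP x; rewrite eqz_mod_dvd => xij.
    have -> : raw a b k ord0 i - raw a b k ord0 j = (raw a b k ord0 i - (val x ord0 i + b%:Z)) -
      (raw a b k ord0 j - (val x ord0 j + b%:Z)) + (val x ord0 i - val x ord0 j) by ring.
    by apply: rpredD => //; apply: rpredB.
  by exists (exist _ (raw a b k) P).
- move=> a b k v _ y; rewrite Out2E.
  case: b; split=> -[f H].
  + exists [ffun i => ~~ f i]; rewrite -addrA -opprD tau_step opp_step H; congr (_ + ext _ _).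
    by apply/rowP => i; rewrite !mxE ffunE negbK.
  + exists [ffun i => ~~ f i]; rewrite H -addrA -opprD tau_step opp_step; congr (_ + ext _ _).
    by apply/rowP => i; rewrite !mxE ffunE.
  + by exists f; rewrite tau_step.
  + by exists f; rewrite H tau_step.
Qed.

End Case2.

(** * Steps along subsets of prescribed size *)

Lemma subset_vecE d (S : {set 'I_d}) i : subset_vec S 0 i = (i \in S)%:R.
Proof.
rewrite /subset_vec summxE; have [iS|iS] := boolP (i \in S).
  rewrite (bigD1 i) //= mxE eqxx big1 ?addr0 // => j /andP[_ ji].
  by rewrite mxE eqSS val_eqE eq_sym (negbTE ji).
rewrite big1 // => j jS; rewrite mxE eqSS val_eqE.
by case: eqP => // E; rewrite E jS in iS.
Qed.

Lemma subset_vecC d (S : {set 'I_d}) : subset_vec (~: S) = const_mx 1 - subset_vec S.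
Proof. by apply/rowP => i; rewrite mxE subset_vecE !mxE subset_vecE inE; case: (i \in S). Qed.

Lemma coord_sum_subset d (S : {set 'I_d}) : coord_sum (subset_vec S) = #|S|%:Z.
Proof.
rewrite /coord_sum; under eq_bigr do rewrite subset_vecE.
by rewrite -natr_sum -sum1_card [in RHS]big_mkcond natz.
Qed.

Lemma coord_sum_ones d : coord_sum (const_mx 1 : 'rV[int]_d) = d%:Z.
Proof.
rewrite /coord_sum; under eq_bigr do rewrite mxE.
by rewrite sumr_const card_ord natz.
Qed.

Definition subset_chart d r (J : finType) :=
  exists m (s : J -> 'rV[int]_m.+2) (Phi : 'rV[int]_m.+2 -> 'rV[int]_d) tau,
  [/\ flat_steps s, {morph Phi : a b / a + b}, injective Phi,
    forall a, coord_sum (Phi a) = 0 &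
    forall z, (exists j, z = tau + Phi (s j)) <-> exists2 S : {set 'I_d}, #|S| = r & z = subset_vec S].

Lemma subset_chartC d r (J : finType) : (r <= d)%N ->
  subset_chart d r J -> subset_chart d (d - r) J.
Proof.
move=> rd [m [s [Phi [tau [fs PhiD Phi_inj sumPhi steps]]]]].
exists m, s, (fun a => - Phi a), (const_mx 1 - tau); split=> //.
- by move=> a b; rewrite PhiD opprD.
- by move=> a b /oppr_inj /Phi_inj.
- by move=> a; apply: (addIr (coord_sum (Phi a))); rewrite -coord_sumD addNr coord_sum0 add0r sumPhi.
- move=> z; have E j : const_mx 1 - tau - Phi (s j) = const_mx 1 - (tau + Phi (s j)).
    by rewrite opprD addrA.
  split=> [[j ->]|[S SE ->]].
    have [|S SE SV] := (steps (tau + Phi (s j))).1; first by exists j.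
    exists (~: S)%SET; first by rewrite cardsCs finset.setCK card_ord SE.
    by rewrite E SV subset_vecC.
  have [|j jE] := (steps (subset_vec (~: S))).2.
    by exists (~: S)%SET => //; rewrite cardsCs finset.setCK card_ord SE subKn.
  by exists j; rewrite E -jE subset_vecC opprB addrC subrK.
Qed.

(** The second move of a pair is along the complement of a [q]-subset, and a set and its complement
    add up to the all-ones vector [omega]. The two kinds of starting vertices differ only in [q],
    and [subset_chartC] provides the chart for the other size. *)
Lemma draws4 (R : realType) d r (J : finType) : (0 < r < d)%N ->
  subset_chart d r J -> draws_for_small_p R (@Out4 d r).
Proof.
move=> /andP[r0 rd] chart_r; have chart_dr := subset_chartC (ltnW rd) chart_r.
apply: (@affine_draws R J d (V4 d r) val) => [|x]; first exact: val_inj.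
have d0 : d != 0%N by case: (d) rd.
have clsE (z : V4 d r) : (d %| coord_sum (val z))%Z = (coord_sum (val z) == 0 %[mod d])%Z.
  by rewrite eqz_mod_dvd subr0.
pose q : nat := if (coord_sum (val x) == 0 %[mod d])%Z then r else (d - r)%N.
have [q0 qd] : (0 < q)%N /\ (q < d)%N by rewrite /q; case: ifP => _; lia.
have [m [s [Phi [tau [fs PhiD Phi_inj sumPhi steps]]]]] : subset_chart d q J.
  by rewrite /q; case: ifP.
have sum_tau : coord_sum tau = q%:Z.
  have [[j0 sj0] _ _ _ _] := fs.
  have Phi0 : Phi 0 = 0 by apply: (addrI (Phi 0)); rewrite -PhiD !addr0.
  have [|S SE E] := (steps tau).1; first by exists j0; rewrite sj0 Phi0 addr0.
  by rewrite E coord_sum_subset SE.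
exists m, s, Phi, (@coord_sum d), tau, (const_mx 1) => raw.
have sum_raw a b k : coord_sum (raw a b k) = coord_sum (val x) + q%:Z *+ b + d%:Z *+ k.
  by rewrite /raw !coord_sumD sumPhi addr0 !coord_sumMn sum_tau coord_sum_ones.
have mod_raw a b k t : (coord_sum (raw a b k) == t %[mod d])%Z =
    (coord_sum (val x) + q%:Z *+ b == t %[mod d])%Z.
  rewrite sum_raw -(mulr_natr d%:Z) natz !eqz_mod_dvd addrAC.
  by rewrite rpredDr // dvdz_mulr.
have size_step a b k : (if (coord_sum (raw a b k) == 0 %[mod d])%Z then r else (d - r)%N) =
    (if b then d - q else q)%N.
  rewrite mod_raw; case: b => /=; last by rewrite mulr0n addr0.
  have := valP x; rewrite mulr1n /q; case: (coord_sum (val x) == 0 %[mod d])%Z /idP => /= [x0 _|x0 xr].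
    have -> : (coord_sum (val x) + r%:Z == 0 %[mod d])%Z = false.
      apply/negP => H; move: x0 H; rewrite !eqz_mod_dvd !subr0 => x0.
      by rewrite rpredDl // dvdzE /= gtnNdvd.
    by [].
  have -> : (coord_sum (val x) + (d - r)%:Z == 0 %[mod d])%Z = true.
    move: xr; rewrite !eqz_mod_dvd subr0 -subzn; last exact: ltnW.
    by rewrite addrCA => xr; rewrite rpredD // addrC.
  by rewrite subKn // ltnW.
have OutE a b k (v : V4 d r) : val v = raw a b k -> forall y, Out4 v y <->
    exists2 S : {set 'I_d}, #|S| = (if b then d - q else q)%N & val y = val v + subset_vec S.
  by move=> vE y; rewrite -(size_step a b k) -vE.
split=> //.
- split=> //; first exact: coord_sumD.
  by rewrite coord_sum_ones sum_tau !ltz_nat q0.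
- move=> a b k.
  have P : (coord_sum (raw a b k) == 0 %[mod d])%Z || (coord_sum (raw a b k) == r%:Z %[mod d])%Z.
    rewrite !mod_raw; case: b => /=; last by rewrite mulr0n addr0; exact: (valP x).
    have := valP x; rewrite mulr1n /q; case: (coord_sum (val x) == 0 %[mod d])%Z /idP => /= [x0 _|x0 xr].
      by rewrite orbC; move: x0; rewrite !eqz_mod_dvd subr0 addrK => ->.
    apply/orP; left; move: xr; rewrite !eqz_mod_dvd subr0 -subzn; last exact: ltnW.
    by move=> xr; rewrite addrCA rpredD // addrC.
  by exists (exist _ (raw a b k) P).
- move=> a b k v vE y; rewrite (OutE _ _ _ _ vE); case: b {vE}.
    split=> [[S SE H]|[j H]].
      have [|j jE] := (steps (subset_vec (~: S))).2.
        by exists (~: S)%SET => //; rewrite cardsCs finset.setCK card_ord SE; lia.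
      exists j; rewrite H -addrA -opprD -jE subset_vecC opprB addrC subrK //.
    have [|S SE SV] := (steps (tau + Phi (s j))).1; first by exists j.
    exists (~: S)%SET; first by rewrite cardsCs finset.setCK card_ord SE.
    by rewrite H -addrA -opprD SV subset_vecC.
  split=> [[S SE H]|[j H]].
    have [|j jE] := (steps (subset_vec S)).2; first by exists S.
    by exists j; rewrite H jE.
  have [|S SE SV] := (steps (tau + Phi (s j))).1; first by exists j.
  by exists S; rewrite // H SV.
Qed.

Lemma singleton_chart m : subset_chart m.+3 1 'I_m.+3.
Proof.
pose s (j : 'I_m.+3) : 'rV[int]_m.+2 := if unlift ord_max j is Some i then delta_mx 0 i else 0.
exists m, s, (fun a => ext a (- sum_row a)), (ext 0 1).
have sum0 : sum_row (0 : 'rV_m.+2) = 0 by rewrite /sum_row big1 // => i _; rewrite mxE.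
have sE j : ext 0 1 + ext (s j) (- sum_row (s j)) = subset_vec [set j].
  rewrite -extD add0r /s; case: (unliftP ord_max j) => [i|] ->.
    rewrite sum_row_delta subrr; apply: rowE_ext => [|k]; rewrite subset_vecE inE.
      by rewrite ext_max (negbTE (neq_lift _ _)).
    by rewrite ext_lift mxE eqxx (inj_eq lift_inj).
  rewrite sum0 subr0; apply: rowE_ext => [|k]; rewrite subset_vecE inE ?ext_max ?eqxx //.
  by rewrite ext_lift mxE eq_sym (negbTE (neq_lift _ _)).
split.
- split.
  + by exists ord_max; rewrite /s unlift_none.
  + by exists (lift ord_max 0); rewrite /s liftK.
  + by exists (lift ord_max 1); rewrite /s liftK.
  + by move=> j i; rewrite /s; case: unlift => [k|]; rewrite ?delta_le1 // mxE.
  + by move=> j; rewrite /s; case: unlift => [k|]; rewrite mxE //; case: (_ && _).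
- by move=> a b; rewrite sum_rowD opprD extD.
- by move=> a b /ext_inj.
- by move=> a; rewrite coord_sum_ext -/(sum_row a) subrr.
- move=> z; split=> [[j ->]|[S /eqP/cards1P[j ->] ->]]; last by exists j; rewrite sE.
  by exists [set j]%SET; rewrite ?cards1 // sE.
Qed.

(** The base point is the pair [{2, 3}]. The indicator of 2 is reversed, so that [{0, 2}] and
    [{1, 2}] become unit vectors; that of 3 follows from the size of the set. *)
Lemma pair_chart : subset_chart 4 2 {S : {set 'I_4} | #|S| == 2%N}.
Proof.
pose o0 := @Ordinal 4 0 isT; pose o1 := @Ordinal 4 1 isT.
pose o2 := @Ordinal 4 2 isT; pose o3 := @Ordinal 4 3 isT.
pose s (S : {S : {set 'I_4} | #|S| == 2%N}) : 'rV[int]_3 :=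
  \row_(i < 3) nth 0 [:: (o0 \in val S)%:R; (o1 \in val S)%:R; (o2 \notin val S)%:R] i.
pose Phi (a : 'rV[int]_3) : 'rV[int]_4 :=
  \row_(i < 4) nth 0 [:: a 0 0; a 0 1; - a 0 2; a 0 2 - a 0 0 - a 0 1] i.
pose tau : 'rV[int]_4 := \row_(i < 4) nth 0 [:: 0; 0; 1; 1] i.
exists 1%N, s, Phi, tau.
have sE S : tau + Phi (s S) = subset_vec (val S).
  have card4 (A : {set 'I_4}) : #|A| = ((o0 \in A) + (o1 \in A) + (o2 \in A) + (o3 \in A))%N.
    have F (x y : 'I_4) : x = y -> (if x \in A then 1 else 0)%N = (y \in A) by move=> ->; case: ifP.
    rewrite -sum1_card big_mkcond /= !big_ord_recl big_ord0 addn0 !addnA.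
    by congr (_ + _ + _ + _)%N; apply: F; exact: val_inj.
  have /eqP := valP S; rewrite card4 => c4; apply/rowP => k; rewrite subset_vecE !mxE.
  case: k => -[|[|[|[|//]]]] lt /=; [rewrite add0r|rewrite add0r| |].
  - by rewrite (_ : Ordinal lt = o0) //; exact: val_inj.
  - by rewrite (_ : Ordinal lt = o1) //; exact: val_inj.
  - by rewrite (_ : Ordinal lt = o2); [case: (o2 \in _)|exact: val_inj].
  - rewrite (_ : Ordinal lt = o3); last exact: val_inj.
    by move: c4; case: (o0 \in _); case: (o1 \in _); case: (o2 \in _); case: (o3 \in _).
have pick (S : {set 'I_4}) : #|S| == 2%N -> exists2 S', tau + Phi (s S') = subset_vec S & val S' = S.
  by move=> S2; exists (Sub S S2); rewrite ?sE SubK.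
split.
- split.
  + have [S _ SE] := pick [set o2; o3]%SET (introT eqP (cards2 o2 o3)).
    by exists S; apply/rowP => -[[|[|[|//]]] lt]; rewrite !mxE /= SE !inE.
  + have [S _ SE] := pick [set o0; o2]%SET (introT eqP (cards2 o0 o2)).
    by exists S; apply/rowP => -[[|[|[|//]]] lt]; rewrite !mxE /= SE !inE.
  + have [S _ SE] := pick [set o1; o2]%SET (introT eqP (cards2 o1 o2)).
    by exists S; apply/rowP => -[[|[|[|//]]] lt]; rewrite !mxE /= SE !inE.
  + move=> S [[|[|[|//]]] lt]; rewrite mxE /=; case: (_ \in _) => //.
  + by move=> S; rewrite mxE /=; case: (_ \in _).
- move=> a b; apply/rowP => -[[|[|[|[|//]]]] lt]; rewrite !mxE /=; ring.
- move=> a b /rowP E; apply/rowP => -[[|[|[|//]]] lt].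
  + by have := E 0; rewrite !mxE /= => E0; rewrite (_ : Ordinal lt = 0) //; apply: val_inj.
  + by have := E 1; rewrite !mxE /= => E0; rewrite (_ : Ordinal lt = 1) //; apply: val_inj.
  + by have := E (inord 2); rewrite !mxE inordK //= => /oppr_inj E0; rewrite (_ : Ordinal lt = 2) //; apply: val_inj.
- by move=> a; rewrite /coord_sum !big_ord_recl big_ord0 !mxE /=; ring.
- move=> z; split=> [[S ->]|[S /eqP /pick[S' SE _] ->]]; last by exists S'; rewrite SE.
  by exists (val S); [exact/eqP/(valP S)|rewrite sE].
Qed.

(** * Steps along proper subsets of three coordinates, projected to the triangular lattice *)

Section TriangularTorus.
Variable n : nat.
(* The centre [M.+1] and the circumference [M.+1.*2] are multiples of 3. *)
Local Notation M := (3 * n + 2)%N.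
Local Notation N := M.*2.
Local Notation Gam := 'rV['Z_N.+2]_2.

Definition tri_class (a : Gam) : 'Z_3 := (nat_of_ord (a 0 0))%:R + (nat_of_ord (a 0 1))%:R.

Lemma Zp3_modn k : (k %% N.+2)%:R = k%:R :> 'Z_3.
Proof.
have N3 : (N.+2 = 3 * (2 * n + 2))%N by lia.
rewrite {2}(divn_eq k N.+2) natrD natrM {3}N3 natrM.
have -> : 3%:R = 0 :> 'Z_3 by exact: val_inj.
by rewrite mul0r mulr0 add0r.
Qed.

Lemma Zp3_add (x y : 'Z_N.+2) :
  (nat_of_ord (x + y))%:R = (nat_of_ord x)%:R + (nat_of_ord y)%:R :> 'Z_3.
Proof. by rewrite /= Zp3_modn natrD. Qed.

Fact tri_class_is_additive : {morph tri_class : a b / a - b}.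
Proof.
have B (x y : 'Z_N.+2) : (nat_of_ord (x - y))%:R = (nat_of_ord x)%:R - (nat_of_ord y)%:R :> 'Z_3.
  by apply/eqP; rewrite eq_sym subr_eq -Zp3_add subrK.
by move=> a b; rewrite /tri_class !mxE !B opprD addrACA.
Qed.

HB.instance Definition _ := GRing.isZmodMorphism.Build _ _ tri_class tri_class_is_additive.

Definition tri_e1 : Gam := delta_mx 0 0.
Definition tri_e2 : Gam := delta_mx 0 1.

Definition nb1 (k : 'I_7) : int := nth 0 [:: 0; 1; 1; 0; -1; -1; 0] k.
Definition nb2 (k : 'I_7) : int := nth 0 [:: 0; 0; 1; 1; 0; -1; -1] k.
(** Projection along (1, 1, 1) sends the six proper nonempty subsets to the six directions; [nb3 k]
    is the third coordinate of the subset above direction [k]. *)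
Definition nb3 (k : 'I_7) : int := nth 0 [:: 0; 0; 0; 0; 1; 1; 1] k.

Local Notation nbr := (nb tri_e1 tri_e2).
Local Notation tri_edge := (tri_rel tri_e1 tri_e2).

Lemma tri_stepE : ((tri_e1 0 0 = 1) * (tri_e1 0 1 = 0)) * ((tri_e2 0 0 = 0) * (tri_e2 0 1 = 1)).
Proof. by rewrite !mxE. Qed.

Lemma row_entryE : (forall (a b : Gam) j, (a + b) 0 j = a 0 j + b 0 j) *
  (forall (a : Gam) j, (- a) 0 j = - a 0 j) * (forall j, (0 : Gam) 0 j = 0).
Proof. by split; [split|] => *; rewrite mxE. Qed.

Lemma nbr0 k : nbr k 0 0 = (nb1 k)%:~R.
Proof.
case: k => -[|[|[|[|[|[|[|//]]]]]]] lt; rewrite /nb /nb1 [nth _ _ _]/= [nth _ _ _]/= ?row_entryE;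
  by rewrite ?row_entryE ?tri_stepE ?addr0 ?oppr0.
Qed.

Lemma nbr1 k : nbr k 0 1 = (nb2 k)%:~R.
Proof.
case: k => -[|[|[|[|[|[|[|//]]]]]]] lt; rewrite /nb /nb2 [nth _ _ _]/= [nth _ _ _]/= ?row_entryE;
  by rewrite ?row_entryE ?tri_stepE ?add0r ?oppr0.
Qed.

Lemma cle1 : tri_class tri_e1 = 1. Proof. by rewrite /tri_class !tri_stepE; exact: val_inj. Qed.
Lemma cle2 : tri_class tri_e2 = 1. Proof. by rewrite /tri_class !tri_stepE; exact: val_inj. Qed.

Lemma tri_sym : symmetric tri_edge.
Proof.
suff H u v : tri_edge u v -> tri_edge v u by move=> u v; apply/idP/idP; exact: H.
move=> /existsP[k /andP[k0 /eqP ->]]; have [k' k'E] := nb_opp tri_e1 tri_e2 k.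
apply/existsP; exists k'; rewrite k'E addrK eqxx andbT.
apply: contraNneq (cl_nb_neq0 cle1 cle2 k0) => k'0.
by rewrite -oppr_eq0 -raddfN /= -k'E k'0 nb0 raddf0.
Qed.

Lemma tri_class_edge u v : tri_edge u v -> tri_class u <> tri_class v.
Proof.
move=> /existsP[k /andP[k0 /eqP ->]]; rewrite raddfD /= => /eqP.
by rewrite -subr_eq0 opprD addrA subrr add0r oppr_eq0 (negbTE (cl_nb_neq0 cle1 cle2 k0)).
Qed.

Lemma tri_irr : irreflexive tri_edge.
Proof. by move=> u; apply/negbTE/negP => H; case: (tri_class_edge H). Qed.

Lemma ground_indep i : indep tri_edge (ground tri_class i).
Proof.
apply/indepP => u v; rewrite !inE => /eqP ui /eqP vi; apply/negP => H.
by apply: (tri_class_edge H); rewrite ui vi.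
Qed.

Definition tri_box : {set Gam} := tbox (coord 0) (coord 1) 3 (N - 1).

Lemma mem_tri_box v : (v \in tri_box) = margin 0 (v 0 0) && margin 0 (v 0 1).
Proof. by rewrite inE /margin addn0 subn0. Qed.

Lemma nb_le1 k : `|nb1 k| <= 1 /\ `|nb2 k| <= 1.
Proof. by case: k => -[|[|[|[|[|[|[|//]]]]]]] lt. Qed.

Lemma deep_tri_box k (v : Gam) : margin k (v 0 0) -> margin k (v 0 1) -> deep tri_edge tri_box k v.
Proof.
elim: k v => // k IH v m0 m1 /=; rewrite mem_tri_box.
have W x : margin k.+1 x -> margin (M := M) 0 x.
  by rewrite /margin; move: (nat_of_ord x) => w; lia.
rewrite !W //=; apply/forallP => w; apply/implyP => /existsP[j /andP[_ /eqP ->]].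
have [j1 j2] := nb_le1 j.
by apply: IH; rewrite mxE ?nbr0 ?nbr1; exact: margin_shift.
Qed.

Lemma tri_class_centered (a : Gam) :
  (nat_of_ord (tri_class a))%:Z = ((centered (a 0%R 0%R) + centered (a 0%R 1%R)) %% 3)%Z.
Proof.
rewrite /tri_class -natrD val_Zp_nat // /centered.
move: (nat_of_ord _) (nat_of_ord _) => u w.
rewrite (_ : w%:Z - _ + _ = (w + u)%:Z - (2 * n + 2)%:Z * 3); last by lia.
by rewrite -mulNr addrC modzMDl modz_nat.
Qed.

Lemma tri_stable (R : realFieldType) (la y : R) i v : 0 < la -> 0 <= y -> y <= 1 ->
  la^-1 <= y ^+ 9 -> 6%:R * 49%:R ^+ 2 * (2%:R ^+ 49 * y) <= 1 ->
  \sum_(I in hc_conf tri_edge tri_box (ground tri_class i) | ~~ correct tri_class tri_e1 tri_e2 I i v)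
      la ^+ #|I| <=
    6%:R * 49%:R ^+ 2 * (2%:R ^+ 49 * y) *
      \sum_(I in hc_conf tri_edge tri_box (ground tri_class i)) la ^+ #|I|.
Proof.
move=> la0 y0 y1 lay small; apply: tri_phase_stable => //.
- by change (tri_e1 0 0 = 1); rewrite tri_stepE.
- by change (tri_e1 0 1 = 0); rewrite tri_stepE.
- by change (tri_e2 0 0 = 0); rewrite tri_stepE.
- by change (tri_e2 0 1 = 1); rewrite tri_stepE.
- exact: cle1.
- exact: cle2.
- apply/rowP => i'; rewrite /tri_e1 mulmxnE !mxE.
  by case: (_ && _) => /=; rewrite ?mul0rn // pchar_Zp.
- lia.
Qed.

(** Chosen such that the coordinate sum of [tri_pos x v j - x] is [3 * j] plus the class of [v]. A
    move raises this sum by 1 or 2, so the time goes up exactly when the class drops. *)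
Definition tri_height (u : int) (j : nat) : int := j%:Z - (u %/ 3)%Z.

Definition tri_pos (x : 'rV[int]_3) (v : Gam) j : 'rV[int]_3 :=
  let u1 := centered (v 0 0) in let u2 := centered (v 0 1) in
  let c := tri_height (u1 + u2) j in x + \row_(i < 3) nth 0 [:: u1 + c; u2 + c; c] i.

Lemma tri_pos_inj x : injective (fun vj => tri_pos x vj.1 vj.2).
Proof.
move=> [v j] [w k] /= /addrI/rowP E.
have := E 0; have := E 1; have := E (inord 2); rewrite !mxE /= inordK //= => E2.
rewrite -E2 => /addIr E1 /addIr E0.
have vw : v = w.
  by apply/rowP => -[[|[|//]] lt]; apply: (@centered_inj M); [move: E0|move: E1];
    congr (centered (v _ _) = centered (w _ _)); exact: val_inj.
by move: E2; rewrite vw => /addIr [->].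
Qed.

Definition nb_vec k : 'rV[int]_3 := \row_(i < 3) nth 0 [:: nb1 k + nb3 k; nb2 k + nb3 k; nb3 k] i.

Lemma nb_vec_subset z : (exists2 k, k != ord0 & z = nb_vec k) <->
  (exists2 S : {set 'I_3}, (1 <= #|S| <= 3 - 1)%N & z = subset_vec S).
Proof.
have card3 (A : {set 'I_3}) : #|A| = ((0%R \in A) + (1%R \in A) + (2%:R%R \in A))%N.
  have F (x y : 'I_3) : x = y -> (if x \in A then 1 else 0)%N = (y \in A) by move=> ->; case: ifP.
  rewrite -sum1_card big_mkcond /= !big_ord_recl big_ord0 addn0 !addnA.
  by congr (_ + _ + _)%N; apply: F; exact: val_inj.
have vec b0 b1 b2 (S : {set 'I_3}) k : (0 \in S) = b0 -> (1 \in S) = b1 -> (2%:R \in S) = b2 ->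
    nb1 k + nb3 k = b0%:R -> nb2 k + nb3 k = b1%:R -> nb3 k = b2%:R -> nb_vec k = subset_vec S.
  move=> S0 S1 S2 k0 k1 k2; apply/rowP => i; rewrite subset_vecE mxE k0 k1 k2 -S0 -S1 -S2.
  have G (x y : 'I_3) : x = y -> (x \in S)%:R = (y \in S)%:R :> int by move=> ->.
  by case: i => -[|[|[|//]]] lt /=; apply: G; exact: val_inj.
pose o k (lt : (k < 7)%N) := Ordinal lt.
split=> [[k k0 ->]|[S SE ->]].
  exists [set i : 'I_3 | nb_vec k 0 i == 1]%SET.
    by rewrite card3 !inE !mxE; case: k k0 => -[|[|[|[|[|[|[|//]]]]]]] lt.
  apply/rowP => i; rewrite subset_vecE inE.
  by rewrite mxE; case: k k0 => -[|[|[|[|[|[|[|//]]]]]]] lt //=; case: i => -[|[|[|//]]].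
move: SE; rewrite card3.
case S0 : (0 \in S); case S1 : (1 \in S); case S2 : (2%:R \in S) => //= _.
- by exists (o 2 isT) => //; apply/esym/(vec _ _ _ _ _ S0 S1 S2).
- by exists (o 6 isT) => //; apply/esym/(vec _ _ _ _ _ S0 S1 S2).
- by exists (o 1%N isT) => //; apply/esym/(vec _ _ _ _ _ S0 S1 S2).
- by exists (o 4 isT) => //; apply/esym/(vec _ _ _ _ _ S0 S1 S2).
- by exists (o 3 isT) => //; apply/esym/(vec _ _ _ _ _ S0 S1 S2).
- by exists (o 5 isT) => //; apply/esym/(vec _ _ _ _ _ S0 S1 S2).
Qed.

Lemma tri_pos_step x v j k : v \in tri_box ->
  tri_pos x (v + nbr k) (j + (tri_class (v + nbr k)%R < tri_class v)%N)%N = tri_pos x v j + nb_vec k.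
Proof.
rewrite mem_tri_box => /andP[m0 m1]; have [k1 k2] := nb_le1 k.
have W y : margin (M := M) 0 y -> (0 < y < N.+1)%N.
  by rewrite /margin; move: (nat_of_ord y) => w; lia.
have c1 := tri_class_centered v; have := tri_class_centered (v + nbr k).
rewrite /tri_pos !row_entryE nbr0 nbr1 !centered_shift ?W //.
move: c1; move: (centered (v 0 0)) (centered (v 0 1)) => u w.
move: (nat_of_ord (tri_class v)) (nat_of_ord (tri_class (v + _))) => r r' c1 c2.
rewrite -[RHS]addrA; congr (_ + _).
have H : tri_height (u + nb1 k + (w + nb2 k)) (j + (r' < r))%N = tri_height (u + w) j + nb3 k.
  move: c1 c2; rewrite /tri_height /nb1 /nb2 /nb3.
  case: k {k1 k2} => -[|[|[|[|[|[|[|//]]]]]]] lt; rewrite [nth _ _ _]/= [nth _ _ _]/= [nth _ _ _]/=; lia.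
rewrite H; apply/rowP => -[[|[|[|//]]] lt]; rewrite !mxE /=; ring.
Qed.

End TriangularTorus.

Lemma Out3_finite x : finite_set (@Out3 3 x).
Proof.
have -> : @Out3 3 x =
    ((fun S : {set 'I_3} => (x + subset_vec S)%R : V3 3) @` [set S : {set 'I_3} | (1 <= #|S| <= 3 - 1)%N])%classic.
  apply/predeqP => y; split=> [[S SE ->]|[S /= SE <-]]; exists S => //.
by apply: finite_image; exact: finite_finset.
Qed.

Lemma tri_undecided (R : realType) (p y : R) d (Omega : measurableType d)
    (P : probability Omega R) (E : V3 3 -> set Omega) x n : random_traps p P E ->
  0 < p < 1 -> 0 <= y <= 1 -> p / (1 - p) <= y ^+ 9 ->
  6%:R * 49%:R ^+ 2 * (2%:R ^+ 49 * y) <= 4%:R^-1 ->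
  ((2%:R^-1)%:E <= P (undecided_event E (@Out3 3) n x))%E.
Proof.
move=> traps /andP[p0 p1] /andP[y0 y1] ty ysmall.
pose v0 : 'rV['Z_(3 * n + 2).*2.+2]_2 := const_mx (3 * n + 2).+1%:R.
pose ep : R := 4%:R^-1.
have q0 : 0 < 1 - p by rewrite subr_gt0.
have la0 : 0 < (1 - p) / p by rewrite divr_gt0.
have class0 : tri_class v0 = 0.
  apply: val_inj; have := tri_class_centered v0; rewrite !mxE !centered_center.
  by move=> /= [->].
have pos0 : tri_pos x v0 0 = x.
  rewrite /tri_pos !mxE !centered_center -[RHS]addr0; congr (_ + _).
  by apply/rowP => -[[|[|[|//]]] lt]; rewrite !mxE.
have stab i v : \sum_(I in hc_conf (tri_rel (tri_e1 n) (tri_e2 n)) (tri_box n) (ground (@tri_class n) i)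
      | ~~ correct (@tri_class n) (tri_e1 n) (tri_e2 n) I i v) ((1 - p) / p) ^+ #|I| <=
    ep * \sum_(I in hc_conf (tri_rel (tri_e1 n) (tri_e2 n)) (tri_box n) (ground (@tri_class n) i))
      ((1 - p) / p) ^+ #|I|.
  apply: (le_trans (@tri_stable n R _ y i v la0 y0 y1 _ _)).
  - by rewrite invf_div.
  - by apply: (le_trans ysmall); rewrite invf_le1 // ler1n.
  - by rewrite ler_wpM2r // sumr_ge0 // => I _; rewrite exprn_ge0 // ltW.
have sub i (Q : pred {set _}) : (forall I : {set _}, Q I -> ~~ correct (@tri_class n) (tri_e1 n) (tri_e2 n) I i v0) ->
    \sum_(I in hc_conf (tri_rel (tri_e1 n) (tri_e2 n)) (tri_box n) (ground (@tri_class n) i) | Q I)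
      ((1 - p) / p) ^+ #|I| <=
    ep * \sum_(I in hc_conf (tri_rel (tri_e1 n) (tri_e2 n)) (tri_box n) (ground (@tri_class n) i))
      ((1 - p) / p) ^+ #|I|.
  move=> QI; apply: le_trans (stab i v0); rewrite !big_mkcondr /=; apply: ler_sum => I _.
  case: ifP => [/QI ->//|_]; case: ifP => // _; rewrite exprn_ge0 // ltW //.
have mem0 i I : correct (@tri_class n) (tri_e1 n) (tri_e2 n) I i v0 -> (v0 \in I) = (0 == i).
  by move=> /correctP/(_ ord0); rewrite nb0 addr0 => ->; congr (_ == _); exact: class0.
have -> : (2%:R^-1 : R) = 1 - 2 * ep by rewrite /ep; lra.
rewrite -{1}pos0.
(* The centre [v0] has class 0, so it is occupied in phase 0 and empty in phase 1; two of the three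
   phases suffice. *)
apply: (undecided_lower_bound Out3_finite traps (T := 'rV['Z_(3 * n + 2).*2.+2]_2)
  (e := tri_rel (tri_e1 n) (tri_e2 n))
  (cls := fun v => nat_of_ord (tri_class v)) (L := tri_box n)
  (I0 := ground (@tri_class n) 0) (I1 := ground (@tri_class n) 1)
  (pos := tri_pos x) (v0 := v0)).
- exact: tri_sym.
- exact: tri_irr.
- by move=> v w /tri_class_edge H /val_inj.
- exact: tri_pos_inj.
- move=> v j vL z; split.
    case=> S SE ->; have [|k k0 ->] := (nb_vec_subset (subset_vec S)).2; first by exists S.
    exists (v + nb (tri_e1 n) (tri_e2 n) k); last by rewrite tri_pos_step.
    by apply/existsP; exists k; rewrite k0 /=.
  case=> w /existsP[k /andP[k0 /eqP ->]] ->; rewrite tri_pos_step //.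
  have [|S SE SV] := (nb_vec_subset (nb_vec k)).1; first by exists k.
  by exists S => //; rewrite SV.
- by rewrite mem_tri_box !mxE !margin_center //; lia.
- by apply: deep_tri_box; rewrite mxE margin_center //; lia.
- by rewrite p0.
- exact: ground_indep.
- exact: ground_indep.
- by apply: sub => I; apply: contra => /mem0 ->.
- by apply: sub => I; apply: contraTN => /mem0 ->.
Qed.

Lemma draws3 (R : realType) : draws_for_small_p R (@Out3 3).
Proof.
have [|y /andP[y0 y1] ysmall] := @small_rate R (6%:R * 49%:R ^+ 2 * 2%:R ^+ 49).
  by rewrite !mulr_ge0 ?exprn_ge0.
exists (Num.min 2%:R^-1 (y ^+ 9 / 2%:R)).
  by rewrite lt_min invr_gt0 ltr0n divr_gt0 ?exprn_gt0.
move=> p /andP[p0]; rewrite lt_min => /andP[p2 py] d Omega P E traps x.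
have t2 := odds_le p0 (ltW p2).
apply: (draw_positive traps Out3_finite (c := 2%:R^-1)); first by rewrite invr_gt0.
move=> n; apply: (tri_undecided (y := y) _ _ traps).
- by rewrite p0; lra.
- by rewrite y1 ltW.
- by lra.
- by rewrite [leLHS]mulrA.
Qed.

Theorem theorem3 (R : realType) :
  [/\ (forall d : nat, (3 <= d)%N -> draws_for_small_p R (@Out1 d)),
      (draws_for_small_p R (@Out2 3) /\ draws_for_small_p R (@Out2 4)),
      draws_for_small_p R (@Out3 3) &
      [/\ draws_for_small_p R (@Out4 3 1),
          draws_for_small_p R (@Out4 4 1) &
          draws_for_small_p R (@Out4 4 2)]].
Proof.
split.
- by case=> [|[|[|m]]] // _; exact: draws1.
- by split; exact: draws2.
- exact: draws3.
- split; [| |exact: draws4 pair_chart];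
    by apply: draws4 (singleton_chart _).
Qed.
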